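(* Let $G$ be a Brink-Howlett groupoid for $(W,S)$. Let $X$ denote either $R$, $M$, $N$, $P$ or $Q$. Then there is a signed groupoid-set $(G,\Upsilon_X)$ as follows. For an object $J\subseteq\Pi$ of $G$, $\Upsilon_X(J):=X_J\times\{\pm\}$ is the signed set with $(X_J\times\{\pm\})^+=X_J\times\{+\}$ and $\{\pm\}$-action $\epsilon(U,\eta)=(U,\epsilon\eta)$ for $U\in X_J$, $\epsilon,\eta\in\{\pm\}$. For each morphism $(K,w,J)$ of $G$, the map $\Upsilon_X(K,w,J)\colon X_J\times\{\pm\}\to X_K\times\{\pm\}$ is $$(U,\epsilon)\mapsto (wUw^{-1},(-1)^{\eta(w,U,J)}\epsilon),\qquad U\in X_J,\ \epsilon\in\{\pm\},$$ where $\eta(w,U,J)$ is equal to $1$ if $(U\setminus W_J)\cap T\subseteq N(w^{-1})$ and to $0$ otherwise (in which case $(U\setminus W_J)\cap N(w^{-1})=\emptyset$). Further: (a) Let $(U,\epsilon)\in\Upsilon_X(J)$. Then $(U,\epsilon)\in(\Upsilon_X(J))^{\mathrm{re}}$ (i.e. $(U,\epsilon)$ is a real root) if and only if $|\Phi_U^+\setminus\Phi_J^+|<\infty$, if and only if $|(U\setminus W_J)\cap T|<\infty$. (b) $(G,\Upsilon_Q)\subseteq(G,\Upsilon_P)\subseteq(G,\Upsilon_M)\subseteq(G,\Upsilon_R)$ and $(G,\Upsilon_Q)\subseteq(G,\Upsilon_N)\subseteq(G,\Upsilon_R)$. (c) $(G,\Upsilon_R^{\mathrm{re}})=(G,\Upsilon_N)$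 and $(G,\Upsilon_M^{\mathrm{re}})=(G,\Upsilon_P^{\mathrm{re}})=(G,\Upsilon_Q)$. (d) There are isomorphisms $(G,\Lambda^{\mathrm{rec}})\cong(G,\Upsilon_X^{\mathrm{rec}})\cong(G,\Upsilon_Q)$ of signed $G$-sets.
   Context: **Based root systems.** $\operatorname{cone}(X)$ is the set of finite non-negative linear combinations of elements of $X$ (including $0$). $(V,B)$ is a real vector space with a symmetric bilinear form; for $B(\alpha,\alpha)\neq 0$, $s_\alpha(v)=v-\frac{2B(v,\alpha)}{B(\alpha,\alpha)}\alpha$. $(\Phi,\Pi)$ is a based root system in $(V,B)$ with associated Coxeter system $(W,S)$: $\Pi\subseteq V$; $\operatorname{cone}(\Pi)\cap\operatorname{cone}(-\Pi)=\{0\}$; for all $\alpha\in\Pi$, $\alpha\notin\operatorname{cone}(\Pi\setminus\{\alpha\})$ and $B(\alpha,\alpha)=1$; $S=\{s_\alpha\mid\alpha\in\Pi\}$, $W=\langle S\rangle$; $\Phi=\{w\alpha\mid w\in W,\alpha\in\Pi\}$ satisfies $\Phi=\Phi^+\cup\Phi^-$ where $\Phi^{\pm}=\Phi\cap\operatorname{cone}(\pm\Pi)$. The rank may be infinite. $T=\{s_\alpha\mid\alpha\in\Phi\}$; $N(w)=\{t\in T\mid\ell(tw)<\ell(w)\}$ with $\ell$ the standard length function. For $J\subseteq\Pi$, $W_J=\langle s_\alpha\mid\alpha\in J\rangle$; parabolic subgroups are the $W$-conjugates of the $W_J$. **Reflection subgroups.** A reflection subgroup is a subgroup $U=\langle U\cap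 T\rangle$ of $W$. $\chi(U)=\{t\in T\mid N(t)\cap U=\{t\}\}$ is its canonical set of Coxeter generators; $\Phi_U=\{\alpha\in\Phi\mid s_\alpha\in U\}$, $\Phi_U^+=\Phi_U\cap\Phi^+$, $\Pi_U=\{\alpha\in\Phi^+\mid s_\alpha\in\chi(U)\}$; $\Phi_J=\Phi_{W_J}$, $\Phi_J^+=\Phi_{W_J}^+$. For reflection subgroups $U'\subseteq U$, $\operatorname{corank}_U(U')$ is the minimum cardinality of $T'\subseteq U\cap T$ with $U=\langle(U'\cap T)\cup T'\rangle$. If $W_J\subseteq U$ then $J\subseteq\Pi_U$ and $\operatorname{corank}_U(W_J)=|\Pi_U\setminus J|$. For $J\subseteq\Pi$: $R_J$ is the set of reflection subgroups $U\supseteq W_J$ with $\operatorname{corank}_U(W_J)=1$; $N_J$ is the set of $U\in R_J$ with $(U\setminus W_J)\cap T$ finite; $M_J$ is the set of inclusion-maximal elements of $R_J$; $P_J$ is the set of $U\in R_J$ which are parabolic subgroups of $W$; $Q_J=P_J\cap N_J$. **Brink-Howlett groupoids.** The full Brink-Howlett groupoid has as objects the subsets of $\Pi$; a morphism $J\to K$ is a triple $(K,w,J)$ with $w\in W$, $w(J)=K$; composition $(L,v,K)(K,w,J)=(L,vw,J)$. A Brink-Howlett groupoid of $(W,S)$ is a union of connected components of it. **Signed groupoid-sets.** A definitely signed set is a set $X$ with a free $\{\pm1\}$-action and a chosen set $X^+$ of orbit representatives (positive elements); $X^-=-X^+$; morphisms are $\{\pm1\}$-equivariant maps. A signed groupoid-set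 (signed $G$-set) $(G,X)$ is a groupoid $G$ with a functor $X$ from $G$ to definitely signed sets. Write $gx=X(g)(x)$. A morphism of signed $G$-sets $(G,X)\to(G,Y)$ is a natural transformation whose components preserve positivity; isomorphism is in the resulting category. $(G,X)\subseteq(G,Y)$ means that there is such a morphism all of whose components are inclusion maps. A root $x\in X(a)$ is real if for some morphism $g$ with domain $a$, $gx$ and $x$ have different signs; $X^{\mathrm{re}}$ is the signed $G$-subset of real roots. Two roots $x,y\in X(a)$ are parallel if $gx$ and $gy$ have the same sign for all morphisms $g$ with domain $a$. The real compression $(G,X^{\mathrm{rec}})$ has $X^{\mathrm{rec}}(a)$ equal to the set of parallelism classes of real roots in $X(a)$, with $g[x]=[gx]$, $-[x]=[-x]$, and $[x]$ positive iff $x$ is. $(G,\Lambda)$ is the signed $G$-set with $\Lambda(J)=\Phi$ (positive elements $\Phi^+$, usual negation) for every object $J$ and $\Lambda(K,w,J)(\alpha)=w\alpha$. *)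

(* Defs.v *)
From HB Require Import structures.
From mathcomp Require Import all_boot all_order all_algebra.
From mathcomp Require Import all_classical reals.
From mathcomp Require Import ring.
Set Implicit Arguments.
Unset Strict Implicit.
Unset Printing Implicit Defensive.
Import Order.TTheory GRing.Theory Num.Theory.
Local Open Scope classical_set_scope.
Local Open Scope ring_scope.

Section GeneralLinear.
Context {R : realType} (V : lmodType R).

(* V may be infinite-dimensional.  Carrying the inverse map does not change
   equality of elements, see [gl_eqP]. *)
Record gl := Gl {
  gl_fun :> V -> V;
  gl_inv : V -> V;
  gl_linear : linear gl_fun;
  gl_funK : cancel gl_fun gl_inv;
  gl_invK : cancel gl_inv gl_fun }.

HB.instance Definition _ (g : gl) :=
  GRing.isLinear.Build R V V *:%R g (gl_linear g).

Lemma gl_eqP (g h : gl) : (g : V -> V) =1 h -> g = h.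
Proof.
case: g h => [f f' lf fK f'K] [k k' lk kK k'K] /= /funext fk.
subst k; have ff' : f' = k' by apply/funext => v; rewrite -{1}(k'K v) fK.
subst k'; rewrite (Prop_irrelevance lf lk) (Prop_irrelevance fK kK).
by rewrite (Prop_irrelevance f'K k'K).
Qed.

HB.instance Definition _ := gen_eqMixin gl.
HB.instance Definition _ := gen_choiceMixin gl.

Definition gl_one : gl :=
  @Gl id id (fun _ _ _ => erefl) (fun=> erefl) (fun=> erefl).

Lemma gl_mul_linear (g h : gl) : linear (g \o h).
Proof. by move=> a u v; rewrite /= !linearP. Qed.

Lemma gl_inv_linear (g : gl) : linear (gl_inv g).
Proof.
move=> a u v; apply: (can_inj (gl_funK g)).
by rewrite (gl_linear g) !gl_invK.
Qed.

Definition gl_mul (g h : gl) : gl :=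
  Gl (@gl_mul_linear g h)
     (can_comp (gl_funK g) (gl_funK h)) (can_comp (gl_invK h) (gl_invK g)).

Definition gl_invg (g : gl) : gl :=
  Gl (@gl_inv_linear g) (gl_invK g) (gl_funK g).

Lemma gl_mulA : associative gl_mul.
Proof. by move=> f g h; apply: gl_eqP. Qed.
Lemma gl_mul1 : left_id gl_one gl_mul.
Proof. by move=> g; apply: gl_eqP. Qed.
Lemma gl_mulr1 : right_id gl_one gl_mul.
Proof. by move=> g; apply: gl_eqP. Qed.
Lemma gl_mulV : left_inverse gl_one gl_invg gl_mul.
Proof. by move=> g; apply: gl_eqP => v /=; rewrite gl_funK. Qed.
Lemma gl_mulrV : right_inverse gl_one gl_invg gl_mul.
Proof. by move=> g; apply: gl_eqP => v /=; rewrite gl_invK. Qed.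

HB.instance Definition _ :=
  isGroup.Build gl gl_mulA gl_mul1 gl_mulr1 gl_mulV gl_mulrV.

Lemma glME (g h : gl) v : (g * h)%g v = g (h v). Proof. by []. Qed.
Lemma gl1E v : (1%g : gl) v = v. Proof. by []. Qed.
Lemma glKV (g : gl) v : g ((g^-1)%g v) = v. Proof. exact: gl_invK. Qed.
Lemma glVK (g : gl) v : (g^-1)%g (g v) = v. Proof. exact: gl_funK. Qed.

End GeneralLinear.

Section Subgroups.
Context {gT : groupType}.
Implicit Types (A U : set gT) (w : gT).

Definition subgroup U : Prop := group_closed (mem U).

Definition gen A : set gT := smallest subgroup A.

Definition conj_set w U : set gT := [set (w * u * w^-1)%g | u in U].

Lemma gen_subgroup A : subgroup (gen A).
Proof.
split=> [|x y]; first by rewrite inE => H [[+ _] _]; rewrite inE.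
rewrite !inE => gx gy H AH; have [[_ HD] _] := AH.
have := HD x y; rewrite !inE; apply; [exact: gx | exact: gy].
Qed.

Lemma gen1 A : gen A 1%g.
Proof. by have [] := gen_subgroup A; rewrite inE. Qed.

Lemma genV A x : gen A x -> gen A x^-1%g.
Proof.
move=> gx; have /group_closedV := gen_subgroup A.
by move=> /(_ x); rewrite !inE; apply.
Qed.

Lemma genM A x y : gen A x -> gen A y -> gen A (x * y)%g.
Proof.
move=> gx gy; have /group_closedM := gen_subgroup A.
by move=> /(_ x y); rewrite !inE; apply.
Qed.

End Subgroups.

Section Reflections.
Context {R : realType} {V : lmodType R}.

Definition cone (X : set V) : set V :=
  [set v | exists n (x : 'I_n -> V) (c : 'I_n -> R),
     [/\ forall i, X (x i), forall i, 0 <= c i & v = \sum_(i < n) c i *: x i]].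

Variable B : {symmetric V}.

(* When [B a a = 0] this is the identity, since [x / 0 = 0]; it is only ever
   used for roots, where [B a a = 1]. *)
Definition refl_fun (a v : V) : V := v - (2 * B v a / B a a) *: a.

Lemma refl_linear a : linear (refl_fun a).
Proof.
move=> k u v; rewrite /refl_fun linearPl mulrDr mulrDl scalerDl opprD.
rewrite scalerBr addrACA; congr (_ - _ + _).
by rewrite scalerA /= mulrCA -!mulrA.
Qed.

Lemma refl_funK a : involutive (refl_fun a).
Proof.
move=> v; rewrite /refl_fun; have [B0|B0] := eqVneq (B a a) 0.
  by rewrite B0 invr0 !mulr0 scale0r !subr0.
rewrite linearBl linearZl_LR /=.
set c := 2 * B v a / B a a.
have -> : 2 * (B v a - c * B a a) / B a a = - c by rewrite /c; field.
by rewrite scaleNr opprK subrK.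
Qed.

Definition refl (a : V) : gl V :=
  Gl (refl_linear a) (refl_funK a) (refl_funK a).

Variable Pi : set V.

Definition weyl_of : set (gl V) := gen [set refl a | a in Pi].

Definition roots_of : set V :=
  [set v | exists w a, [/\ weyl_of w, Pi a & v = w a]].

End Reflections.

Definition opp_set {V : zmodType} (X : set V) : set V := [set - x | x in X].

Record based_root_system {R : realType} (V : lmodType R) := BasedRootSystem {
  bform : {symmetric V};
  simple : set V;
  cone_simple : cone simple `&` cone (opp_set simple) = [set 0];
  simple_notin_cone : forall a, simple a -> ~ cone (simple `\ a) a;
  simple_norm1 : forall a, simple a -> bform a a = 1;
  roots_sign : roots_of bform simple =
    (roots_of bform simple `&` cone simple) `|`
    (roots_of bform simple `&` cone (opp_set simple)) }.

Section CoxeterGroup.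
Context {R : realType} {V : lmodType R} (D : based_root_system V).
Implicit Types (U : set (gl V)) (J K : set V) (w t : gl V).

Definition srefl (a : V) : gl V := refl (bform D) a.
Definition roots : set V := roots_of (bform D) (simple D).
Definition pos_roots : set V := roots `&` cone (simple D).

Definition simple_refls : set (gl V) := [set srefl a | a in simple D].
Definition refls : set (gl V) := [set srefl a | a in roots].
Definition weyl : set (gl V) := gen simple_refls.

Definition has_word w (n : nat) : Prop :=
  exists s : seq (gl V),
    [/\ {subset s <= simple_refls}, size s = n & (\prod_(t <- s) t)%g = w].

(* Meaningful on [weyl] only; its value elsewhere is the default 0. *)
Definition len w : nat :=
  xget 0%N [set n | has_word w n /\ forall m, has_word w m -> (n <= m)%N].

Definition Nset w : set (gl V) :=
  [set t | refls t /\ (len (t * w)%g < len w)%N].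

Definition std_parabolic J : set (gl V) := gen [set srefl a | a in J].

Definition parabolic U : Prop :=
  exists w J, [/\ weyl w, J `<=` simple D & U = conj_set w (std_parabolic J)].

Definition refl_subgroup U : Prop := U = gen (U `&` refls).

Definition roots_in U : set V := [set a | roots a /\ U (srefl a)].
Definition pos_roots_in U : set V := roots_in U `&` pos_roots.

(* [n] is the minimum cardinality of the sets of reflections of [U] generating
   [U] together with the reflections of [U']. *)
Definition corank_eq U U' (n : nat) : Prop :=
  let generating (T' : set (gl V)) :=
    T' `<=` U `&` refls /\ U = gen ((U' `&` refls) `|` T') in
  (exists T', generating T' /\ (`I_n #= T')%card) /\
  (forall T', generating T' -> (`I_n #<= T')%card).

Inductive fam_kind := FamR | FamM | FamN | FamP | FamQ.

Definition R_ J : set (set (gl V)) :=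
  [set U | [/\ refl_subgroup U, std_parabolic J `<=` U
             & corank_eq U (std_parabolic J) 1]].

Definition N_ J : set (set (gl V)) :=
  [set U | R_ J U /\ finite_set ((U `\` std_parabolic J) `&` refls)].

Definition M_ J : set (set (gl V)) :=
  [set U | R_ J U /\ forall U', R_ J U' -> U `<=` U' -> U' = U].

Definition P_ J : set (set (gl V)) := [set U | R_ J U /\ parabolic U].

Definition Q_ J : set (set (gl V)) := P_ J `&` N_ J.

Definition fam (X : fam_kind) : set V -> set (set (gl V)) :=
  match X with
  | FamR => R_ | FamM => M_ | FamN => N_ | FamP => P_ | FamQ => Q_
  end.

Definition eta w U J : bool :=
  `[< (U `\` std_parabolic J) `&` refls `<=` Nset w^-1%g >].

End CoxeterGroup.

Record groupoid := Groupoid {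
  obj :> Type;
  mor : obj -> obj -> Type;
  idm : forall a, mor a a;
  compm : forall a b c, mor b c -> mor a b -> mor a c;
  comp1m : forall a b (f : mor a b), compm (idm b) f = f;
  compm1 : forall a b (f : mor a b), compm f (idm a) = f;
  compmA : forall a b c d (h : mor c d) (g : mor b c) (f : mor a b),
    compm h (compm g f) = compm (compm h g) f;
  mor_inv : forall a b (f : mor a b),
    exists g : mor b a, compm g f = idm a /\ compm f g = idm b }.

Arguments mor {_}.
Arguments idm {_}.
Arguments compm {_ _ _ _}.

Definition component (G : groupoid) (a : G) : set G :=
  [set b | inhabited (mor a b)].

Definition component_union (G : groupoid) (C : set G) : Prop :=
  exists A : set G, C = \bigcup_(a in A) component a.

Section FullSub.
Variables (G : groupoid) (C : set G).

Definition sub_hom (a b : {a : G | C a}) := mor (sval a) (sval b).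

Definition full_sub : groupoid :=
  @Groupoid {a : G | C a} sub_hom
    (fun a => idm (sval a))
    (fun a b c (g : sub_hom b c) (f : sub_hom a b) => compm g f)
    (fun a b f => comp1m f) (fun a b f => compm1 f)
    (fun a b c d h g f => compmA h g f) (fun a b f => mor_inv f).

End FullSub.

Section BrinkHowlett.
Context {R : realType} {V : lmodType R} (D : based_root_system V).

Record bh_hom (J K : set V) := BHHom {
  bh_elt : gl V;
  bh_weyl : weyl D bh_elt;
  bh_image : bh_elt @` J = K }.

Lemma bh_hom_eqP J K (f g : bh_hom J K) : bh_elt f = bh_elt g -> f = g.
Proof.
case: f g => [w wW wJ] [v vW vJ] /= wv; subst v.
by congr BHHom; exact: Prop_irrelevance.
Qed.

Lemma bh_image1 J : (1%g : gl V) @` J = J.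
Proof. by rewrite (eq_imagel (f' := id)) ?image_id. Qed.

Lemma bh_imageM J K L (g : bh_hom K L) (f : bh_hom J K) :
  (bh_elt g * bh_elt f)%g @` J = L.
Proof.
by case: g f => w _ /= wK [v _ /= vJ]; rewrite -wK -vJ image_comp.
Qed.

Lemma bh_imageV J K (f : bh_hom J K) : (bh_elt f)^-1%g @` K = J.
Proof.
case: f => w _ /= <-; rewrite image_comp.
by rewrite (eq_imagel (f' := id)) ?image_id // => v _; exact: glVK.
Qed.

Definition bh_id J : bh_hom J J :=
  BHHom (@gen1 _ (simple_refls D)) (bh_image1 J).
Definition bh_comp J K L (g : bh_hom K L) (f : bh_hom J K) : bh_hom J L :=
  BHHom (@genM _ (simple_refls D) _ _ (bh_weyl g) (bh_weyl f)) (bh_imageM g f).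
Definition bh_inv J K (f : bh_hom J K) : bh_hom K J :=
  BHHom (@genV _ (simple_refls D) _ (bh_weyl f)) (bh_imageV f).

Lemma bh_comp1m J K (f : bh_hom J K) : bh_comp (bh_id K) f = f.
Proof. by apply: bh_hom_eqP; rewrite /= mul1g. Qed.
Lemma bh_compm1 J K (f : bh_hom J K) : bh_comp f (bh_id J) = f.
Proof. by apply: bh_hom_eqP; rewrite /= mulg1. Qed.
Lemma bh_compA J K L M (h : bh_hom L M) (g : bh_hom K L) (f : bh_hom J K) :
  bh_comp h (bh_comp g f) = bh_comp (bh_comp h g) f.
Proof. by apply: bh_hom_eqP; rewrite /= mulgA. Qed.
Lemma bh_hom_inv J K (f : bh_hom J K) :
  exists g : bh_hom K J, bh_comp g f = bh_id J /\ bh_comp f g = bh_id K.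
Proof.
by exists (bh_inv f); split; apply: bh_hom_eqP; rewrite /= ?mulVg ?mulgV.
Qed.

Definition bh_full : groupoid :=
  @Groupoid {J : set V | J `<=` simple D}
    (fun J K => bh_hom (sval J) (sval K))
    (fun J => bh_id (sval J)) (fun J K L g f => bh_comp g f)
    (fun J K f => bh_comp1m f) (fun J K f => bh_compm1 f)
    (fun J K L M h g f => bh_compA h g f) (fun J K f => bh_hom_inv f).

Definition bh_groupoid (C : set bh_full) : groupoid := full_sub C.

Definition bh_set (C : set bh_full) (J : bh_groupoid C) : set V :=
  sval (sval J).

Definition bh_mor (C : set bh_full) (J K : bh_groupoid C) (f : mor J K) :
  gl V := bh_elt f.

End BrinkHowlett.

(* A definitely signed set is a subset of an ambient type [T], so that
   inclusions and equalities of signed sets make literal sense; only the values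
   of [neg] on [car] are relevant.  A free {±1}-action amounts to an involution
   without fixed points. *)
Record signed_set (T : Type) := SignedSet {
  car : set T;
  pos : set T;
  neg : T -> T;
  pos_car : pos `<=` car;
  neg_car : forall x, car x -> car (neg x);
  negK : forall x, car x -> neg (neg x) = x;
  neg_free : forall x, car x -> neg x <> x;
  pos_repr : forall x, car x -> pos (neg x) <-> ~ pos x }.

Record signed_gset (G : groupoid) (T : Type) := SignedGSet {
  sset :> G -> signed_set T;
  gact : forall a b, mor a b -> T -> T;
  gact_car : forall a b (g : mor a b) x,
    car (sset a) x -> car (sset b) (gact g x);
  gact_neg : forall a b (g : mor a b) x, car (sset a) x ->
    gact g (neg (sset a) x) = neg (sset b) (gact g x);
  gact_id : forall a x, car (sset a) x -> gact (idm a) x = x;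
  gact_comp : forall a b c (h : mor b c) (g : mor a b) x, car (sset a) x ->
    gact (compm h g) x = gact h (gact g x) }.

Arguments gact {_ _} _ {_ _}.

Section SignedGSetTheory.
Context {G : groupoid}.

(* Equality of signed groupoid-sets, ignoring values outside the carriers. *)
Definition sgset_eq T (X Y : signed_gset G T) : Prop :=
  (forall a, [/\ car (X a) = car (Y a), pos (X a) = pos (Y a) &
     forall x, car (X a) x -> neg (X a) x = neg (Y a) x]) /\
  (forall a b (g : mor a b) x, car (X a) x -> gact X g x = gact Y g x).

Definition sgset_morphism T T' (X : signed_gset G T) (Y : signed_gset G T')
    (f : G -> T -> T') : Prop :=
  [/\ forall a x, car (X a) x -> car (Y a) (f a x),
      forall a x, car (X a) x -> f a (neg (X a) x) = neg (Y a) (f a x),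
      forall a x, pos (X a) x -> pos (Y a) (f a x)
    & forall a b (g : mor a b) x, car (X a) x ->
        f b (gact X g x) = gact Y g (f a x)].

Definition sgset_iso T T' (X : signed_gset G T) (Y : signed_gset G T') : Prop :=
  exists f f', [/\ sgset_morphism X Y f, sgset_morphism Y X f',
    forall a x, car (X a) x -> f' a (f a x) = x
  & forall a y, car (Y a) y -> f a (f' a y) = y].

Definition sgset_incl T (X Y : signed_gset G T) : Prop :=
  exists f, sgset_morphism X Y f /\ forall a x, car (X a) x -> f a x = x.

Context {T : Type} (X : signed_gset G T).

Definition real_root a (x : T) : Prop :=
  exists b (g : mor a b), ~ (pos (X b) (gact X g x) <-> pos (X a) x).

Definition parallel a (x y : T) : Prop :=
  forall b (g : mor a b), pos (X b) (gact X g x) <-> pos (X b) (gact X g y).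

Lemma act_pos_neg a b (g : mor a b) x : car (X a) x ->
  pos (X b) (gact X g (neg (X a) x)) <-> ~ pos (X b) (gact X g x).
Proof.
by move=> Xx; rewrite gact_neg //; apply: pos_repr; exact: gact_car.
Qed.

Lemma real_neg a x : car (X a) x -> real_root a x -> real_root a (neg (X a) x).
Proof.
move=> Xx [b [g gx]]; exists b, g; rewrite act_pos_neg // pos_repr //.
case: (pselect (pos (X b) (gact X g x))); case: (pselect (pos (X a) x)); tauto.
Qed.

Lemma parallel_neg a x y : car (X a) x -> car (X a) y ->
  parallel a x y -> parallel a (neg (X a) x) (neg (X a) y).
Proof.
by move=> Xx Xy xy b g; rewrite !act_pos_neg //; apply: not_iff_compat.
Qed.

Lemma real_act a b (g : mor a b) x : car (X a) x ->
  real_root a x -> real_root b (gact X g x).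
Proof.
move=> Xx [c [h hx]].
have [g' [g'g gg']] := mor_inv g.
have g'gx : gact X g' (gact X g x) = x by rewrite -gact_comp // g'g gact_id.
have [e|ne] := pselect (pos (X b) (gact X g x) <-> pos (X a) x).
  exists c, (compm h g'); rewrite gact_comp ?g'gx; first by rewrite e.
  exact: gact_car.
by exists a, g'; rewrite g'gx => e; apply: ne; split => ?; apply/e.
Qed.

Lemma parallel_act a b (g : mor a b) x y : car (X a) x -> car (X a) y ->
  parallel a x y -> parallel b (gact X g x) (gact X g y).
Proof. by move=> Xx Xy xy c h; rewrite -!gact_comp //; exact: xy. Qed.

Lemma parallel_pos a x y : car (X a) x -> car (X a) y -> parallel a x y ->
  pos (X a) x <-> pos (X a) y.
Proof. by move=> Xx Xy /(_ a (idm a)); rewrite !gact_id. Qed.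

Lemma parallel_refl a x : parallel a x x. Proof. by []. Qed.
Lemma parallel_sym a x y : parallel a x y -> parallel a y x.
Proof. by move=> xy b g; split=> /xy. Qed.
Lemma parallel_trans a x y z :
  parallel a x y -> parallel a y z -> parallel a x z.
Proof. by move=> xy yz b g; rewrite xy. Qed.

Definition real_car a : set T := [set x | car (X a) x /\ real_root a x].
Definition real_pos a : set T := [set x | pos (X a) x /\ real_root a x].

Definition real_sset (a : G) : signed_set T.
Proof.
apply: (@SignedSet T (real_car a) (real_pos a) (neg (X a))).
- by move=> x [px rx]; split=> //; exact: pos_car.
- by move=> x [Xx rx]; split; [exact: neg_car | exact: real_neg].
- by move=> x [Xx _]; exact: negK.
- by move=> x [Xx _]; exact: neg_free.
- move=> x [Xx rx].
  split=> [[/(pos_repr Xx) npx _] [px _]|px]; first exact: npx.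
  split; last exact: real_neg.
  by apply/(pos_repr Xx) => px'; apply: px.
Defined.

Definition real_part : signed_gset G T.
Proof.
apply: (@SignedGSet G T real_sset (fun a b g => gact X g)).
- by move=> a b g x [Xx rx]; split; [exact: gact_car | exact: real_act].
- by move=> a b g x [Xx _]; exact: gact_neg.
- by move=> a x [Xx _]; exact: gact_id.
- by move=> a b c h g x [Xx _]; exact: gact_comp.
Defined.

Definition pclass a (x : T) : set T :=
  [set y | real_car a y /\ parallel a x y].

Definition rec_car a : set (set T) := [set pclass a x | x in real_car a].
Definition rec_pos a : set (set T) := [set pclass a x | x in real_pos a].

(* [- [x] = [- x]] and [g [x] = [g x]] without choosing representatives, see
   [rec_negE] and [rec_actE]. *)
Definition rec_neg a (c : set T) : set T :=
  \bigcup_(x in c) pclass a (neg (X a) x).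
Definition rec_act a b (g : mor a b) (c : set T) : set T :=
  \bigcup_(x in c) pclass b (gact X g x).

Lemma real_pos_car a x : real_pos a x -> real_car a x.
Proof. by case=> px rx; split=> //; exact: pos_car. Qed.

Lemma pclass_eq a x y : parallel a x y -> pclass a x = pclass a y.
Proof.
move=> xy; apply/seteqP; split=> z [rz pz]; split=> //.
  exact: parallel_trans (parallel_sym xy) pz.
exact: parallel_trans xy pz.
Qed.

Lemma pclass_self a x : real_car a x -> pclass a x x.
Proof. by []. Qed.

Lemma pclass_inj a x y : real_car a y -> pclass a x = pclass a y ->
  parallel a x y.
Proof. by move=> ry xy; have := pclass_self ry; rewrite -xy => -[]. Qed.

Lemma rec_negE a x : real_car a x ->
  rec_neg a (pclass a x) = pclass a (neg (X a) x).
Proof.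
move=> rx; apply/seteqP; split=> [y [z [rz xz]]|y yx]; last by exists x.
by rewrite -(pclass_eq (parallel_neg rx.1 rz.1 xz)).
Qed.

Lemma rec_actE a b (g : mor a b) x : real_car a x ->
  rec_act g (pclass a x) = pclass b (gact X g x).
Proof.
move=> rx; apply/seteqP; split=> [y [z [rz xz]]|y yx]; last by exists x.
by rewrite -(pclass_eq (parallel_act g rx.1 rz.1 xz)).
Qed.

Lemma rec_posE a x : real_car a x ->
  rec_pos a (pclass a x) <-> pos (X a) x.
Proof.
move=> rx; split=> [[y [py ry] yx]|px]; last by exists x => //; case: rx.
apply/(parallel_pos _ rx.1 (pclass_inj rx yx)) => //; exact: pos_car.
Qed.

Lemma neg_real_car a x : real_car a x -> real_car a (neg (X a) x).
Proof. by case=> Xx rx; split; [exact: neg_car | exact: real_neg]. Qed.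

Lemma act_real_car a b (g : mor a b) x :
  real_car a x -> real_car b (gact X g x).
Proof. by case=> Xx rx; split; [exact: gact_car | exact: real_act]. Qed.

Definition rec_sset (a : G) : signed_set (set T).
Proof.
apply: (@SignedSet (set T) (rec_car a) (rec_pos a) (rec_neg a)).
- by move=> _ [x /real_pos_car rx <-]; exists x.
- move=> _ [x rx <-]; rewrite rec_negE //.
  by exists (neg (X a) x) => //; exact: neg_real_car.
- move=> _ [x rx <-]; rewrite !rec_negE ?negK //; last exact: neg_real_car.
  by case: rx.
- move=> _ [x rx <-]; rewrite rec_negE // => /(pclass_inj rx).
  move=> /(parallel_pos (neg_car rx.1) rx.1).
  by rewrite (pos_repr rx.1); case: (pselect (pos (X a) x)) => px []; tauto.
- move=> _ [x rx <-]; rewrite rec_negE // !rec_posE //.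
    exact: (pos_repr rx.1).
  exact: neg_real_car.
Defined.

Definition real_compression : signed_gset G (set T).
Proof.
apply: (@SignedGSet G (set T) rec_sset rec_act).
- move=> a b g _ [x rx <-]; rewrite rec_actE //.
  by exists (gact X g x) => //; exact: act_real_car.
- move=> a b g _ [x rx <-] /=.
  rewrite rec_negE // !rec_actE ?rec_negE ?gact_neg //.
  + by case: rx.
  + exact: act_real_car.
  + exact: neg_real_car.
- by move=> a _ [x rx <-]; rewrite rec_actE // gact_id //; case: rx.
- move=> a b c h g _ [x rx <-]; rewrite !rec_actE ?gact_comp //.
    by case: rx.
  exact: act_real_car.
Defined.

End SignedGSetTheory.

Section Lambda.
Context {R : realType} {V : lmodType R} (D : based_root_system V).

Lemma roots_act w a : weyl D w -> roots D a -> roots D (w a).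
Proof.
move=> Ww [v [b [Wv Pb ->]]]; exists (w * v)%g, b; split=> //.
exact: genM.
Qed.

Lemma roots_opp a : roots D a -> roots D (- a).
Proof.
move=> [w [b [Ww Pb ->]]]; exists (w * srefl D b)%g, b; split=> //.
  by apply: genM => //; apply: sub_gen_smallest; exists b.
rewrite glME /= /refl_fun (simple_norm1 Pb) mulr1 divr1.
by rewrite scaler_nat mulr2n opprD addrA subrr add0r linearN.
Qed.

Lemma roots_neq0 a : roots D a -> a <> 0.
Proof.
move=> [w [b [Ww Pb ->]]] wb0.
have b0 : b = 0 by rewrite -(glVK w b) wb0 linear0.
have := simple_norm1 Pb; rewrite b0 linear0l => /eqP.
by rewrite eq_sym oner_eq0.
Qed.

Lemma cone_opp (X : set V) a : cone X a -> cone (opp_set X) (- a).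
Proof.
move=> [n [x [c [Xx c0 ->]]]]; exists n, (fun i => - x i), c; split=> //.
  by move=> i; exists (x i).
by rewrite -sumrN; apply: eq_bigr => i _; rewrite scalerN.
Qed.

Lemma opp_setK (X : set V) : opp_set (opp_set X) = X.
Proof.
rewrite /opp_set image_comp (eq_imagel (f' := id)) ?image_id // => v _ /=.
exact: opprK.
Qed.

Lemma pos_roots_opp a : roots D a -> pos_roots D (- a) <-> ~ pos_roots D a.
Proof.
move=> ra; split=> [[_ cNa] [_ ca]|npa].
  apply: (roots_neq0 ra).
  suff : [set 0] a by [].
  rewrite -(cone_simple D); split=> //.
  by rewrite -[a]opprK; exact: cone_opp.
split; first exact: roots_opp.
have := ra; rewrite /roots (roots_sign D) => -[//|[_ /cone_opp]].
by rewrite opp_setK.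
Qed.

Definition Lambda_sset : signed_set V.
Proof.
apply: (@SignedSet V (roots D) (pos_roots D) -%R).
- by move=> x [].
- exact: roots_opp.
- by move=> x _; exact: opprK.
- move=> x rx Nx; have := pos_roots_opp rx; rewrite Nx.
  by case: (pselect (pos_roots D x)) => px []; tauto.
- exact: pos_roots_opp.
Defined.

Variable C : set (bh_full D).

Definition Lambda : signed_gset (bh_groupoid C) V.
Proof.
apply: (@SignedGSet (bh_groupoid C) V (fun=> Lambda_sset)
  (fun J K f a => bh_mor f a)).
- by move=> J K f a; exact: roots_act (bh_weyl f).
- by move=> J K f a _; rewrite /= linearN.
- by [].
- by [].
Defined.

End Lambda.

Section Upsilon.
Context {R : realType} {V : lmodType R} {D : based_root_system V}.
Context {C : set (bh_full D)}.

(* The signs are encoded as booleans: [false] is [+] and [true] is [-], so that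
   negation is [~~] and the action of [(-1) ^ b] is [b (+) _]. *)
Definition is_Upsilon (X : fam_kind)
    (Y : signed_gset (bh_groupoid C) (set (gl V) * bool)) : Prop :=
  [/\ forall J, car (Y J) = fam D X (bh_set J) `*` [set: bool],
      forall J, pos (Y J) = fam D X (bh_set J) `*` [set false],
      forall J U e, fam D X (bh_set J) U -> neg (Y J) (U, e) = (U, ~~ e)
    & forall J K (f : mor J K) U e, fam D X (bh_set J) U ->
        let w := bh_mor f in
        gact Y f (U, e) = (conj_set w U, eta D w U (bh_set J) (+) e)].

End Upsilon.

(* Main.v *)
Require Import Defs.
From mathcomp Require Import all_boot all_order all_algebra.
From mathcomp Require Import all_classical reals.
From mathcomp Require Import ring lra.
Import Defs.
Set Implicit Arguments.
Unset Strict Implicit.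
Unset Printing Implicit Defensive.
Import Order.TTheory GRing.Theory Num.Theory.
Local Open Scope classical_set_scope.
Local Open Scope ring_scope.

(** The theorem is about signs: a morphism [w : J -> K] acts on a root [(U, e)]
    by the sign of [w] on the positive roots of [U] outside [W_J].  The points
    to prove are that this sign does not depend on the root, that it can be
    reversed exactly when there are finitely many such roots, and that the sign
    patterns that occur are those of finite parabolic subgroups.

    Reflection subgroups.  A reflection subgroup [U] has its own simple roots
    ([canon_simple]), and with them it is a based root system in the same space
    ([canon]).  The simple roots may be linearly dependent, so that there are
    no coordinates with respect to them and a root may lie in [cone J] without
    its reflection belonging to [W_J].  Functionals on the set of roots take
    the place of coordinates: arbitrary values on the simple roots extend to a
    function that behaves under reflections like a linear form
    ([root_functional_exists]).
    The values are propagated by increasing depth; two ways to reach the same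
    root are compared inside a dihedral group ([fgraph_uniq]).

    Uniform signs.  If [U] lies in [R_ D J], it has exactly one simple root [g]
    outside [J] ([R_canon]), so up to scaling there is only one functional on
    the roots of [U] that vanishes on [J].  A morphism [w : J -> K] carries the
    one of [w U w^-1] to a multiple of the one of [U], and the sign of the
    factor is the sign of [w] on all the new roots at once ([R_sign]).  This
    gives the functoriality of [Upsilon] and the remark on [eta].

    Real roots.  If some morphism reverses the sign, the new roots are
    inversions of an element of the group, so they are finite in number.
    Conversely, if they are finite in number, average over [U / W_J] the
    functional that is [0] on [J] and [1] on the other simple roots.  The
    average vanishes on [U] and is nonpositive at finitely many positive roots
    outside [W_J].  Moved into the fundamental chamber, it is fixed by a
    standard parabolic subgroup whose longest element modulo the image of [W_J]
    yields the required morphism ([finite_real]).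

    Sign patterns.  Factoring a morphism that makes a positive root [d]
    negative through standard parabolic subgroups of corank one shows that [d]
    belongs to a member of [Q_ D J] ([Q_closure]).  A member of [Q_ D J] is in
    turn determined by the signs at two morphisms ([Q_separation]), so distinct
    roots of [Upsilon_Q] are not parallel.  Therefore the real roots of
    [Lambda] and of each [Upsilon_X] have the same sign patterns as the roots
    of [Upsilon_Q], and [real_compression_iso] gives the isomorphisms. *)

(** * Cones *)

Section Cones.
Context {R : realType} {V : lmodType R}.
Implicit Types (X Y : set V) (u v a : V).

Lemma cone0 X : cone X 0.
Proof.
exists 0%N, (fun=> 0), (fun=> 0); split=> [[]//|[]//|].
by rewrite big_ord0.
Qed.

Lemma cone_self X a : X a -> cone X a.
Proof.
move=> Xa; exists 1%N, (fun=> a), (fun=> 1); split=> //.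
by rewrite big_ord1 scale1r.
Qed.

Lemma coneD X u v : cone X u -> cone X v -> cone X (u + v).
Proof.
move=> [n [x [c [Xx c0 ->]]]] [m [y [d [Xy d0 ->]]]].
exists (n + m)%N,
  (fun i : 'I_(n + m) =>
     match fintype.split i with inl j => x j | inr j => y j end),
  (fun i : 'I_(n + m) =>
     match fintype.split i with inl j => c j | inr j => d j end); split.
- by move=> i; case: (fintype.split i).
- by move=> i; case: (fintype.split i).
- rewrite big_split_ord /=; congr (_ + _); apply: eq_bigr => i _.
    by rewrite (unsplitK (inl i)).
  by rewrite (unsplitK (inr i)).
Qed.

Lemma coneZ X k v : 0 <= k -> cone X v -> cone X (k *: v).
Proof.
move=> k0 [n [x [c [Xx c0 ->]]]]; exists n, x, (fun i => k * c i); split=> //.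
  by move=> i; apply: mulr_ge0.
by rewrite scaler_sumr; apply: eq_bigr => i _; rewrite scalerA.
Qed.

Lemma cone_ind X (P : V -> Prop) : P 0 ->
  (forall x v c, X x -> 0 <= c -> cone X v -> P v -> P (c *: x + v)) ->
  forall v, cone X v -> P v.
Proof.
move=> P0 PD v [n [x [c [Xx c0 ->]]]] {v}.
elim: n x c Xx c0 => [|n IHn] x c Xx c0; first by rewrite big_ord0.
rewrite big_ord_recl; apply: PD => //; last exact: IHn.
by exists n, (fun i => x (lift ord0 i)), (fun i => c (lift ord0 i)).
Qed.

Lemma cone_sub X Y : X `<=` cone Y -> cone X `<=` cone Y.
Proof.
move=> XY; apply: cone_ind => [|x v c Xx c0 _ Yv]; first exact: cone0.
by apply: coneD => //; apply: coneZ => //; apply: XY.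
Qed.

Lemma cone_split X a v : cone X v ->
  exists k v', [/\ 0 <= k, cone (X `\ a) v' & v = k *: a + v'].
Proof.
move: v; apply: cone_ind => [|x v c Xx c0 _ [k [v' [k0 v'X ->]]]].
  by exists 0, 0; rewrite scale0r addr0; split=> //; exact: cone0.
have [->|/eqP xa] := eqVneq x a.
  by exists (c + k), v'; rewrite scalerDl addrA; split=> //; exact: addr_ge0.
exists k, (c *: x + v'); rewrite addrCA; split=> //.
by apply: coneD => //; apply: coneZ => //; exact: cone_self.
Qed.

Lemma cone_linear (f : {linear V -> V}) X Y : (forall x, X x -> cone Y (f x)) ->
  forall v, cone X v -> cone Y (f v).
Proof.
move=> XY; apply: cone_ind => [|x v c Xx c0 _ Yv].
  by rewrite linear0; exact: cone0.
by rewrite linearP; apply: coneD => //; apply: coneZ => //; exact: XY.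
Qed.

End Cones.

(** * Isometries, reflections and words *)

Section LinearGroup.
Context {R : realType} {V : lmodType R}.
Implicit Types (g : gl V) (u v : V) (k : R).

Lemma glD g u v : g (u + v) = g u + g v. Proof. exact: linearD. Qed.
Lemma glN g v : g (- v) = - g v. Proof. exact: linearN. Qed.
Lemma glB g u v : g (u - v) = g u - g v. Proof. exact: linearB. Qed.
Lemma glZ g k v : g (k *: v) = k *: g v. Proof. exact: linearZ. Qed.
Lemma gl0 g : g 0 = 0. Proof. exact: linear0. Qed.

End LinearGroup.

Section Forms.
Context {R : realType} {V : lmodType R} (B : {symmetric V}).
Implicit Types (u v a b : V) (s : seq V) (A P : set V).

Lemma formC u v : B u v = B v u.
Proof. by rewrite hermC /= expr0 mul1r. Qed.

Lemma reflE a v : B a a = 1 -> refl B a v = v - (2 * B v a) *: a.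
Proof. by move=> Ba; rewrite /= /refl_fun Ba divr1. Qed.

Lemma refl_self a : B a a = 1 -> refl B a a = - a.
Proof.
move=> Ba; rewrite reflE // Ba mulr1 scaler_nat mulr2n opprD addrA subrr.
by rewrite add0r.
Qed.

Lemma refl_invol a v : refl B a (refl B a v) = v.
Proof. exact: refl_funK. Qed.

Lemma reflM a : (refl B a * refl B a = 1)%g.
Proof. by apply: gl_eqP => v; rewrite glME gl1E refl_invol. Qed.

Lemma reflV a : ((refl B a)^-1 = refl B a)%g.
Proof. by apply: mulg1_eq; exact: reflM. Qed.

Definition isometry (w : gl V) : Prop := forall u v, B (w u) (w v) = B u v.

Lemma refl_isometry a : B a a = 1 -> isometry (refl B a).
Proof.
move=> Ba u v; rewrite !reflE // linearBl linearBr linearBr !linearZl_LR.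
rewrite !linearZr_LR /= Ba (formC a v); lra.
Qed.

Lemma isometryM w w' : isometry w -> isometry w' -> isometry (w * w')%g.
Proof. by move=> hw hw' u v; rewrite !glME hw hw'. Qed.

Lemma refl_conj w a : isometry w -> refl B (w a) = (w * refl B a * w^-1)%g.
Proof.
move=> hw; apply: gl_eqP => v; rewrite !glME.
have reflF b u : refl B b u = u - (2 * B u b / B b b) *: b by [].
rewrite !reflF; have -> : B v (w a) = B (w^-1 v)%g a.
  by rewrite -(hw (w^-1 v)%g) glKV.
by rewrite glB glZ glKV hw.
Qed.

Lemma reflN a : refl B (- a) = refl B a.
Proof.
apply: gl_eqP => v; rewrite /= /refl_fun linearNr linearNl linearNr opprK.
by rewrite mulrN mulNr scaleNr scalerN opprK.
Qed.

Definition word s : gl V := (\prod_(a <- s) refl B a)%g.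

Lemma word_nil : word [::] = 1%g.
Proof. exact: big_nil. Qed.

Lemma word_cat s s' : word (s ++ s') = (word s * word s')%g.
Proof. exact: big_cat. Qed.

Lemma word1 a : word [:: a] = refl B a.
Proof. by rewrite /word big_cons big_nil mulg1. Qed.

Lemma word_rcons s a : word (rcons s a) = (word s * refl B a)%g.
Proof. by rewrite -cats1 word_cat word1. Qed.

Lemma word_cons a s : word (a :: s) = (refl B a * word s)%g.
Proof. exact: big_cons. Qed.

Lemma word_rev s : word (rev s) = (word s)^-1%g.
Proof.
elim: s => [|a s IHs]; first by rewrite word_nil invg1.
by rewrite rev_cons word_rcons word_cons invgM IHs reflV.
Qed.

Lemma gen_refl A a : A a -> gen [set refl B a | a in A] (refl B a).
Proof. by move=> Aa; apply: sub_gen_smallest; exists a. Qed.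

Lemma gen_word A s : [set` s] `<=` A -> gen [set refl B a | a in A] (word s).
Proof.
elim: s => [|a s IHs] sA; first by rewrite word_nil; exact: gen1.
rewrite word_cons; apply: genM.
  by apply: gen_refl; apply: sA; rewrite /= mem_head.
by apply: IHs => b bs; apply: sA; rewrite /= inE bs orbT.
Qed.

Lemma genP A w : gen [set refl B a | a in A] w ->
  exists2 s, [set` s] `<=` A & w = word s.
Proof.
suff : gen [set refl B a | a in A] `<=`
  [set w | exists2 s, [set` s] `<=` A & w = word s] by apply.
apply: smallest_sub => [|_ [a Aa <-]]; last first.
  by exists [:: a]; rewrite ?word1 // => b; rewrite /= inE => /eqP ->.
split=> [|x y]; rewrite !inE /=.
  by exists [::]; rewrite ?word_nil.
move=> [s sA ->] [s' s'A ->]; exists (s ++ rev s').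
  by move=> b /=; rewrite mem_cat mem_rev => /orP[/sA|/s'A].
by rewrite word_cat word_rev.
Qed.

Lemma gen_isometry A w : (forall a, A a -> B a a = 1) ->
  gen [set refl B a | a in A] w -> isometry w.
Proof.
move=> A1 /genP[s sA ->]; elim: s sA => [|a s IHs] sA.
  by rewrite word_nil.
rewrite word_cons; apply: isometryM.
  by apply/refl_isometry/A1/sA; rewrite /= mem_head.
by apply: IHs => b bs; apply: sA; rewrite /= inE bs orbT.
Qed.

(** The strong exchange condition: reading the word from the right, the image
    of [d] can leave [P] only at a letter equal to it, and this letter can be
    dropped.  The set [P] is arbitrary because the positive roots of a
    reflection subgroup, with the letters taken in its own simple roots, are
    needed as much as all positive roots. *)
Lemma exchange A P s d :
    (forall a, A a -> B a a = 1) ->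
    (forall a b, A a -> P b -> b = a \/ P (refl B a b)) ->
    [set` s] `<=` A -> P d -> ~ P (word s d) ->
  exists s', [/\ [set` s'] `<=` A, (size s' < size s)%N &
    (word s * refl B d)%g = word s'].
Proof.
move=> A1 AP; elim/last_ind: s d => [|s a IHs] d sA Pd.
  by rewrite word_nil gl1E.
have Aa : A a by apply: sA; rewrite /= mem_rcons mem_head.
have {}sA : [set` s] `<=` A.
  by move=> b /= bs; apply: sA; rewrite /= mem_rcons inE bs orbT.
have [->|Pad] := AP _ _ Aa Pd.
  by move=> _; exists s; rewrite size_rcons word_rcons -mulgA reflM mulg1.
rewrite word_rcons glME => /(IHs _ sA Pad)[s' [s'A ss' e]].
exists (rcons s' a); split; rewrite ?size_rcons ?ltnS //.
  by move=> b /=; rewrite mem_rcons inE => /orP[/eqP -> //|/s'A].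
rewrite word_rcons -e (refl_conj _ (refl_isometry (A1 _ Aa))).
by rewrite reflV -!mulgA reflM mulg1.
Qed.

End Forms.

(** * Positive roots *)

Section BasedRoots.
Context {R : realType} {V : lmodType R} {D : based_root_system V}.
Implicit Types (a b d x y u v : V) (w z : gl V) (J K L X : set V).
Local Notation B := (Defs.bform D).
Local Notation Pi := (simple D).
Local Notation pos := (pos_roots D).

Lemma weyl1 : weyl D 1%g. Proof. exact: gen1. Qed.

Lemma weylM w z : weyl D w -> weyl D z -> weyl D (w * z)%g.
Proof. exact: genM. Qed.

Lemma weylV w : weyl D w -> weyl D w^-1%g.
Proof. exact: genV. Qed.

Lemma weyl_isometry w : weyl D w -> isometry B w.
Proof. by apply: gen_isometry => a; exact: simple_norm1. Qed.

Lemma root_norm a : roots D a -> B a a = 1.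
Proof.
by move=> [w [b [/weyl_isometry Iw /simple_norm1 b1 ->]]]; rewrite Iw.
Qed.

Lemma pos_root a : pos a -> roots D a. Proof. by case. Qed.

Lemma simple_root a : Pi a -> roots D a.
Proof. by exists 1%g, a; split=> //; exact: weyl1. Qed.

Lemma simple_pos a : Pi a -> pos a.
Proof. by move=> Pa; split; [exact: simple_root | exact: cone_self]. Qed.

Lemma sreflE a v : roots D a -> srefl D a v = v - (2 * B v a) *: a.
Proof. by move=> /root_norm; exact: reflE. Qed.

Lemma srefl_self a : roots D a -> srefl D a a = - a.
Proof. by move=> /root_norm; exact: refl_self. Qed.

Lemma sreflK a v : srefl D a (srefl D a v) = v.
Proof. exact: refl_invol. Qed.

Lemma srefl_conj w a : weyl D w ->
  srefl D (w a) = (w * srefl D a * w^-1)%g.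
Proof. by move=> /weyl_isometry; exact: refl_conj. Qed.

Lemma weyl_srefl a : roots D a -> weyl D (srefl D a).
Proof.
move=> [w [b [Ww Pb ->]]]; rewrite srefl_conj //.
by apply: weylM; [apply: weylM | apply: weylV] => //; exact: gen_refl.
Qed.

Lemma roots_srefl a b : roots D a -> roots D b -> roots D (srefl D a b).
Proof. by move=> ra; apply: roots_act; exact: weyl_srefl. Qed.

Lemma root_sign a : roots D a -> pos a \/ pos (- a).
Proof.
by move=> ra; have [|/(pos_roots_opp ra)] := pselect (pos a); [left | right].
Qed.

Lemma pos_opp a : pos a -> ~ pos (- a).
Proof. by move=> pa /(pos_roots_opp (pos_root pa)). Qed.

Lemma npos_opp a : roots D a -> ~ pos a -> pos (- a).
Proof. by move=> /root_sign[]. Qed.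

Lemma cone_pointed v : cone Pi v -> cone Pi (- v) -> v = 0.
Proof.
move=> cv cNv; suff : [set 0] v by [].
by rewrite -(cone_simple D); split=> //; rewrite -[v]opprK; exact: cone_opp.
Qed.

(** A simple root spans an extremal ray of the cone of positive vectors: a
    relation violating this would either express [a] through the other simple
    roots or contradict that the cone is pointed. *)
Lemma simple_ray a u v k : Pi a -> cone Pi u -> cone Pi v -> u + v = k *: a ->
  exists2 l, 0 <= l & u = l *: a.
Proof.
move=> Pa /(cone_split a)[k1 [u' [k10 cu' ->]]].
move=> /(cone_split a)[k2 [v' [k20 cv' ->]]] e.
have {}e : u' + v' = (k - k1 - k2) *: a.
  rewrite -addrA -opprD scalerBl scalerDl -e addrACA.
  by rewrite -[RHS]addrA addrCA subrr addr0.
have [m0|m0] := ltP 0 (k - k1 - k2).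
  case: (simple_notin_cone Pa).
  have m0' : 0 <= (k - k1 - k2)^-1 by rewrite invr_ge0 ltW.
  have := coneZ m0' (coneD cu' cv').
  by rewrite e scalerA mulVf ?scale1r // lt0r_neq0.
suff u'0 : u' = 0 by exists k1; rewrite // u'0 addr0.
have subPi : cone (Pi `\ a) `<=` cone Pi.
  by apply: cone_sub => x [Px _]; exact: cone_self.
apply: cone_pointed; first exact: subPi.
have -> : - u' = v' + (- (k - k1 - k2)) *: a.
  by rewrite scaleNr -e opprD addrCA subrr addr0.
apply: coneD; first exact: subPi.
by apply: coneZ; [rewrite oppr_ge0 | exact: cone_self].
Qed.

Lemma cone_pos x : pos x -> cone Pi x. Proof. by case. Qed.

Lemma pos_scale a b k : 0 <= k -> pos a -> pos b -> a = k *: b -> a = b.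
Proof.
move=> k0 [ra _] [rb _] e; have := root_norm ra.
rewrite e linearZl_LR linearZr_LR /= (root_norm rb) => k2.
have -> : k = 1; last by rewrite scale1r.
nra.
Qed.

Lemma simple_pos_ray a x v k :
  Pi a -> pos x -> cone Pi v -> x + v = k *: a -> x = a.
Proof.
move=> Pa px cv /(simple_ray Pa (cone_pos px) cv)[l l0].
by apply: pos_scale => //; exact: simple_pos.
Qed.

Lemma simple_indec a x v c : Pi a -> pos x -> cone Pi v -> 0 < c ->
  a = c *: x + v -> x = a.
Proof.
move=> Pa px cv c0 e; apply: (@simple_pos_ray a x (c^-1 *: v) c^-1) => //.
  by apply: coneZ => //; rewrite invr_ge0 ltW.
by rewrite e scalerDr scalerA mulVf ?gt_eqF // scale1r.
Qed.

Lemma simple_srefl_pos a b : Pi a -> pos b -> b = a \/ pos (srefl D a b).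
Proof.
move=> Pa pb; have ra := simple_root Pa.
have [|/npos_opp pn] := pselect (pos (srefl D a b)); [by right|left].
have {}pn := pn (roots_srefl ra (pos_root pb)).
apply: (@simple_pos_ray a b (- srefl D a b) (2 * B b a)) => //.
  exact: cone_pos.
by rewrite sreflE // opprB addrCA subrr addr0.
Qed.

Lemma srefl_inj a b : pos a -> pos b -> srefl D a = srefl D b -> a = b.
Proof.
move=> pa pb e; have ra := pos_root pa; have rb := pos_root pb.
have {e}eb : b = B b a *: a.
  have := sreflE b ra; rewrite e srefl_self // => e'.
  have : 2 *: b = 2 *: (B b a *: a).
    rewrite scalerA scaler_nat mulr2n -[X in _ + X]opprK e' opprB.
    by rewrite addrC subrK.
  by apply: scalerI; rewrite pnatr_eq0.
have [k0|k0] := leP 0 (B b a); first exact/esym/(pos_scale k0).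
case: (roots_neq0 rb); apply: cone_pointed; first exact: cone_pos.
rewrite eb -scaleNr; apply: coneZ; last exact: cone_pos.
by rewrite oppr_ge0 ltW.
Qed.

(** * Length and inversions *)

Lemma pos_refl w : refls D w -> exists2 d, pos d & w = srefl D d.
Proof.
move=> [d /[dup] rd /root_sign[pd|pd] <-]; first by exists d.
by exists (- d); rewrite // /srefl reflN.
Qed.

Lemma has_wordP w n : has_word D w n <->
  exists s, [/\ [set` s] `<=` Pi, size s = n & word B s = w].
Proof.
split=> [[s [sS <- <-]]|[s [sPi <- <-]]].
  elim: s sS => [|t s IHs] sS; first by exists [::]; rewrite word_nil big_nil.
  have [t' [t'Pi st' e]] : exists s', [/\ [set` s'] `<=` Pi, size s' = size s &
      word B s' = (\prod_(t <- s) t)%g].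
    by apply: IHs => x xs; apply: sS; rewrite inE xs orbT.
  have : t \in simple_refls D by apply: sS; rewrite mem_head.
  rewrite inE => -[a Pa <-]; exists (a :: t'); split=> /=.
  - by move=> b; rewrite /= inE => /orP[/eqP ->|/t'Pi].
  - by rewrite st'.
  - by rewrite word_cons e big_cons.
exists (map (srefl D) s); rewrite size_map big_map; split=> //.
by move=> t /mapP[a /sPi Pa ->]; rewrite inE; exists a.
Qed.

Lemma lenP w : weyl D w ->
  has_word D w (len D w) /\ forall m, has_word D w m -> (len D w <= m)%N.
Proof.
move=> /genP[s sPi ew]; rewrite /len; case: xgetP => [n -> //|] none.
have ex : exists n, `[< has_word D w n >].
  by exists (size s); apply/asboolP/has_wordP; exists s.
case: (none (ex_minn ex)).
case: ex_minnP => m /asboolP hm mmin; split=> // k hk.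
by apply: mmin; apply/asboolP.
Qed.

Lemma len_le s : [set` s] `<=` Pi -> (len D (word B s) <= size s)%N.
Proof.
move=> sPi; have /lenP[_] : weyl D (word B s) by exact: gen_word.
by apply; apply/has_wordP; exists s.
Qed.

Lemma len_word w : weyl D w ->
  exists s, [/\ [set` s] `<=` Pi, size s = len D w & word B s = w].
Proof. by move=> /lenP[/has_wordP]. Qed.

Lemma len_inv w : weyl D w -> len D w^-1%g = len D w.
Proof.
have le w' : weyl D w' -> (len D w'^-1%g <= len D w')%N.
  move=> /len_word[s [sPi <- <-]]; rewrite -word_rev -size_rev.
  by apply: len_le => a /=; rewrite mem_rev; exact: sPi.
move=> Ww; apply/eqP; rewrite eqn_leq le //.
by rewrite -{1}(invgK w) le //; exact: weylV.
Qed.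

Lemma len_exchange w d : weyl D w -> pos d -> ~ pos (w d) ->
  (len D (w * srefl D d)%g < len D w)%N.
Proof.
move=> /len_word[s [sPi <- <-]] pd nwd.
have [s' [s'Pi ss' ->]] :=
  exchange (@simple_norm1 _ _ D) simple_srefl_pos sPi pd nwd.
exact: leq_ltn_trans (len_le s'Pi) ss'.
Qed.

Lemma len_exchangeN w d : weyl D w -> pos d -> pos (w d) ->
  (len D w < len D (w * srefl D d)%g)%N.
Proof.
move=> Ww pd pwd; have rd := pos_root pd.
have := @len_exchange (w * srefl D d)%g d (weylM Ww (weyl_srefl rd)) pd.
rewrite -mulgA reflM mulg1; apply.
by rewrite glME srefl_self // glN; exact: pos_opp.
Qed.

Lemma NsetE w d : weyl D w -> pos d ->
  Nset D w (srefl D d) <-> ~ pos (w^-1 d)%g.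
Proof.
move=> Ww pd; have rd := pos_root pd; have Ws := weyl_srefl rd.
rewrite /Nset /= -(len_inv (weylM Ws Ww)) invgM reflV -(len_inv Ww).
have WV := weylV Ww; split=> [[_ lt] p|n]; last first.
  by split; [exists d | exact: len_exchange].
by have := ltn_trans lt (len_exchangeN WV pd p); rewrite ltnn.
Qed.

Lemma weyl_step w : weyl D w -> w = 1%g \/ exists z a,
  [/\ weyl D z, Pi a, pos (z a), (len D z < len D w)%N
    & w = (z * srefl D a)%g].
Proof.
move=> Ww; have [s [+ + ew]] := len_word Ww.
case/lastP: s ew => [|s a]; first by rewrite word_nil; left.
rewrite word_rcons size_rcons => ew sPi ss; right; exists (word B s), a.
have Pa : Pi a by apply: sPi; rewrite /= mem_rcons mem_head.
have {}sPi : [set` s] `<=` Pi.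
  by move=> b bs; apply: sPi; rewrite /= mem_rcons inE bs orbT.
have ls : (len D (word B s) < len D w)%N by rewrite -ss ltnS; exact: len_le.
have Ws : weyl D (word B s) by exact: gen_word.
split=> //; have [//|nsa] := pselect (pos (word B s a)).
have := len_exchange Ws (simple_pos Pa) nsa.
by rewrite /srefl ew => /(ltn_trans ls); rewrite ltnn.
Qed.

Lemma weyl_stepl w : weyl D w -> w = 1%g \/ exists z a,
  [/\ weyl D z, Pi a, pos (z^-1 a)%g, (len D z < len D w)%N
    & w = (srefl D a * z)%g].
Proof.
move=> Ww; have [/eqP|[z [a [Wz Pa pa lz e]]]] := weyl_step (weylV Ww).
  by rewrite invg_eq1 => /eqP; left.
right; exists z^-1%g, a; rewrite invgK len_inv // -(len_inv Ww); split=> //.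
  exact: weylV.
by rewrite -[srefl D a]reflV -invgM -e invgK.
Qed.

Lemma weyl_ind (P : gl V -> Prop) : P 1%g ->
  (forall w a, weyl D w -> Pi a -> pos (w a) -> P w -> P (w * srefl D a)%g) ->
  forall w, weyl D w -> P w.
Proof.
move=> P1 PM w; have [n] := ubnP (len D w); elim: n w => // n IHn w lw Ww.
have [-> //|[z [a [Wz Pa pa lz ->]]]] := weyl_step Ww.
by apply: PM => //; apply: IHn => //; exact: leq_trans lz lw.
Qed.

Lemma inversions_finite w : weyl D w ->
  finite_set [set d | pos d /\ ~ pos (w d)].
Proof.
move: w; apply: weyl_ind => [|w a Ww Pa pa fin].
  apply: (sub_finite_set _ (finite_set0 V)) => d [pd]; exact.
have : finite_set ([set a] `|` srefl D a @` [set d | pos d /\ ~ pos (w d)]).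
  by rewrite finite_setU; split; [exact: finite_set1 | exact: finite_image].
apply: sub_finite_set.
move=> d [pd nd]; have [->|psd] := simple_srefl_pos Pa pd; first by left.
by right; exists (srefl D a d); rewrite ?sreflK.
Qed.

(** * Depth *)

Definition depth_le d n := exists w,
  [/\ weyl D w, (len D w <= n)%N & ~ pos (w d)].

Lemma depth_le_trans d m n : (m <= n)%N -> depth_le d m -> depth_le d n.
Proof.
by move=> mn [w [Ww lw nw]]; exists w; split=> //; exact: leq_trans mn.
Qed.

Lemma depth_exists d : pos d -> exists n, depth_le d n.
Proof.
move=> pd; exists (len D (srefl D d)), (srefl D d); split=> //.
  by apply: weyl_srefl; exact: pos_root.
by rewrite srefl_self; [exact: pos_opp | exact: pos_root].
Qed.

(** In a shortest word making [d] negative, the reflection applied last is the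
    one in the image of [d] under the others, which is thus a simple root. *)
Lemma depth_min d n : pos d -> depth_le d n -> exists z a,
  [/\ weyl D z, Pi a, z d = a, (len D z < n)%N &
      forall w, weyl D w -> (len D w <= len D z)%N -> pos (w d)].
Proof.
move=> pd hn; have ex : exists m, `[< depth_le d m >].
  by exists n; apply/asboolP.
case: (ex_minnP ex) => m /asboolP[w [Ww lw nw]] mmin.
have mn : (m <= n)%N by apply: mmin; apply/asboolP.
have [w1|[z [a [Wz Pa pa lz ew]]]] := weyl_stepl Ww; first by rewrite w1 in nw.
have lzm : (len D z < m)%N by exact: leq_trans lw.
have zmin w' : weyl D w' -> (len D w' <= len D z)%N -> pos (w' d).
  move=> Ww1 lw1; have [//|nw1] := pselect (pos (w' d)).
  suff : (m <= len D z)%N by rewrite leqNgt lzm.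
  by apply: mmin; apply/asboolP; exists w'.
exists z, a; split=> //; last exact: leq_trans mn.
by have [//|] := simple_srefl_pos Pa (zmin z Wz (leqnn _)); rewrite -glME -ew.
Qed.

(** Reflecting [d] in a root [e] inverted by [z], where [z d] is simple:
    removing a letter from [z] shows that [s_e d] or its opposite has smaller
    depth. *)
Lemma depth_srefl z a d e : weyl D z -> Pi a -> z d = a -> pos e ->
    ~ pos (z e) ->
  (pos (srefl D e d) -> depth_le (srefl D e d) (len D z)) /\
  (pos (- srefl D e d) -> depth_le (- srefl D e d) (len D z)).
Proof.
move=> Wz Pa zd pe nze; have Ws := weyl_srefl (pos_root pe).
have lt := len_exchange Wz pe nze; have Wzs := weylM Wz Ws.
have zsd : (z * srefl D e)%g (srefl D e d) = a by rewrite glME sreflK.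
split=> [_|_]; last first.
  exists (z * srefl D e)%g; rewrite glN zsd ltnW //; split=> //.
  by apply: pos_opp; exact: simple_pos.
exists (srefl D a * (z * srefl D e))%g; split.
- by apply: weylM => //; exact: weyl_srefl (simple_root Pa).
- apply: leq_trans lt; have [s [sPi <- <-]] := len_word Wzs.
  rewrite /srefl -word_cons; apply: (leq_trans (len_le _)) => //.
  by move=> b /=; rewrite inE => /orP[/eqP -> //|/sPi].
- rewrite glME zsd srefl_self; last exact: simple_root.
  by apply: pos_opp; exact: simple_pos.
Qed.

(** Let [z d = b] be simple with [z] as short as possible.  Were both [z a] and
    [z (s_a d)] positive, then [b] would be a positive combination of them, and
    as [b] is extremal [z a] would be equal to [z d]. *)
Lemma depth_step d a n : pos d -> Pi a -> d <> a -> 0 < B d a ->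
  depth_le d n.+1 -> depth_le (srefl D a d) n.
Proof.
move=> pd Pa da Bda /(depth_min pd)[z [b [Wz Pb zd lz _]]].
have psd : pos (srefl D a d) by have [] := simple_srefl_pos Pa pd.
apply: (@depth_le_trans _ (len D z)) => //.
have [pza|nza] := pselect (pos (z a)); last first.
  exact: (depth_srefl Wz Pb zd (simple_pos Pa) nza).1.
exists z; split=> // pzs; apply: da; apply: (can_inj (gl_funK z)).
rewrite zd; apply/esym; apply: (simple_indec Pb pza (cone_pos pzs)).
  exact: mulr_gt0 (ltr0Sn _ 1) Bda.
by rewrite (sreflE _ (simple_root Pa)) glB glZ zd addrC subrK.
Qed.

Lemma depth0 d : pos d -> ~ depth_le d 0.
Proof. by move=> pd /(depth_min pd)[z [a [_ _ _]]]. Qed.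

Lemma pos_simple_gt0 d : pos d -> exists2 a, Pi a & 0 < B d a.
Proof.
move=> pd; have [//|none] := pselect (exists2 a, Pi a & 0 < B d a).
have le0 : forall v, cone Pi v -> B d v <= 0.
  apply: cone_ind => [|x v c Px c0 _ dv]; first by rewrite linear0r.
  rewrite linearDr linearZr_LR /=; have : B d x <= 0.
    by rewrite leNgt; apply/negP => dx; apply: none; exists x.
  by move=> dx; rewrite -oppr_ge0 opprD addr_ge0 ?oppr_ge0 // mulr_ge0_le0.
have := le0 d (cone_pos pd); rewrite root_norm ?ler10 //; exact: pos_root.
Qed.

Lemma form_srefl d a : roots D a -> B (srefl D a d) a = - B d a.
Proof.
by move=> ra; rewrite sreflE // linearBl linearZl_LR /= root_norm //; lra.
Qed.

(** Since [B d d = 1], a positive root [d] has [B d a > 0] for some simple [a],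
    and [s_a d] then has smaller depth. *)
Lemma root_ind (P : V -> Prop) : (forall a, Pi a -> P a) ->
  (forall d a, pos d -> Pi a -> B d a < 0 -> P d -> P (srefl D a d)) ->
  forall d, pos d -> P d.
Proof.
move=> Pbase Pstep d pd; have [n hn] := depth_exists pd.
elim: n d pd hn => [|n IHn] d pd hn; first by case: (depth0 pd hn).
have [a Pa Bda] := pos_simple_gt0 pd.
have [-> |/eqP da] := eqVneq d a; first exact: Pbase.
have [//|psd] := simple_srefl_pos Pa pd.
rewrite -(sreflK a d); apply: Pstep => //; last exact/IHn/depth_step.
by rewrite form_srefl ?oppr_lt0 //; exact: simple_root.
Qed.

End BasedRoots.

(** * Simple roots of reflection subgroups *)

Lemma gen_sub (gT : groupType) (A B : set gT) :
  A `<=` gen B -> gen A `<=` gen B.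
Proof. by move=> AB; apply: smallest_sub => //; exact: gen_subgroup. Qed.

Lemma gen_mono (gT : groupType) (A B : set gT) : A `<=` B -> gen A `<=` gen B.
Proof. by move=> AB; apply: gen_sub => x /AB; exact: sub_gen_smallest. Qed.

Section ReflectionSubgroups.
Context {R : realType} {V : lmodType R} {D : based_root_system V}.
Implicit Types (a b d e g x y u v : V) (w z : gl V) (J K L X Y : set V).
Local Notation B := (Defs.bform D).
Local Notation Pi := (simple D).
Local Notation pos := (pos_roots D).
Local Notation grp := (std_parabolic D).
Local Notation posin X := (pos_roots_in D (std_parabolic D X)).

Lemma grp_srefl X a : X a -> grp X (srefl D a).
Proof. exact: gen_refl. Qed.

Lemma grp_mono X Y : X `<=` Y -> grp X `<=` grp Y.
Proof. by move=> XY; apply: gen_mono => _ [a /XY Ya <-]; exists a. Qed.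

Lemma grp_weyl X w : X `<=` roots D -> grp X w -> weyl D w.
Proof.
move=> XR; apply: gen_sub w => _ [a /XR ra <-]; exact: weyl_srefl ra.
Qed.

Lemma pos_in X d : posin X d -> pos d. Proof. by case. Qed.

Lemma posin_grp X d : posin X d -> grp X (srefl D d).
Proof. by case=> -[]. Qed.

Lemma grp_conj X w a : grp X w -> weyl D w -> grp X (srefl D a) ->
  grp X (srefl D (w a)).
Proof.
move=> Xw Ww Xa; rewrite srefl_conj //; apply: genM; last exact: genV.
exact: genM.
Qed.

Lemma sreflN a : srefl D (- a) = srefl D a.
Proof. exact: reflN. Qed.

(** These roots correspond to the canonical Coxeter generators of the subgroup
    generated by the reflections in [X]: a reflection [t] of it is canonical
    when [N(t)] contains no other reflection of the subgroup. *)
Definition canon_simple X : set V := [set g | posin X g /\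
  forall d, posin X d -> d = g \/ pos (srefl D g d)].

Section Canon.
Variables (X : set V) (XR : X `<=` roots D).
Local Notation CX := (canon_simple X).

Lemma canon_act w d : grp X w -> roots_in D (grp X) d ->
  roots_in D (grp X) (w d).
Proof.
move=> Xw [rd Xd]; have Ww := grp_weyl XR Xw.
by split; [exact: roots_act | exact: grp_conj].
Qed.

Lemma canon_srefl_pos a d : CX a -> posin X d ->
  d = a \/ posin X (srefl D a d).
Proof.
move=> [/posin_grp Xa aP] pd; have [->|ps] := aP d pd; [by left | right].
by split=> //; apply: canon_act => //; case: pd.
Qed.

Lemma canon_norm a : CX a -> B a a = 1.
Proof. by move=> [[_ /pos_root/root_norm]]. Qed.

(** Suppose that the positive root [d] is not canonical, so that [s_d e < 0] for
    some other positive root [e] of the subgroup; then [e] and [- s_d e] are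
    positive roots whose sum is a multiple of [d].  Let [z] be a shortest
    element for which [z d] is simple.  As simple roots are extremal, [z]
    inverts one of the two, say [f], and both [f] and [s_f d] have smaller
    depth than [d]. *)
Lemma canon_base d : posin X d -> exists w g,
  [/\ gen [set srefl D a | a in CX] w, CX g & d = w g].
Proof.
move=> pd; have [n hn] := depth_exists (pos_in pd).
elim: n d pd hn => [|n IHn] d pd hn; first by case: (depth0 (pos_in pd)).
have [CXd|nCX] := pselect (CX d).
  by exists 1%g, d; split=> //; exact: gen1.
have [e [pe ed nse]] : exists e, [/\ posin X e, e <> d & ~ pos (srefl D d e)].
  apply: contrapT => none; apply: nCX; split=> // e pe.
  have [|ed] := pselect (e = d); [by left | right].
  by apply: contrapT => ns; apply: none; exists e.
have [Xd rd] := (posin_grp pd, pos_root (pos_in pd)).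
have [z [a [Wz Pa zd lz zmin]]] := depth_min (pos_in pd) hn.
have pe' : posin X (- srefl D d e).
  have [rs Xs] := canon_act Xd pe.1.
  split; last exact: npos_opp.
  by split; [exact: roots_opp | rewrite sreflN].
have step f : posin X f -> ~ pos (z f) -> exists w g,
    [/\ gen [set srefl D a | a in CX] w, CX g & d = w g].
  move=> pf nf; have [hp hN] := depth_srefl Wz Pa zd (pos_in pf) nf.
  have [|w1 [g1 [G1 C1 ef]]] := IHn f pf.
    by exists z; split=> //; rewrite -ltnS.
  have Gf : gen [set srefl D a | a in CX] (srefl D f).
    have Xw1 : weyl D w1.
      apply: gen_sub G1 => _ [b [[_ /pos_root rb] _] <-]; exact: weyl_srefl rb.
    rewrite ef srefl_conj //; apply: genM; last exact: genV.
    by apply: genM => //; exact: gen_refl.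
  have [rs Xs] := canon_act (posin_grp pf) pd.1.
  have [ps|pN] := root_sign rs.
    have [//||w2 [g2 [G2 C2 e2]]] := IHn (srefl D f d).
      exact: depth_le_trans (hp ps).
    exists (srefl D f * w2)%g, g2; split=> //; first exact: genM.
    by rewrite glME -e2 sreflK.
  have [||w2 [g2 [G2 C2 e2]]] := IHn (- srefl D f d).
  - by split=> //; split; [exact: roots_opp | rewrite sreflN].
  - exact: depth_le_trans (hN pN).
  exists (srefl D f * (w2 * srefl D g2))%g, g2; split=> //.
    by apply: genM => //; apply: genM => //; exact: gen_refl.
  have rg2 : roots D g2 by exact: pos_root (pos_in C2.1).
  by rewrite !glME srefl_self // glN -e2 opprK sreflK.
have [nze|pze] := pselect (~ pos (z e)); first exact: (step e).
have [nze'|pze'] := pselect (~ pos (z (- srefl D d e))).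
  exact: (step (- srefl D d e)).
move: pze pze' => /contrapT pze /contrapT pze'.
case: ed; apply: (can_inj (gl_funK z)); rewrite zd.
apply: (simple_pos_ray Pa pze (cone_pos pze') (k := 2 * B e d)).
rewrite -glD sreflE // opprB addrCA subrr addr0 glZ zd //.
Qed.
Lemma canon_weyl_sub w : gen [set srefl D a | a in CX] w -> weyl D w.
Proof. by apply: (grp_weyl (X := CX)) => a [[_ /pos_root]]. Qed.

Lemma canon_gen : gen [set srefl D a | a in CX] = grp X.
Proof.
apply/seteqP; split; apply: gen_sub => _ [a + <-].
  by move=> [/posin_grp].
move=> Xa; have Ga : grp X (srefl D a) by exact: grp_srefl.
have base d : posin X d -> gen [set srefl D a | a in CX] (srefl D d).
  move=> /canon_base[w [g [Gw Cg ->]]].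
  by apply: grp_conj => //; [exact: canon_weyl_sub | exact: gen_refl].
have ra := XR Xa.
have [pa|pN] := root_sign ra; first by apply: base.
rewrite -sreflN; apply: base; split=> //.
by split; [exact: roots_opp | rewrite sreflN].
Qed.

Lemma canon_roots : roots_of B CX = roots_in D (grp X).
Proof.
apply/seteqP; split=> [_ [w [g [Gw Cg ->]]]|d [rd Xd]].
  have Xw : grp X w by rewrite -canon_gen.
  by apply: canon_act => //; case: Cg => -[].
have base e : posin X e -> roots_of B CX e.
  by move=> /canon_base[w [g [Gw Cg ->]]]; exists w, g.
have [pd|pN] := root_sign rd; first by apply: base.
have [|w [g [Gw Cg e]]] := base (- d).
  by split=> //; split; [exact: roots_opp | rewrite sreflN].
exists (w * srefl D g)%g, g; split=> //.
  by apply: genM => //; exact: gen_refl.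
by rewrite glME (srefl_self (pos_root (pos_in Cg.1))) glN -e opprK.
Qed.

(** Distinct simple roots are at an obtuse angle: with [B g h > 0], applying
    [s_h] to [h = s_g h + 2 B(g,h) g] would make [- h] a sum of positive
    vectors. *)
Lemma canon_obtuse g h : CX g -> CX h -> g <> h -> B g h <= 0.
Proof.
move=> Cg Ch gh; rewrite leNgt; apply/negP => gt0.
have rg := pos_root (pos_in Cg.1); have rh := pos_root (pos_in Ch.1).
have [/esym//|pxh] := canon_srefl_pos Cg Ch.1.
have e : h = srefl D g h + (2 * B g h) *: g.
  by rewrite sreflE // (formC _ h) subrK.
have [xh|px] := Ch.2 _ pxh.
  move/eqP: e; rewrite xh -subr_eq0 opprD addrA subrr add0r oppr_eq0.
  rewrite scaler_eq0 => /orP[|/eqP]; last exact: (roots_neq0 rg).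
  by rewrite mulf_eq0 pnatr_eq0 /= => /eqP g0; move: gt0; rewrite g0 ltxx.
have [//|pg] := Ch.2 _ Cg.1.
apply: (pos_opp (pos_in Ch.1)); rewrite -(srefl_self rh); split.
  exact: roots_srefl.
rewrite {2}e glD glZ; apply: coneD; first exact: cone_pos.
by apply: coneZ; [rewrite mulr_ge0 // ltW | exact: cone_pos].
Qed.

Lemma canon_cone_sub : cone CX `<=` cone Pi.
Proof. by apply: cone_sub => a [[_ /cone_pos]]. Qed.

Lemma canon_cone_pointed : cone CX `&` cone (opp_set CX) = [set 0].
Proof.
apply/seteqP; split=> [v [cv cNv]|_ ->]; last by split; exact: cone0.
apply: (@cone_pointed _ _ D); apply: canon_cone_sub => //.
by rewrite -(opp_setK CX); exact: cone_opp.
Qed.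

Lemma canon_notin_cone a : CX a -> ~ cone (CX `\ a) a.
Proof.
move=> Ca ca; have : forall v, cone (CX `\ a) v -> B a v <= 0.
  apply: cone_ind => [|x v c [Cx xa] c0 _ av]; first by rewrite linear0r.
  rewrite linearDr linearZr_LR /= -oppr_ge0 opprD addr_ge0 ?oppr_ge0 //.
  by rewrite mulr_ge0_le0 // canon_obtuse // => ax; apply: xa.
by move=> /(_ _ ca); rewrite canon_norm // ler10.
Qed.

(** On a shortest word in the simple roots of the subgroup that makes [d]
    negative, let [g] be the last letter.  If [B d g] were negative, the other
    letters would have to invert [g], and the exchange condition would give a
    shorter word.  Hence [d] is [s_g d] plus a nonnegative multiple of [g]. *)
Lemma posin_cone d : posin X d -> cone CX d.
Proof.
move=> pd.
have [s sC nd] : exists2 s, [set` s] `<=` CX & ~ posin X (word B s d).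
  have : gen [set srefl D a | a in CX] (srefl D d).
    by rewrite canon_gen; exact: posin_grp.
  move=> /genP[s sC e]; exists s; rewrite // -e => /pos_in.
  rewrite [refl _ _ _]srefl_self; last exact: pos_root (pos_in pd).
  by apply: pos_opp; exact: pos_in pd.
have [n] := ubnP (size s); elim: n s d pd sC nd => // n IHn s d pd sC nd sn.
have [[s' [s'C nd' ss']]|min] := pselect (exists s',
    [/\ [set` s'] `<=` CX, ~ posin X (word B s' d) & (size s' < size s)%N]).
  by apply: (IHn s') => //; exact: leq_trans ss' sn.
case/lastP: s sC nd sn min => [|s g] sC; first by rewrite word_nil.
rewrite word_rcons glME size_rcons => nd sn min.
have Cg : CX g by apply: sC; rewrite /= mem_rcons mem_head.
have {}sC : [set` s] `<=` CX.
  by move=> b bs; apply: sC; rewrite /= mem_rcons inE bs orbT.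
have [->|pgd] := canon_srefl_pos Cg pd; first exact: cone_self.
have cgd : cone CX (srefl D g d) by apply: (IHn s).
have rg := pos_root (pos_in Cg.1).
have e : d = srefl D g d + (2 * B d g) *: g by rewrite sreflE // subrK.
have [Bdg|Bdg] := leP 0 (B d g).
  rewrite e; apply: coneD => //; apply: coneZ; last exact: cone_self.
  by rewrite mulr_ge0.
have Xs : grp X (word B s) by rewrite -canon_gen; exact: gen_word.
have psd : posin X (word B s d).
  by apply: contrapT => nsd; apply: min; exists s.
have [rsg Xsg] := canon_act Xs Cg.1.1.
have nsg : ~ posin X (word B s g).
  move=> psg; have [rsgd Xsgd] := canon_act Xs pgd.1.
  apply: nd; split=> //; split=> //.
  have -> : srefl D g d = d + (- (2 * B d g)) *: g by rewrite sreflE // scaleNr.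
  rewrite glD glZ; apply: coneD; first exact: cone_pos (pos_in psd).
  apply: coneZ; last exact: cone_pos (pos_in psg).
  by rewrite oppr_ge0 mulr_ge0_le0 // ltW.
have [s' [s'C ss' es']] := exchange canon_norm canon_srefl_pos sC Cg.1 nsg.
case: min; exists s'; split=> //; last exact: ltnW.
by rewrite -es' glME.
Qed.

Lemma canon_roots_sign : roots_of B CX =
  (roots_of B CX `&` cone CX) `|` (roots_of B CX `&` cone (opp_set CX)).
Proof.
apply/seteqP; split=> [d rd|d [[]|[]]//].
have : roots_in D (grp X) d by rewrite -canon_roots.
move=> [Rd Xd]; have [pd|pN] := root_sign Rd; [left | right]; split=> //.
  exact: posin_cone.
rewrite -[d]opprK; apply: cone_opp; apply: posin_cone.
by split=> //; split; [exact: roots_opp | rewrite sreflN].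
Qed.

(** A reflection subgroup with its simple roots is again a based root system in
    the same space, so the whole theory applies to it. *)
Definition canon : based_root_system V :=
  BasedRootSystem canon_cone_pointed canon_notin_cone canon_norm
    canon_roots_sign.

Lemma canon_weylE : weyl canon = grp X. Proof. exact: canon_gen. Qed.

Lemma canon_rootsE : roots canon = roots_in D (grp X).
Proof. exact: canon_roots. Qed.

Lemma canon_posE : pos_roots canon = posin X.
Proof.
apply/seteqP; split=> d.
  rewrite /pos_roots canon_rootsE => -[rd cd]; split=> //; split.
    by case: rd.
  exact: canon_cone_sub.
by move=> pd; split; [rewrite canon_rootsE; case: pd | exact: posin_cone].
Qed.

End Canon.

Lemma std_descent X w : X `<=` Pi -> grp X w -> w <> 1%g ->
  exists2 a, X a & ~ pos (w a).
Proof.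
move=> XPi /genP[s sX ->].
have [n] := ubnP (size s); elim: n s sX => // n IHn s.
case/lastP: s => [|s a] sX; first by rewrite word_nil.
rewrite size_rcons => sn w1.
have Xa : X a by apply: sX; rewrite /= mem_rcons mem_head.
have [nsa|psa] := pselect (~ pos (word B (rcons s a) a)); first by exists a.
have {}sX : [set` s] `<=` X.
  by move=> b bs; apply: sX; rewrite /= mem_rcons inE bs orbT.
move: psa w1 => /contrapT; rewrite word_rcons glME.
rewrite [refl _ _ _]srefl_self ?glN; last exact/simple_root/XPi.
move=> psa w1; have nsa : ~ pos (word B s a) by move=> /pos_opp.
have X1 b : X b -> B b b = 1 by move=> /XPi; exact: simple_norm1.
have Xp b d : X b -> pos d -> d = b \/ pos (refl B b d).
  by move=> /XPi; exact: simple_srefl_pos.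
have [s' [s'X ss' es']] := exchange X1 Xp sX (simple_pos (XPi _ Xa)) nsa.
rewrite es'; apply: IHn => //; last by rewrite -es'.
by apply: (leq_trans ss'); apply: ltnW.
Qed.

Lemma simple_canon X a : X `<=` roots D -> X a -> Pi a -> canon_simple X a.
Proof.
move=> XR Xa Pa; split.
  by split; [split; [exact: XR | exact: grp_srefl] | exact: simple_pos].
by move=> d /pos_in; exact: simple_srefl_pos.
Qed.

(** A reflection in a standard parabolic subgroup, being nontrivial, inverts
    some element of [X]; if it is canonical, it can invert only its own
    root. *)
Lemma canon_std X : X `<=` Pi -> canon_simple X = X.
Proof.
move=> XPi; apply/seteqP; split=> [g Cg|a Xa]; last first.
  by apply: simple_canon => // [b /XPi|]; [exact: simple_root | exact: XPi].
have rg := pos_root (pos_in Cg.1).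
have [|a Xa nga] := std_descent XPi (posin_grp Cg.1).
  move=> e; have := srefl_self rg; rewrite e gl1E => e'.
  by apply: (pos_opp (pos_in Cg.1)); rewrite -e'; exact: pos_in Cg.1.
have pa : posin X a.
  split; last exact/simple_pos/XPi.
  by split; [exact/simple_root/XPi | exact: grp_srefl].
by have [<-|] := Cg.2 _ pa.
Qed.

End ReflectionSubgroups.

(** * Functionals on the roots *)

Section RootFunctionals.
Context {R : realType} {V : lmodType R} (D : based_root_system V).
Implicit Types (a b d e g x y u v : V) (w z : gl V) (J K L X Y : set V).
Local Notation B := (Defs.bform D).
Local Notation Pi := (simple D).
Local Notation pos := (pos_roots D).
Local Notation grp := (std_parabolic D).
Local Notation posin X := (pos_roots_in D (std_parabolic D X)).

Lemma simple_roots_sub L : L `<=` Pi -> L `<=` roots D.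
Proof. by move=> LPi a /LPi; exact: simple_root. Qed.

Lemma pos_multiple a b k : pos a -> pos b -> b = k *: a -> a = b.
Proof.
move=> pa pb e; have [k0|k0] := leP 0 k; first exact/esym/(pos_scale k0 pb pa).
case: (roots_neq0 (pos_root pb)); apply: (@cone_pointed _ _ D).
  exact: cone_pos.
rewrite e -scaleNr; apply: coneZ; last exact: cone_pos.
by rewrite oppr_ge0 ltW.
Qed.

Lemma simple_indep a b k l : Pi a -> Pi b -> a <> b -> k *: a + l *: b = 0 ->
  k = 0 /\ l = 0.
Proof.
move=> /simple_pos pa /simple_pos pb ab e.
have [k0|k0] := eqVneq k 0.
  split=> //; move/eqP: e; rewrite k0 scale0r add0r scaler_eq0.
  by move=> /orP[/eqP //|/eqP b0]; case: (roots_neq0 (pos_root pb)).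
case: ab; apply/esym/(@pos_multiple _ _ (- (l / k))) => //.
apply: (scalerI k0); rewrite scalerA mulrN mulrCA mulfV // mulr1 scaleNr.
by apply/eqP; rewrite -subr_eq0 opprK e.
Qed.

Lemma simple_obtuse a b : Pi a -> Pi b -> a <> b -> B a b <= 0.
Proof.
move=> Pa Pb ab; rewrite leNgt; apply/negP => gt0; apply: ab.
have [//|ps] := simple_srefl_pos Pb (simple_pos Pa).
apply/esym/(simple_indec Pa (simple_pos Pb) (cone_pos ps)).
  exact: mulr_gt0 (ltr0Sn _ 1) gt0.
by rewrite (sreflE _ (simple_root Pb)) addrC subrK.
Qed.

Definition antidominant L x := forall a, L a -> B x a <= 0.

(** Along a reduced word every reflection adds a nonnegative multiple of a
    positive root of the subgroup. *)
Lemma antidominant_orbit L x w : L `<=` Pi -> antidominant L x -> grp L w ->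
  cone L (w x - x).
Proof.
move=> LPi xL; have LR := simple_roots_sub LPi.
rewrite -(canon_weylE LR); move: w; apply: weyl_ind.
  by rewrite gl1E subrr; exact: cone0.
move=> w a _; rewrite /= (canon_std LPi) => La [_ /=].
rewrite (canon_std LPi) => cwa cwx.
have -> : (w * srefl (canon LR) a)%g x - x =
    (w x - x) + (- (2 * B x a)) *: w a.
  rewrite glME (_ : srefl _ a = srefl D a) // sreflE; last exact: LR.
  by rewrite glB glZ scaleNr addrAC.
apply: coneD => //; apply: coneZ => //.
by rewrite oppr_ge0 mulr_ge0_le0 // xL.
Qed.

Lemma antidominant_eq L x w : L `<=` Pi -> grp L w ->
  antidominant L x -> antidominant L (w x) -> w x = x.
Proof.
move=> LPi Lw xL wxL; apply/eqP; rewrite -subr_eq0; apply/eqP.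
have LC : cone L `<=` cone Pi.
  by apply: cone_sub => a /LPi; exact: cone_self.
apply: (@cone_pointed _ _ D); apply: LC; first exact: antidominant_orbit.
rewrite opprB -{1}(glVK w x).
by apply: antidominant_orbit => //; exact: genV.
Qed.

Lemma antidominant_notin L x : L `<=` Pi -> posin L x -> ~ antidominant L x.
Proof.
move=> LPi px xL; have := posin_cone (simple_roots_sub LPi) px.
rewrite (canon_std LPi) => cx.
have le0 : forall v, cone L v -> B x v <= 0.
  apply: cone_ind => [|y v c Ly c0 _ xv]; first by rewrite linear0r.
  rewrite linearDr linearZr_LR /= -oppr_ge0 opprD addr_ge0 ?oppr_ge0 //.
  by rewrite mulr_ge0_le0 // xL.
have := le0 x cx.
by rewrite root_norm ?ler10 //; exact: pos_root (pos_in px).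
Qed.

Section Graph.
Variable h : V -> R.

(** The values that the rule for simple reflections forces on a positive root
    reached from simple roots by steps of increasing depth. *)
Inductive fgraph : V -> R -> Prop :=
| fgraph_simple a : Pi a -> fgraph a (h a)
| fgraph_step d a (x : R) : pos d -> Pi a -> B d a < 0 -> fgraph d x ->
    fgraph (srefl D a d) (x - 2 * B d a * h a).

Lemma fgraph_pos d (x : R) : fgraph d x -> pos d.
Proof.
case=> [a|{}d a {}x pd Pa lt0 _]; first exact: simple_pos.
have [da|//] := simple_srefl_pos Pa pd.
by move: lt0; rewrite da root_norm ?ltr10 //; exact: simple_root.
Qed.

Lemma fgraph_total d : pos d -> exists x : R, fgraph d x.
Proof.
move: d; apply: root_ind => [a Pa|d a pd Pa lt0 [x Fx]].
  by exists (h a); exact: fgraph_simple.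
by exists (x - 2 * B d a * h a); exact: fgraph_step.
Qed.

Lemma fgraph_up d a (x : R) : pos d -> Pi a -> d <> a -> 0 < B d a ->
  fgraph (srefl D a d) x -> fgraph d (x + 2 * B d a * h a).
Proof.
move=> pd Pa da gt0 Fx; have ra := simple_root Pa.
have := fgraph_step (fgraph_pos Fx) Pa _ Fx.
by rewrite form_srefl // sreflK mulrN mulNr opprK oppr_lt0; apply.
Qed.

Lemma fgraph_inv d (x : R) : fgraph d x ->
  (Pi d /\ x = h d) \/ exists a (y : R),
  [/\ Pi a, d <> a, 0 < B d a, fgraph (srefl D a d) y
    & x = y + 2 * B d a * h a].
Proof.
case=> [a Pa|{}d a {}x pd Pa lt0 Fx]; [by left | right].
have ra := simple_root Pa.
exists a, x; rewrite form_srefl // sreflK mulrN mulNr oppr_gt0; split=> //.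
move=> e; apply: (pos_opp (simple_pos Pa)).
by rewrite -(srefl_self ra) -{2}e sreflK.
Qed.

Lemma fgraph_simple_inv a (x : R) : Pi a -> fgraph a x -> x = h a.
Proof.
move=> Pa /fgraph_inv[[]//|[b [y [Pb ab gt0 _ _]]]].
by move: gt0; rewrite ltNge simple_obtuse.
Qed.

Section Rank2.
Variables (a b : V) (Pa : Pi a) (Pb : Pi b) (ab : a <> b).

Definition span2 v (r : R) :=
  exists k l, v = k *: a + l *: b /\ r = k * h a + l * h b.

Lemma span2_eq v r r' : span2 v r -> span2 v r' -> r = r'.
Proof.
move=> [k [l [-> ->]]] [k' [l' [e ->]]].
have [|k0 l0] := @simple_indep a b (k - k') (l - l') Pa Pb ab.
  rewrite !scalerBl addrACA e -opprD subrr //.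
by rewrite -(subrK k' k) -(subrK l' l) k0 l0 !add0r.
Qed.

Lemma span2_0 : span2 0 0.
Proof. by exists 0, 0; rewrite !scale0r !mul0r !addr0. Qed.

Lemma span2D v r c k : [set a; b] c -> span2 v r ->
  span2 (v + k *: c) (r + k * h c).
Proof.
move=> Lc [k1 [l1 [-> ->]]]; case: Lc => ->.
  exists (k1 + k), l1; rewrite scalerDl mulrDl addrAC; split=> //.
  by rewrite addrAC.
by exists k1, (l1 + k); rewrite scalerDl mulrDl !addrA.
Qed.

End Rank2.

(** Two descents of [d], starting with distinct simple reflections [s_a] and
    [s_b], continue inside the dihedral group they generate down to the unique
    antidominant element of the orbit of [d], or to [a] or [b] if [d] is a
    root of that group.  The values differ along either path by the linear
    form on the plane of [a] and [b] that [h] prescribes, so they agree. *)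
Lemma fgraph_uniq d (x y : R) : fgraph d x -> fgraph d y -> x = y.
Proof.
move=> Fx Fy; have pd := fgraph_pos Fx; have [n hn] := depth_exists pd.
elim: n d x y pd hn Fx Fy => [|n IHn] d x y pd hn Fx Fy.
  by case: (depth0 pd hn).
case: (fgraph_inv Fx) => [[Pd xd]|[a [x1 [Pa da gta Fx1 ex]]]].
  by rewrite xd (fgraph_simple_inv Pd Fy).
case: (fgraph_inv Fy) => [[Pd yd]|[b [y1 [Pb db gtb Fy1 ey]]]].
  by rewrite yd (fgraph_simple_inv Pd Fx).
have hx1 := depth_step pd Pa da gta hn; have hy1 := depth_step pd Pb db gtb hn.
have [eab|/eqP ab] := eqVneq a b.
  rewrite ex ey -eab; congr (_ + _); apply: (IHn (srefl D a d)) => //.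
    exact: fgraph_pos Fx1.
  by rewrite eab.
pose L := [set a; b].
have LPi : L `<=` Pi by move=> c [] ->.
have LR := simple_roots_sub LPi.
pose bottom f (r : R) := exists d0 (x0 : R),
  [/\ depth_le (D := D) d0 n, fgraph d0 x0,
  span2 a b (f - d0) (r - x0), (exists2 w, grp L w & d0 = w f)
  & L d0 \/ antidominant L d0].
have lift c f r : L c -> bottom (srefl D c f) r ->
    bottom f (r + 2 * B f c * h c).
  move=> Lc [d0 [x0 [hd0 F0 s0 [w Lw e0] last0]]]; exists d0, x0; split=> //.
    have -> : f - d0 = (srefl D c f - d0) + (2 * B f c) *: c.
      by rewrite sreflE; [rewrite addrAC subrK | exact: LR].
    by rewrite [X in span2 _ _ _ X]addrAC; exact: span2D.
  exists (w * srefl D c)%g => //.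
  by apply: genM => //; exact: gen_refl.
have descent m f r : (m <= n)%N -> depth_le (D := D) f m -> fgraph f r ->
    bottom f r.
  elim: m f r => [|m IHm] f r mn hf Fr; have pf := fgraph_pos Fr.
    by case: (depth0 pf).
  have [last|nlast] := pselect (L f \/ antidominant L f).
    exists f, r; rewrite !subrr; split=> //; first exact: depth_le_trans hf.
      exact: span2_0.
    by exists 1%g; rewrite ?gl1E //; exact: gen1.
  have [c Lc gtc] : exists2 c, L c & 0 < B f c.
    apply: contrapT => none; apply: nlast; right => c Lc.
    by rewrite leNgt; apply/negP => gtc; apply: none; exists c.
  have fc : f <> c by move=> fc; apply: nlast; left; rewrite fc.
  have hsf := depth_step pf (LPi _ Lc) fc gtc hf.
  have psf : pos (srefl D c f) by have [] := simple_srefl_pos (LPi _ Lc) pf.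
  have [r1 Fr1] := fgraph_total psf.
  have -> : r = r1 + 2 * B f c * h c.
    apply: (IHn f) => //; first exact: depth_le_trans hf.
    exact: fgraph_up (LPi _ Lc) fc gtc Fr1.
  by apply: lift => //; apply: IHm => //; exact: ltnW.
have [d0 [x0 [hd0 F0 s0 [w Lw e0] last0]]] : bottom d x.
  by rewrite ex; apply: lift; [left | exact: (descent n)].
have [d1 [y0 [hd1 F1 s1 [z Lz e1] last1]]] : bottom d y.
  by rewrite ey; apply: lift; [right | exact: (descent n)].
have e01 : d1 = (z * w^-1)%g d0 by rewrite e0 glME glVK.
have Lzw : grp L (z * w^-1)%g by apply: genM => //; exact: genV.
have inL f r f0 r0 : span2 a b (f - f0) (r - r0) -> fgraph f0 r0 -> L f0 ->
    span2 a b f r.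
  move=> s F L0; have := span2D 1 L0 s.
  by rewrite scale1r mul1r -(fgraph_simple_inv (LPi _ L0) F) !subrK.
have mixed f w' : L f -> grp L w' -> pos (w' f) -> ~ antidominant L (w' f).
  move=> Lf Lw' pw; apply: antidominant_notin => //; split=> //.
  apply: canon_act => //; split; first exact: LR.
  exact: gen_refl.
case: last0 last1 => [L0|A0] [L1|A1].
- exact: span2_eq (inL _ _ _ _ s0 F0 L0) (inL _ _ _ _ s1 F1 L1).
- case: (mixed _ _ L0 Lzw); rewrite -e01 //; exact: fgraph_pos F1.
- have e10 : d0 = (z * w^-1)^-1%g d1 by rewrite e01 glVK.
  case: (mixed _ _ L1 (genV Lzw)); rewrite -e10 //; exact: fgraph_pos F0.
- have d10 : d1 = d0.
    by rewrite e01; apply: (antidominant_eq LPi); rewrite -?e01.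
  move: F1 s1; rewrite d10 => F1 s1.
  rewrite (IHn d0 y0 x0 (fgraph_pos F0) hd0 F1 F0) in s1.
  by apply: (addIr (- x0)); exact: span2_eq s0 s1.
Qed.

End Graph.

(** These functions behave like restrictions of linear forms to the roots.  They
    replace linear forms because they can take arbitrary values on the simple
    roots, even when these are linearly dependent. *)
Definition root_functional (f : V -> R) := forall e d,
  roots D e -> roots D d -> f (srefl D e d) = f d - 2 * B d e * f e.

(** By [fgraph_uniq] the values obtained by climbing from the simple roots are
    well defined, and they satisfy the rule for simple reflections.  It extends
    to all reflections because [s_{s_a e} = s_a s_e s_a]. *)
Lemma root_functional_exists (h : V -> R) :
  exists2 f, root_functional f & forall a, Pi a -> f a = h a.
Proof.
pose val d := xget 0 [set x | fgraph h d x].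
have valP d : pos d -> fgraph h d (val d).
  by move=> /(fgraph_total h)[x Fx]; rewrite /val; case: xgetP => // /(_ x).
have valE d (x : R) : fgraph h d x -> val d = x.
  by move=> Fx; apply: fgraph_uniq (valP _ (fgraph_pos Fx)) Fx.
pose f d := if `[< pos d >] then val d else - val (- d).
have fpos d : pos d -> f d = val d by rewrite /f => /asboolT ->.
have fopp d : roots D d -> f (- d) = - f d.
  move=> rd; have [pd|pN] := root_sign rd.
    by rewrite (fpos d) // /f opprK asboolF //; exact: pos_opp.
  by rewrite (fpos (- d)) // /f asboolF ?opprK // => /pos_opp.
have fsimple a : Pi a -> f a = h a.
  move=> Pa; rewrite fpos; last exact: simple_pos.
  by apply: valE; exact: fgraph_simple.
have rule_pos a d : Pi a -> pos d -> f (srefl D a d) = f d - 2 * B d a * f a.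
  move=> Pa pd; have ra := simple_root Pa.
  have [-> |/eqP da] := eqVneq d a.
    by rewrite srefl_self // fopp // root_norm //; lra.
  have [//|ps] := simple_srefl_pos Pa pd.
  rewrite (fsimple a) // !fpos //.
  have [lt0|gt0|B0] := ltgtP (B d a) 0.
  - by apply: valE; exact: fgraph_step (valP _ pd).
  - by rewrite (valE _ _ (fgraph_up pd Pa da gt0 (valP _ ps))) addrK.
  - by rewrite sreflE // B0 mulr0 scale0r mul0r !subr0.
have rule a d : Pi a -> roots D d ->
    f (srefl D a d) = f d - 2 * B d a * f a.
  move=> Pa rd; have [pd|pN] := root_sign rd; first exact: rule_pos.
  have := rule_pos a (- d) Pa pN.
  rewrite glN !fopp ?linearNl //; last exact/roots_srefl/rd/simple_root.
  rewrite /= => /eqP; rewrite mulrN mulNr opprK eqr_oppLR opprD opprK.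
  by move=> /eqP.
have rulep : forall e, pos e -> forall d, roots D d ->
    f (srefl D e d) = f d - 2 * B d e * f e.
  apply: root_ind => [a Pa d rd|e a pe Pa _ IHe d rd]; first exact: rule.
  have [ra re] := (simple_root Pa, pos_root pe).
  have rsd := roots_srefl ra rd.
  rewrite (srefl_conj _ (weyl_srefl ra)) !glME [_^-1%g]reflV.
  rewrite (rule _ _ Pa (roots_srefl re rsd)) (IHe _ rsd) !(rule _ _ Pa) //.
  have -> : B (srefl D e (srefl D a d)) a =
      - B d a - 2 * B (srefl D a d) e * B e a.
    by rewrite (sreflE _ re) linearBl linearZl_LR /= form_srefl.
  have -> : B d (srefl D a e) = B (srefl D a d) e.
    by rewrite -{1}[d](sreflK (D := D) a) (weyl_isometry (weyl_srefl ra)).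
  ring.
exists f => // e d re rd; have [pe|pN] := root_sign re; first exact: rulep.
rewrite -sreflN rulep // fopp // linearNr; ring.
Qed.

Variables (f : V -> R) (fP : root_functional f).

Lemma root_functionalN d : roots D d -> f (- d) = - f d.
Proof.
by move=> rd; rewrite -(srefl_self rd) fP // root_norm //; lra.
Qed.

Lemma root_functional_ge0 : (forall a, Pi a -> 0 <= f a) ->
  forall d, pos d -> 0 <= f d.
Proof.
move=> f0; apply: root_ind => // d a pd Pa lt0 fd.
rewrite (fP (simple_root Pa) (pos_root pd)).
by rewrite subr_ge0 (le_trans _ fd) // mulr_le0_ge0 ?f0 //; lra.
Qed.

(** The values can only grow from a root to one of larger depth, so a zero of
    [f] is reached from zeros of [f] only.  The statement is about membership in
    a parabolic subgroup because, when the simple roots are dependent, a root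
    may lie in the cone of [X] without its reflection lying in the subgroup
    of [X]. *)
Lemma root_functional_zero : (forall a, Pi a -> 0 <= f a) ->
  forall d, pos d -> f d = 0 -> grp [set a | Pi a /\ f a = 0] (srefl D d).
Proof.
move=> f0; apply: root_ind => [a Pa fa|d a pd Pa lt0 IHd].
  exact: grp_srefl.
have ra := simple_root Pa; have fd := root_functional_ge0 f0 pd.
rewrite (fP ra (pos_root pd)) => e.
have fa0 : f a = 0 by have := f0 a Pa; nra.
have Ga : grp [set a | Pi a /\ f a = 0] (srefl D a) by exact: grp_srefl.
apply: grp_conj => //; first exact: weyl_srefl.
by apply: IHd; move: e; rewrite fa0 mulr0 subr0.
Qed.

Lemma root_functional_grp X w d :
  X `<=` roots D -> (forall a, X a -> f a = 0) ->
  grp X w -> roots D d -> f (w d) = f d.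
Proof.
move=> XR fX /genP[s sX ->] rd; elim: s sX => [|a s IHs] sX.
  by rewrite word_nil gl1E.
have Xa : X a by apply: sX; rewrite /= mem_head.
have {}sX : [set` s] `<=` X.
  by move=> b bs; apply: sX; rewrite /= inE bs orbT.
have Ws : weyl D (word B s) by apply: (grp_weyl XR); exact: gen_word.
rewrite word_cons glME [LHS](fP (XR _ Xa) (roots_act Ws rd)).
by rewrite (fX _ Xa) mulr0 subr0 IHs.
Qed.

(** The functional is constant on orbits of the subgroup, one of whose elements
    maps [d] to [- d]. *)
Lemma root_functional_in0 X d : X `<=` roots D -> (forall a, X a -> f a = 0) ->
  roots_in D (grp X) d -> f d = 0.
Proof.
move=> XR fX [rd Xd]; have := root_functional_grp XR fX Xd rd.
by rewrite srefl_self // root_functionalN //; lra.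
Qed.

Lemma root_functional_comp w : weyl D w -> root_functional (fun d => f (w d)).
Proof.
move=> Ww e d re rd; have [rwe rwd] := (roots_act Ww re, roots_act Ww rd).
rewrite -[B d e](weyl_isometry Ww) -(fP rwe rwd) srefl_conj //.
by rewrite !glME glVK.
Qed.

End RootFunctionals.

Section FunctionalAlgebra.
Context {R : realType} {V : lmodType R} (D : based_root_system V).
Implicit Types (f g : V -> R).

Lemma root_functional_lin f g k l : root_functional D f ->
  root_functional D g -> root_functional D (fun d => k * f d + l * g d).
Proof. by move=> fP gP e d re rd; rewrite fP // gP //; ring. Qed.

Lemma root_functional_sum (T : eqType) (r : seq T) (F : T -> V -> R) :
  (forall i, i \in r -> root_functional D (F i)) ->
  root_functional D (fun d => \sum_(i <- r) F i d).
Proof.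
move=> FP e d re rd; elim: r FP => [|i r IHr] FP.
  by rewrite !big_nil; ring.
have FPr j : j \in r -> root_functional D (F j).
  by move=> jr; apply: FP; rewrite inE jr orbT.
by rewrite !big_cons (FP i (mem_head i r)) // (IHr FPr); ring.
Qed.

Lemma root_functional_eq f g : root_functional D f -> root_functional D g ->
  (forall a, simple D a -> f a = g a) -> forall d, roots D d -> f d = g d.
Proof.
move=> fP gP fg; have eqp : forall d, pos_roots D d -> f d = g d.
  apply: root_ind => // d a pd Pa _ e.
  have [ra rd] := (simple_root Pa, pos_root pd).
  by rewrite (fP _ _ ra rd) (gP _ _ ra rd) e fg.
move=> d rd; have [/eqp //|/eqp] := root_sign rd.
by rewrite !(root_functionalN _ rd) // => /oppr_inj.
Qed.

End FunctionalAlgebra.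

(** * Subgroups of corank one over a standard parabolic *)

Section RankOne.
Context {R : realType} {V : lmodType R} {D : based_root_system V}.
Implicit Types (a b d e g x y u v : V) (w z : gl V) (J K L X Y : set V).
Implicit Types (U : set (gl V)).
Local Notation B := (Defs.bform D).
Local Notation Pi := (simple D).
Local Notation pos := (pos_roots D).
Local Notation grp := (std_parabolic D).
Local Notation posin X := (pos_roots_in D (std_parabolic D X)).

Lemma conj_gen_sub (gT : groupType) (w : gT) (A : set gT) (C : set gT) :
  subgroup C -> conj_set w A `<=` C -> conj_set w (gen A) `<=` C.
Proof.
move=> sC AC _ [x Ax <-].
have sub : gen A `<=` [set x | C (w * x * w^-1)%g]; last exact: sub Ax.
apply: smallest_sub => [|y Ay]; last by apply: AC; exists y.
have [C1 CV] := sC; split=> [|y z]; rewrite !inE /=.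
  by rewrite mulg1 mulgV; move: C1; rewrite inE.
move=> Cy Cz; have := CV _ _ (mem_set Cy) (mem_set Cz); rewrite inE.
by rewrite !invgM invgK !mulgA mulgVK.
Qed.

Lemma conj_set1 U : conj_set 1%g U = U.
Proof.
apply/seteqP; split=> [_ [u Uu <-]|u Uu]; first by rewrite mul1g invg1 mulg1.
by exists u; rewrite ?mul1g ?invg1 ?mulg1.
Qed.

Lemma conj_setM w z U : conj_set (w * z)%g U = conj_set w (conj_set z U).
Proof.
apply/seteqP; split=> [_ [u Uu <-]|_ [_ [u Uu <-] <-]].
  by exists (z * u * z^-1)%g; [exists u | rewrite invgM !mulgA].
by exists u => //; rewrite invgM !mulgA.
Qed.

Lemma conj_setK w U : conj_set w^-1%g (conj_set w U) = U.
Proof. by rewrite -conj_setM mulVg conj_set1. Qed.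

Lemma conj_set_mono w U U' : U `<=` U' -> conj_set w U `<=` conj_set w U'.
Proof. by move=> UU _ [u /UU Uu <-]; exists u. Qed.

Lemma conj_setE w U z : conj_set w U (w * z * w^-1)%g <-> U z.
Proof.
split=> [[u Uu /mulIg/mulgI <- //]|Uz]; by exists z.
Qed.

Lemma conj_grp_sub w X : weyl D w ->
  conj_set w (grp X) `<=` grp (w @` X).
Proof.
move=> Ww; apply: conj_gen_sub; first exact: gen_subgroup.
move=> _ [_ [a Xa <-] <-]; rewrite -[X in grp _ X](srefl_conj (D := D)) //.
by apply: grp_srefl; exists a.
Qed.

Lemma image_weylV w X : (w^-1)%g @` (w @` X) = X.
Proof.
rewrite image_comp (eq_imagel (f' := id)) ?image_id // => v _ /=.
exact: glVK.
Qed.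

Lemma conj_grp w X : weyl D w -> conj_set w (grp X) = grp (w @` X).
Proof.
move=> Ww; apply/seteqP; split; first exact: conj_grp_sub.
rewrite -{1}[grp _](conj_setK w^-1%g) invgK.
apply: conj_set_mono; have := @conj_grp_sub w^-1%g (w @` X) (weylV Ww).
by rewrite image_weylV.
Qed.

Lemma conj_srefl w U a : weyl D w ->
  conj_set w U (srefl D (w a)) <-> U (srefl D a).
Proof. by move=> Ww; rewrite srefl_conj // conj_setE. Qed.

Lemma grp_image_srefl w X a : weyl D w ->
  grp (w @` X) (srefl D (w a)) <-> grp X (srefl D a).
Proof. by move=> Ww; rewrite -conj_grp // conj_srefl. Qed.

Definition newpos J U : set V :=
  [set d | [/\ pos d, U (srefl D d) & ~ grp J (srefl D d)]].

Lemma newposE J U :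
  newpos J U = pos_roots_in D U `\` pos_roots_in D (grp J).
Proof.
apply/seteqP; split=> [d [pd Ud nd]|d [[[rd Ud] pd] nd]].
  by split=> [|[[]]] //; split=> //; split=> //; exact: pos_root.
by split=> // Jd; apply: nd; split=> //; split.
Qed.

Lemma R_P J U : J `<=` Pi -> R_ D J U <->
  exists b, [/\ pos b, ~ grp J (srefl D b) & U = grp (J `|` [set b])].
Proof.
move=> JPi; split=> [[_ JU [[T' [[T'U eU] cT']] minT]]|[b [pb nb ->]]].
  have [t tE] : exists t, T' = [set t].
    have /card_set_bijP[f [fT finj fsurj]] : (T' #= `I_1)%card.
      by rewrite card_eq_sym.
    have [t T't ft] := fsurj 0%N (ltn0Sn 0).
    exists t; apply/seteqP; split=> [x T'x|x -> //].
    have : f x = f t.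
      have := fT _ T'x; have := fT _ T't; rewrite /= !ltnS !leqn0.
      by move=> /eqP -> /eqP ->.
    by apply: finj; rewrite inE.
  have [Ut /pos_refl[b pb tb]] : (U `&` refls D) t by apply: T'U; rewrite tE.
  exists b; split=> //.
    move=> nb; suff : (`I_1 #<= @set0 (gl V))%card.
      by rewrite card_le0 => /eqP; rewrite predeqE => /(_ 0%N)[/(_ isT)].
    apply: minT; split=> //; rewrite {1}eU setU0 tE; congr gen.
    apply/seteqP; split=> [x [//|->]|x]; last by left.
    by split; rewrite tb //; exists b => //; exact: pos_root.
  apply/seteqP; split.
    rewrite eU tE tb; apply: gen_sub => x [[Jx _]|->].
      by apply: grp_mono Jx => a; left.
    by apply: gen_refl; right.
  rewrite eU tE tb; apply: gen_sub => _ [a [Ja|->] <-].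
    apply: sub_gen_smallest; left; split; first exact: grp_srefl.
    by exists a => //; exact/simple_root/JPi.
  by apply: sub_gen_smallest; right.
have XR : J `|` [set b] `<=` roots D.
  by move=> a [/JPi/simple_root|->] //; exact: pos_root.
have gU : grp (J `|` [set b]) = gen ((grp J `&` refls D) `|` [set srefl D b]).
  apply/seteqP; split; apply: gen_sub.
    move=> _ [a [Ja|->] <-]; last by apply: sub_gen_smallest; right.
    apply: sub_gen_smallest; left; split; first exact: grp_srefl.
    by exists a => //; exact/simple_root/JPi.
  move=> x [[Jx _]|->]; last by apply: gen_refl; right.
  by apply: grp_mono Jx => a; left.
split.
- apply/seteqP; split; apply: gen_sub; last by move=> x [].
  move=> _ [a Xa <-]; apply: sub_gen_smallest; split; first exact: grp_srefl.
  by exists a => //; exact: XR.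
- by apply: grp_mono => a; left.
split.
  exists [set srefl D b]; split; last by rewrite card_eq_sym card_set1.
  split=> // _ ->; split; first by apply: grp_srefl; right.
  by exists b => //; exact: pos_root.
move=> T' [T'U eU]; have [T'0|/set0P[t T't]] := eqVneq T' set0.
  case: nb; have : grp (J `|` [set b]) (srefl D b) by apply: grp_srefl; right.
  by rewrite eU T'0 setU0; apply: gen_sub => x [].
have <- : ([set t] #<= T')%card = (`I_1 #<= T')%card.
  exact/card_le_eql/card_set1.
by apply: subset_card_le => _ ->.
Qed.

Lemma R_ex J U : J `<=` Pi -> R_ D J U ->
  exists2 b, newpos J U b & U = grp (J `|` [set b]).
Proof.
move=> JPi /(R_P _ JPi)[b [pb nb ->]]; exists b => //; split=> //.
by apply: grp_srefl; right.
Qed.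

Lemma R_grp J b : J `<=` Pi -> roots D b -> ~ grp J (srefl D b) ->
  R_ D J (grp (J `|` [set b])).
Proof.
move=> JPi rb nb; apply/R_P => //; have [pb|pN] := root_sign rb.
  by exists b.
exists (- b); split=> //; first by rewrite sreflN.
congr gen; apply/seteqP; split=> _ [a [Ja|->] <-].
- by exists a => //; left.
- by exists (- b); [right | exact: reflN].
- by exists a => //; left.
- by exists b; [right | exact/esym/reflN].
Qed.

Lemma simple_in_parabolic J X g : J `<=` Pi -> J `<=` X ->
  canon_simple (D := D) X g -> grp J (srefl D g) -> J g.
Proof.
move=> JPi JX Cg Jg; have pg := pos_in Cg.1; have rg := pos_root pg.
have [|a Ja na] := std_descent JPi Jg.
  move=> e; have := srefl_self rg; rewrite e gl1E => e'.
  by apply: (pos_opp pg); rewrite -e'.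
have pa : posin X a.
  split; last exact/simple_pos/JPi.
  by split; [exact/simple_root/JPi | apply: grp_srefl; exact: JX].
by have [<-|] := Cg.2 _ pa.
Qed.

(** If [U] had two simple roots outside [J], a suitable combination of the
    corresponding coordinate functionals would vanish on [J] and on the root of
    the additional generator, hence on all roots of [U]. *)
Lemma R_canon J U : J `<=` Pi -> R_ D J U -> exists g,
  [/\ newpos J U g, U = grp (J `|` [set g])
    & canon_simple (D := D) (J `|` [set g]) = J `|` [set g]].
Proof.
move=> JPi /(R_P _ JPi)[b [pb nb ->]]; set X := J `|` [set b].
have XR : X `<=` roots D.
  by move=> a [/JPi/simple_root|->] //; exact: pos_root.
pose C := canon_simple (D := D) X; pose E := canon XR.
have JX : J `<=` X by move=> a; left.
have JC : J `<=` C by move=> a Ja; apply: simple_canon; [|left|exact: JPi].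
have gC : gen [set srefl D a | a in C] = grp X by exact: canon_gen.
have [g Cg nJg] : exists2 g, C g & ~ J g.
  apply: contrapT => none; apply: nb.
  have CJ : C `<=` J.
    by move=> a Ca; apply: contrapT => nJ; apply: none; exists a.
  have : grp X (srefl D b) by apply: grp_srefl; right.
  by rewrite -gC; apply: grp_mono.
have XE : X `<=` roots E.
  rewrite canon_rootsE => a Xa; split; first exact: (XR _ Xa).
  exact: grp_srefl.
have CE a : C a -> roots_in E (std_parabolic E X) a.
  move=> Ca; split; first exact: (@simple_root _ _ E).
  exact: posin_grp Ca.1.
have CX : C = J `|` [set g].
  apply/seteqP; split=> [g' Cg'|a [/JC //|-> //]].
  apply: contrapT => /not_orP[nJg' gg'].
  pose delta (c a : V) : R := if `[< a = c >] then 1 else 0.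
  have deltaE c : delta c c = 1 by rewrite /delta asboolT.
  have deltaN c a : a <> c -> delta c a = 0.
    by move=> ac; rewrite /delta asboolF.
  have [f1 f1P f1E] := root_functional_exists E (delta g).
  have [f2 f2P f2E] := root_functional_exists E (delta g').
  have fJ f c : (forall a, C a -> f a = delta c a) -> ~ J c ->
      forall a, J a -> f a = 0.
    move=> fE nJc a Ja; rewrite fE; last exact: JC.
    by apply: deltaN => ac; apply: nJc; rewrite -ac.
  have fP := root_functional_lin (f2 b) (- f1 b) f1P f2P.
  have f0 a : X a -> f2 b * f1 a + - f1 b * f2 a = 0.
    move=> [Ja|->]; last by ring.
    by rewrite (fJ _ _ f1E nJg _ Ja) (fJ _ _ f2E nJg' _ Ja) !mulr0 addr0.
  have vanish := root_functional_in0 fP XE f0.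
  have := vanish _ (CE _ Cg); rewrite (f1E _ Cg) (f2E _ Cg) deltaE.
  rewrite deltaN; last by move=> e; apply: gg'.
  rewrite mulr1 mulr0 addr0 => f2b.
  have := vanish _ (CE _ Cg'); rewrite (f1E _ Cg') (f2E _ Cg') deltaE deltaN //.
  rewrite mulr1 mulr0 add0r => /eqP; rewrite oppr_eq0 => /eqP f1b.
  have f10 a : X a -> f1 a = 0 by move=> [Ja|->] //; rewrite (fJ _ _ f1E nJg).
  have := root_functional_in0 f1P XE f10 (CE _ Cg).
  by rewrite f1E // deltaE => /eqP; rewrite oner_eq0.
have gX : grp X = grp (J `|` [set g]) by rewrite -gC CX.
exists g; split=> //.
  split; [exact: pos_in Cg.1 | exact: posin_grp Cg.1 |].
  by move=> /(simple_in_parabolic JPi JX Cg).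
by rewrite -{2}CX /C /canon_simple -gX.
Qed.

End RankOne.

(** * Uniform signs *)

Section Signs.
Context {R : realType} {V : lmodType R} {D : based_root_system V}.
Implicit Types (a b d e g x y u v : V) (w z : gl V) (J K L X Y : set V).
Implicit Types (U P : set (gl V)).
Local Notation B := (Defs.bform D).
Local Notation Pi := (simple D).
Local Notation pos := (pos_roots D).
Local Notation grp := (std_parabolic D).
Local Notation posin X := (pos_roots_in D (std_parabolic D X)).
Local Notation newpos := (newpos (D := D)).

Lemma newpos_root J U d : newpos J U d -> roots D d.
Proof. by move=> [/pos_root]. Qed.

Lemma newpos_in J U d : newpos J U d -> roots_in D U d.
Proof. by move=> [/pos_root rd Ud _]. Qed.

Lemma newpos_conj J U w d : weyl D w -> newpos J U d -> pos (w d) ->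
  newpos (w @` J) (conj_set w U) (w d).
Proof.
by move=> Ww [pd Ud nd] pwd; split; rewrite ?conj_srefl ?grp_image_srefl.
Qed.

Lemma newpos_conjN J U w d : weyl D w -> newpos J U d -> ~ pos (w d) ->
  newpos (w @` J) (conj_set w U) (- w d).
Proof.
move=> Ww /[dup] nd [pd Ud Jd] /npos_opp pN.
split; rewrite ?sreflN ?conj_srefl ?grp_image_srefl //.
by apply: pN; apply: roots_act => //; exact: pos_root.
Qed.

Lemma R_conj J U w : J `<=` Pi -> weyl D w -> w @` J `<=` Pi ->
  R_ D J U -> R_ D (w @` J) (conj_set w U).
Proof.
move=> JPi Ww KPi /(R_P _ JPi)[b [pb nb ->]].
rewrite conj_grp // image_setU image_set1; apply: R_grp => //.
  by apply: roots_act => //; exact: pos_root.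
by rewrite grp_image_srefl.
Qed.

Definition functional_on U (f : V -> R) := forall e d,
  roots_in D U e -> roots_in D U d -> f (srefl D e d) = f d - 2 * B d e * f e.

(** By [R_canon] a functional on the roots of [U] that vanishes on [J] is
    determined by its value at a single simple root, and the one with value [1]
    there is positive at all new positive roots. *)
Lemma R_coordinate J U : J `<=` Pi -> R_ D J U -> exists g f,
  [/\ newpos J U g, forall d, newpos J U d -> 0 < f d, functional_on U f,
      forall a, J a -> f a = 0
    & forall h, functional_on U h -> (forall a, J a -> h a = 0) ->
        forall d, roots_in D U d -> h d = h g * f d].
Proof.
move=> JPi /(R_canon JPi)[g [ng eU CX]]; subst U.
set X := J `|` [set g] in ng CX *.
have XR : X `<=` roots D.
  by move=> a [/JPi/simple_root|->] //; exact: newpos_root ng.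
pose E := canon XR.
have simpleE a : simple E a <-> X a by rewrite -[in X in _ <-> X]CX.
pose h0 a : R := if `[< a = g >] then 1 else 0.
have [f fP fE] := root_functional_exists E h0.
have rootsE h : root_functional E h <-> functional_on (grp X) h.
  by rewrite /root_functional canon_rootsE.
have fJ a : J a -> f a = 0.
  move=> Ja; rewrite fE; last by apply/simpleE; left.
  rewrite /h0 asboolF // => ag; case: ng => _ _; apply.
  by rewrite -ag; exact: grp_srefl.
have fg : f g = 1 by rewrite fE /h0 ?asboolT //; apply/simpleE; right.
have f0 a : simple E a -> 0 <= f a.
  by move=> /simpleE[/fJ ->|->] //; rewrite fg ler01.
exists g, f; split=> //; last first.
- move=> h /rootsE hP hJ d rd.
  have := root_functional_eq hP (root_functional_lin (h g) 0 fP fP).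
  rewrite canon_rootsE => /(_ _ _ rd) ->; first by rewrite mul0r addr0.
  move=> a /simpleE[Ja|->]; first by rewrite hJ // fJ // mulr0 mul0r addr0.
  by rewrite fg mulr1 mul0r addr0.
- exact/rootsE.
move=> d [pd Xd nd]; have pEd : pos_roots E d.
  by rewrite canon_posE; split=> //; split=> //; exact: pos_root.
rewrite lt_neqAle (root_functional_ge0 fP f0 pEd) andbT; apply/negP => /eqP e.
apply: nd; have := root_functional_zero fP f0 pEd (esym e).
apply: grp_mono => a [/simpleE[//|->]]; rewrite fg => /eqP.
by rewrite oner_eq0.
Qed.

Lemma functional_onN U f d : functional_on U f -> roots_in D U d ->
  f (- d) = - f d.
Proof.
move=> fP rd; have := fP d d rd rd.
by rewrite srefl_self ?root_norm => [->||]; [lra | case: rd..].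
Qed.

(** A morphism [J -> K] of the groupoid carries the coordinate functional of
    [w U w^-1] relative to [K] to a multiple of that of [U] relative to [J],
    and the sign of the factor is the common sign of all [w d]. *)
Lemma R_sign J U w d e : J `<=` Pi -> R_ D J U -> weyl D w -> w @` J `<=` Pi ->
  newpos J U d -> newpos J U e -> pos (w d) <-> pos (w e).
Proof.
move=> JPi RU Ww KPi.
have [g [f [ng f0 fP fJ funiq]]] := R_coordinate JPi RU.
have [g' [f' [ng' f'0 f'P f'K _]]] := R_coordinate KPi (R_conj JPi Ww KPi RU).
have act x : roots_in D U x -> roots_in D (conj_set w U) (w x).
  by move=> [rx Ux]; split; [exact: roots_act | rewrite conj_srefl].
have hP : functional_on U (fun x => f' (w x)).
  move=> a b ra rb; rewrite -(weyl_isometry Ww b a).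
  rewrite -(f'P _ _ (act _ ra) (act _ rb)).
  by rewrite srefl_conj // !glME glVK.
have hJ a : J a -> f' (w a) = 0 by move=> Ja; apply: f'K; exists a.
have main x : newpos J U x -> pos (w x) <-> 0 < f' (w g).
  move=> nx; have rx := newpos_in nx; have fx := f0 _ nx.
  have hx := funiq _ hP hJ _ rx; have [px|nnx] := pselect (pos (w x)).
    split=> // _; rewrite -(pmulr_lgt0 _ fx) -hx.
    by apply: f'0; exact: newpos_conj.
  split=> // lt; exfalso; have := f'0 _ (newpos_conjN Ww nx nnx).
  rewrite (functional_onN f'P (act _ rx)) hx oppr_gt0 pmulr_llt0 //.
  by move=> lt'; have := lt_trans lt lt'; rewrite ltxx.
by move=> /main -> /main ->.
Qed.

Lemma R_eta J U w d : J `<=` Pi -> R_ D J U -> weyl D w -> w @` J `<=` Pi ->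
  newpos J U d -> eta D w U J <-> ~ pos (w d).
Proof.
move=> JPi RU Ww KPi nd; have WV := weylV Ww; split=> [/asboolP sub|nwd].
  have [pd Ud Jd] := nd; have := NsetE WV pd; rewrite invgK => <-.
  by apply: sub; split=> //; exists d => //; exact: pos_root.
apply/asboolP => t [[Ut Jt] /pos_refl[e pe te]]; rewrite te in Ut Jt *.
apply/(NsetE WV pe); rewrite invgK.
have ne : newpos J U e by [].
by move=> /(R_sign JPi RU Ww KPi ne nd).
Qed.

Lemma newpos_finite J U : finite_set (newpos J U) <->
  finite_set ((U `\` grp J) `&` refls D).
Proof.
have -> : (U `\` grp J) `&` refls D = srefl D @` newpos J U.
  apply/seteqP; split=> [t [[Ut Jt] /pos_refl[d pd td]]|_ [d [pd Ud Jd] <-]].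
    by rewrite td in Ut Jt *; exists d.
  by split=> //; exists d => //; exact: pos_root.
split=> [|fin]; first exact: finite_image.
have : (srefl D @` newpos J U #= newpos J U)%card.
  apply: inj_card_eq => a b; rewrite !inE => -[pa _ _] [pb _ _].
  exact: srefl_inj.
by move=> /eq_finite_set <-.
Qed.

(** As [a] is extremal, all the elements of [K] that occur in [d] have image [a]
    under [z], so [d] is one of them. *)
Lemma simple_preimage K z d a : (forall k, K k -> pos (z k)) -> cone K d ->
  z d = a -> Pi a -> K d.
Proof.
move=> Kpos cd zd Pa.
have main : forall v, cone K v -> cone Pi (z v) /\ (v = 0 \/ exists k c v',
    [/\ K k, 0 < c, cone Pi (z v') & v = c *: k + v']).
  apply: cone_ind => [|x v c Kx c0 _ [czv IHv]].
    by rewrite gl0; split; [exact: cone0 | left].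
  split.
    rewrite glD glZ; apply: coneD => //; apply: coneZ => //.
    exact/cone_pos/Kpos.
  have [->|cn0] := eqVneq c 0; first by rewrite scale0r add0r.
  by right; exists x, c, v; split=> //; rewrite lt_neqAle eq_sym cn0.
have [_ [d0|[k [c [v' [Kk c0 cv' e]]]]]] := main d cd.
  by case: (roots_neq0 (simple_root Pa)); rewrite -zd d0 gl0.
suff -> : d = k by [].
apply: (can_inj (gl_funK z)); rewrite zd; apply/esym.
apply: (simple_indec Pa (Kpos _ Kk) cv' c0).
by rewrite -zd e glD glZ.
Qed.

Lemma inversion_in L z d : L `<=` Pi -> grp L z -> pos d -> ~ pos (z d) ->
  grp L (srefl D d).
Proof.
move=> LPi /genP[s sL ->] pd nd.
have L1 b : L b -> B b b = 1 by move=> /LPi; exact: simple_norm1.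
have Lp b x : L b -> pos x -> x = b \/ pos (refl B b x).
  by move=> /LPi; exact: simple_srefl_pos.
have [s' [s'L _ es']] := exchange L1 Lp sL pd nd.
have -> : srefl D d = ((word B s)^-1 * word B s')%g by rewrite -es' mulKg.
by apply: genM; [apply: genV|]; exact: gen_word.
Qed.

Lemma pos_push L (y0 : gl V) d : (forall l, L l -> pos (y0 l)) -> weyl D y0 ->
  cone L d -> roots D d -> pos (y0 d).
Proof.
move=> Ly Wy cd rd; split; first exact: roots_act.
by apply: (cone_linear (f := y0)) cd => l /Ly; exact: cone_pos.
Qed.

Lemma pos_pull L (y0 : gl V) d : L `<=` Pi -> (forall l, L l -> pos (y0 l)) ->
  weyl D y0 -> roots D d -> grp L (srefl D d) -> pos (y0 d) -> posin L d.
Proof.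
move=> LPi Ly Wy rd Ld pyd; split; first by split.
apply: contrapT => /npos_opp => /(_ rd) pN.
have pNL : posin L (- d).
  by split=> //; split; [exact: roots_opp | rewrite sreflN].
have := posin_cone (simple_roots_sub LPi) pNL; rewrite (canon_std LPi) => cN.
have := pos_push Ly Wy cN (roots_opp rd).
by rewrite glN; exact: pos_opp.
Qed.

Lemma posin_std_cone L d : L `<=` Pi -> posin L d -> cone L d.
Proof.
by move=> LPi /(posin_cone (simple_roots_sub LPi)); rewrite (canon_std LPi).
Qed.

End Signs.

(** * Transport along morphisms and coset representatives *)

Section Closures.
Context {R : realType} {V : lmodType R} {D : based_root_system V}.
Implicit Types (a b d e g x : V) (w y z : gl V) (J K L X Y : set V).
Implicit Types (U P : set (gl V)).
Local Notation B := (Defs.bform D).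
Local Notation Pi := (simple D).
Local Notation pos := (pos_roots D).
Local Notation grp := (std_parabolic D).
Local Notation posin X := (pos_roots_in D (std_parabolic D X)).
Local Notation newpos := (newpos (D := D)).

Lemma newpos_finite_conj J U w : weyl D w -> finite_set (newpos J U) ->
  finite_set (newpos (w @` J) (conj_set w U)).
Proof.
move=> Ww fin.
have : finite_set ((w : V -> V) @` newpos J U `|`
    (fun d => - w d) @` newpos J U).
  by rewrite finite_setU; split; exact: finite_image.
apply: sub_finite_set => e [pe]; have re := pos_root pe.
have WV := weylV Ww; have rd := roots_act WV re.
rewrite -{1 2}(glKV w e) conj_srefl // grp_image_srefl // => Ud Jd.
have [pd|pN] := root_sign rd.
  by left; exists (w^-1 e)%g; rewrite ?glKV.
right; exists (- (w^-1 e)%g); rewrite ?glN ?glKV ?opprK //.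
by split; rewrite ?sreflN.
Qed.

Lemma fam_R (X : fam_kind) J U : fam D X J U -> R_ D J U.
Proof. by case: X => /= [|[]|[]|[]|[[]]]. Qed.

Lemma fam_conj (X : fam_kind) J U w : J `<=` Pi -> weyl D w -> w @` J `<=` Pi ->
  fam D X J U -> fam D X (w @` J) (conj_set w U).
Proof.
move=> JPi Ww KPi; have WV := weylV Ww.
have RC U' : R_ D J U' -> R_ D (w @` J) (conj_set w U') by exact: R_conj.
have parC U' : parabolic D U' -> parabolic D (conj_set w U').
  move=> [z [L [Wz LPi ->]]]; exists (w * z)%g, L.
  rewrite conj_setM; split=> //.
  exact: weylM.
have finC U' : finite_set ((U' `\` grp J) `&` refls D) ->
    finite_set ((conj_set w U' `\` grp (w @` J)) `&` refls D).
  by move=> /newpos_finite/(newpos_finite_conj Ww)/newpos_finite.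
case: X => /=.
- exact: RC.
- move=> [RU max]; split=> [|U' RU' sub]; first exact: RC.
  have JK : w^-1%g @` (w @` J) = J by exact: image_weylV.
  have RV : R_ D J (conj_set w^-1%g U').
    by rewrite -JK; apply: R_conj; rewrite ?JK.
  rewrite -(max _ RV); last first.
    by rewrite -{1}(conj_setK w U); exact: conj_set_mono.
  by rewrite -{1}[w]invgK conj_setK.
- by move=> [RU fin]; split; [exact: RC | exact: finC].
- by move=> [RU par]; split; [exact: RC | exact: parC].
- move=> [[RU par] [_ fin]].
  by split; split; [exact: RC | exact: parC | exact: RC | exact: finC].
Qed.

(** The factor [y] is the shortest element of its coset: an element of [L] that
    is made negative gives a shorter representative. *)
Lemma coset_rep L w : L `<=` Pi -> weyl D w -> exists y z,
  [/\ weyl D y, grp L z, w = (y * z)%g, forall l, L l -> pos (y l)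
    & (len D y <= len D w)%N /\
      ((exists2 l, L l & ~ pos (w l)) -> (len D y < len D w)%N)].
Proof.
move=> LPi; have [n] := ubnP (len D w); elim: n w => // n IHn w lw Ww.
have [[l Ll nl]|none] := pselect (exists2 l, L l & ~ pos (w l)); last first.
  exists w, 1%g; split=> //; [exact: gen1 | by rewrite mulg1 |].
  by move=> l Ll; apply: contrapT => nl; apply: none; exists l.
have Pl := LPi _ Ll; have lt := len_exchange Ww (simple_pos Pl) nl.
have Wsl : weyl D (w * srefl D l)%g.
  by apply: weylM => //; exact: weyl_srefl (simple_root Pl).
have [|y [z [Wy Lz e yL [ly _]]]] := IHn (w * srefl D l)%g _ Wsl.
  exact: leq_trans lt lw.
have ltw : (len D y < len D w)%N by exact: leq_ltn_trans ly lt.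
exists y, (z * srefl D l)%g; split=> //; last by split=> //; exact: ltnW.
- by apply: genM => //; exact: gen_refl.
- by rewrite mulgA -e -mulgA reflM mulg1.
Qed.

Lemma grp_rootsin L z d : L `<=` Pi -> grp L z -> roots_in D (grp L) d ->
  roots_in D (grp L) (z d).
Proof. by move=> /simple_roots_sub LR; exact: canon_act. Qed.

Lemma simple_rootsin L l : L `<=` Pi -> L l -> roots_in D (grp L) l.
Proof.
by move=> LPi Ll; split; [exact/simple_root/LPi | exact: grp_srefl].
Qed.

Lemma simple_newpos J a : J `<=` Pi -> Pi a -> ~ J a ->
  newpos J (grp (J `|` [set a])) a.
Proof.
move=> JPi Pa nJa; have LPi : J `|` [set a] `<=` Pi by move=> x [/JPi|->].
split; [exact: simple_pos | by apply: grp_srefl; right |].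
move=> Ja; apply: nJa.
apply: (simple_in_parabolic JPi _ _ Ja (X := J `|` [set a])).
  by left.
by rewrite canon_std //; right.
Qed.

(** An element of greatest length among the [z] in the parabolic subgroup of
    [L] with [z K > 0], which exists by finiteness, plays the role of the
    product of the longest elements of [L] and [K]. *)
Lemma longest_coset K L : K `<=` L -> L `<=` Pi ->
  finite_set (newpos K (grp L)) -> exists z,
  [/\ grp L z, z @` K `<=` L & forall d, newpos K (grp L) d -> ~ pos (z d)].
Proof.
move=> KL LPi /finite_seqP[r er].
have KPi : K `<=` Pi by move=> k /KL/LPi.
have [z [Lz Kz zmax]] : exists z, [/\ grp L z, forall k, K k -> pos (z k) &
    forall a, L a -> pos (z^-1 a)%g -> K (z^-1 a)%g].
  have : [set d | newpos K (grp L) d /\ pos ((1%g : gl V) d)] `<=` [set` r].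
    by rewrite -er => d [].
  have : forall k, K k -> pos ((1%g : gl V) k).
    by move=> k /KPi; exact: simple_pos.
  have : grp L 1%g by exact: gen1.
  move: (1%g : gl V) => z; clear er; have [n] := ubnP (size r).
  elim: n r z => // n IHn r z rn Lz Kz zr.
  have Wz := grp_weyl (simple_roots_sub LPi) Lz.
  have [[a [La pa nKa]]|none] :=
      pselect (exists a, [/\ L a, pos (z^-1 a)%g & ~ K (z^-1 a)%g]); last first.
    exists z; split=> // a La pa; apply: contrapT => nK.
    by apply: none; exists a.
  have Pa := LPi _ La; have ra := simple_root Pa.
  have newa : newpos K (grp L) (z^-1 a)%g.
    have [rza Lza] := grp_rootsin LPi (genV Lz) (simple_rootsin LPi La).
    split=> // Kza; apply: nKa; have pK : posin K (z^-1 a)%g by [].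
    by apply: (simple_preimage Kz (posin_std_cone KPi pK) _ Pa); rewrite glKV.
  apply: (IHn [seq d <- r | d != (z^-1 a)%g] (srefl D a * z)%g).
  - rewrite size_filter; move: rn; rewrite ltnS; apply: leq_trans.
    rewrite -(count_predC [pred d | d == (z^-1 a)%g] r) -addn1 addnC leq_add //.
    rewrite -has_count; apply/hasP; exists (z^-1 a)%g => //=.
    by apply: zr; rewrite /= glKV; split=> //; exact: simple_pos.
  - by apply: genM => //; exact: gen_refl.
  - move=> k Kk; have [e|//] := simple_srefl_pos Pa (Kz _ Kk).
    by case: nKa; rewrite -e glVK.
  move=> d [nd]; rewrite glME => pd; rewrite /= mem_filter; apply/andP; split.
    apply/eqP => e; move: pd; rewrite e glKV srefl_self //.
    exact/pos_opp/simple_pos.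
  apply: zr; split=> //; apply: contrapT => nzd.
  have pN := npos_opp (roots_act Wz (newpos_root nd)) nzd.
  have [e|] := simple_srefl_pos Pa pN; last by rewrite glN; exact: pos_opp.
  by have [+ _ _] := newa; rewrite -e glN glVK; apply/pos_opp; case: nd.
have Wz := grp_weyl (simple_roots_sub LPi) Lz; have WzV := weylV Wz.
exists z; rewrite /=.
(* the functional vanishing exactly on the roots of the subgroup of [K] *)
pose h a : R := if `[< K a >] then 0 else 1.
have [p pP pE] := root_functional_exists D h.
have p0 a : Pi a -> 0 <= p a by move=> /pE ->; rewrite /h; case: asboolP.
have pK a : Pi a -> p a = 0 -> K a.
  move=> /pE ->; rewrite /h; case: asboolP => // _ /eqP.
  by rewrite oner_eq0.
have Kp a : K a -> p a = 0.
  by move=> Ka; rewrite pE /h ?asboolT //; exact: KPi.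
have pzero d : pos d -> p d = 0 -> grp K (srefl D d).
  move=> pd /(root_functional_zero pP p0 pd).
  by apply: grp_mono => a [] /pK.
have Kin a : L a -> p (z^-1 a)%g = 0 -> K (z^-1 a)%g.
  move=> La e; have ra := simple_root (LPi _ La).
  apply: zmax => //; apply: contrapT => nd.
  have pN := npos_opp (roots_act WzV ra) nd.
  have : posin K (- (z^-1 a)%g).
    split=> //; split; first exact: pos_root.
    by apply: pzero => //; rewrite (root_functionalN pP) ?e ?oppr0 //;
       exact: roots_act.
  move=> /(posin_std_cone KPi) cN.
  have := pos_push Kz Wz cN (pos_root pN).
  by rewrite glN glKV; apply/pos_opp/simple_pos/LPi.
(* by maximality of [z], the functional [- p z^-1] is nonnegative on [L] *)
have LR := simple_roots_sub LPi; pose E := canon LR.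
have simpleE : simple E = L by exact: canon_std.
have fP : root_functional E (fun d => (- 1) * p (z^-1 d)%g + 0 * p (z^-1 d)%g).
  have fD := root_functional_comp pP WzV.
  move=> e d re rd; have rD x : roots E x -> roots D x.
    by rewrite canon_rootsE => -[].
  by have := root_functional_lin (-1) 0 fD fD; apply; exact: rD.
have f0 a : simple E a -> 0 <= (- 1) * p (z^-1 a)%g + 0 * p (z^-1 a)%g.
  rewrite simpleE mul0r addr0 mulN1r oppr_ge0 => La.
  have rza := roots_act WzV (simple_root (LPi _ La)).
  have [pza|nza] := pselect (pos (z^-1 a)%g).
    by rewrite Kp //; exact: zmax.
  have := root_functional_ge0 pP p0 (npos_opp rza nza).
  by rewrite (root_functionalN pP) // oppr_ge0.
have posE d : posin L d -> pos_roots E d by rewrite canon_posE.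
split=> //.
  move=> _ [k Kk <-]; have pzk : posin L (z k).
    split; last exact: Kz.
    by apply: grp_rootsin => //; apply: simple_rootsin => //; exact: KL.
  have := root_functional_zero fP f0 (posE _ pzk).
  rewrite glVK Kp // !mulr0 addr0 => /(_ erefl); rewrite simpleE => Gk.
  pose A := [set a | L a /\ p (z^-1 a)%g = 0].
  have {}Gk : grp A (srefl D (z k)).
    apply: grp_mono Gk => a [La]; rewrite mul0r addr0 mulN1r => /eqP.
    by rewrite oppr_eq0 => /eqP.
  have AK : z^-1%g @` A `<=` K by move=> _ [a [La pa] <-]; exact: Kin.
  have : grp (z^-1%g @` A) (srefl D (z^-1%g (z k))) by rewrite grp_image_srefl.
  rewrite glVK => /(simple_in_parabolic _ AK)[||a [La _] <-].
  - by move=> a /AK/KPi.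
  - by rewrite canon_std.
  - by rewrite glKV.
move=> d nd pzd; have [pd Ld Kd] := nd.
have pzdL : posin L (z d).
  by split=> //; apply: grp_rootsin => //; exact: newpos_in nd.
have := root_functional_ge0 fP f0 (posE _ pzdL).
rewrite glVK mul0r addr0 mulN1r oppr_ge0 => le0.
apply: Kd; apply: pzero => //; apply/eqP; rewrite eq_le le0.
exact: (root_functional_ge0 pP p0 pd).
Qed.

End Closures.

(** * Finite parabolic subgroups over [J] *)

Section RealSubgroups.
Context {R : realType} {V : lmodType R} {D : based_root_system V}.
Implicit Types (a b d e g x : V) (w y z : gl V) (J K L X Y : set V).
Implicit Types (U P : set (gl V)).
Local Notation B := (Defs.bform D).
Local Notation Pi := (simple D).
Local Notation pos := (pos_roots D).
Local Notation grp := (std_parabolic D).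
Local Notation posin X := (pos_roots_in D (std_parabolic D X)).
Local Notation newpos := (newpos (D := D)).

Lemma Q_P J U : Q_ D J U <->
  [/\ R_ D J U, parabolic D U & finite_set (newpos J U)].
Proof.
split=> [[[RU par] [_ /newpos_finite fin]] //|[RU par /newpos_finite fin]].
by split; split.
Qed.

Lemma std_parabolicP L : L `<=` Pi -> parabolic D (grp L).
Proof.
by move=> LPi; exists 1%g, L; rewrite conj_set1; split=> //; exact: weyl1.
Qed.

Lemma srefl_image_in L J (y : gl V) : J `<=` Pi -> L `<=` Pi -> weyl D y ->
    (forall l, L l -> pos (y l)) ->
    (forall j, J j -> roots_in D (grp L) (y^-1 j)%g) ->
  (y^-1)%g @` J `<=` L.
Proof.
move=> JPi LPi Wy yL Jin _ [j Jj <-]; have [rj Lj] := Jin _ Jj.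
have pj : posin L (y^-1 j)%g.
  apply: (pos_pull LPi yL Wy rj Lj); rewrite glKV.
  exact/simple_pos/JPi.
apply: (simple_preimage yL (posin_std_cone LPi pj) _ (JPi _ Jj)).
by rewrite glKV.
Qed.

(** Factor [w] through the standard parabolic subgroup of [J] and a simple root
    inverted by [w].  If the first factor inverts [d], this subgroup will do:
    it adds finitely many roots to [J] because by [R_sign] the first factor
    inverts them all.  Otherwise one goes on with the second factor, which is
    shorter than [w]. *)
Lemma Q_closure J w d : J `<=` Pi -> weyl D w -> w @` J `<=` Pi -> pos d ->
  ~ grp J (srefl D d) -> ~ pos (w d) -> exists2 P, Q_ D J P & newpos J P d.
Proof.
have [n] := ubnP (len D w); elim: n w J d => // n IHn w J d.
move=> wn JPi Ww KPi pd Jd nwd.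
have [w1|[z0 [a [_ Pa pa _ ew]]]] := weyl_step Ww; first by rewrite w1 in nwd.
have ra := simple_root Pa.
have nwa : ~ pos (w a) by rewrite ew glME srefl_self // glN; exact: pos_opp.
have nJa : ~ J a by move=> Ja; apply/nwa/simple_pos/KPi; exists a.
pose L := J `|` [set a]; have LPi : L `<=` Pi by move=> x [/JPi|->].
have [y [z [Wy Lz e yL [_ lt]]]] := coset_rep LPi Ww.
have {}lt : (len D y < len D w)%N by apply: lt; exists a => //; right.
have Wz := grp_weyl (simple_roots_sub LPi) Lz.
have zJL : z @` J `<=` L.
  move=> _ [k Jk <-]; have Lk : L k by left.
  have [rk gk] := grp_rootsin LPi Lz (simple_rootsin LPi Lk).
  have Pwk : Pi (y (z k)) by apply: KPi; exists k; rewrite // e glME.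
  have pk := pos_pull LPi yL Wy rk gk (simple_pos Pwk).
  exact: (simple_preimage yL (posin_std_cone LPi pk) erefl Pwk).
have zJPi : z @` J `<=` Pi by move=> k /zJL/LPi.
have [nzd|pzd] := pselect (~ pos (z d)).
  have newa : newpos J (grp L) a by exact: simple_newpos.
  have RL : R_ D J (grp L) by case: newa => _ _; exact: R_grp.
  have nza : ~ pos (z a).
    move=> pza; apply: nwa; rewrite e glME.
    have La : L a by right.
    have [rza gza] := grp_rootsin LPi Lz (simple_rootsin LPi La).
    by apply: (pos_push yL Wy _ rza); apply: (posin_std_cone LPi).
  exists (grp L); last by split=> //; exact: inversion_in nzd.
  apply/Q_P; split=> //; first exact: std_parabolicP.
  apply: sub_finite_set (inversions_finite Wz) => x nx.
  split; first by case: nx.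
  by move=> /(R_sign JPi RL Wz zJPi nx newa).
move: pzd => /contrapT pzd.
have yK : y @` (z @` J) = w @` J.
  by rewrite image_comp; congr image; apply/funext => x; rewrite e.
have [||||P QP nP] := IHn y (z @` J) (z d) _ zJPi Wy _ pzd.
- exact: leq_trans lt wn.
- by rewrite yK.
- by rewrite grp_image_srefl.
- by rewrite -glME -e.
have WV := weylV Wz; have JE := image_weylV z J.
exists (conj_set z^-1%g P).
  by rewrite -JE; apply: (fam_conj (X := FamQ)); rewrite ?JE.
rewrite -{1}JE -{1}(glVK z d); apply: newpos_conj => //.
by rewrite glVK.
Qed.

(** Let [y] be the shortest representative of the coset of an element that
    conjugates a standard parabolic subgroup to [P].  It preserves the signs of
    the roots of [L], and since simple roots are extremal, the elements of [J]
    can only be images of elements of [L]. *)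
Lemma parabolic_normal J P : J `<=` Pi -> grp J `<=` P -> parabolic D P ->
  exists y L, [/\ weyl D y, L `<=` Pi, P = conj_set y (grp L),
    forall l, L l -> pos (y l) & (y^-1)%g @` J `<=` L].
Proof.
move=> JPi JP [w [L [Ww LPi eP]]].
have [y [z [Wy Lz e yL _]]] := coset_rep LPi Ww.
have eP' : P = conj_set y (grp L).
  rewrite eP e conj_setM; congr conj_set; apply/seteqP; split.
    by move=> _ [u Lu <-]; apply: genM; [exact: genM | exact: genV].
  move=> u Lu; exists (z^-1 * u * z)%g; last first.
    by rewrite !mulgA mulgV mul1g mulgK.
  by apply: genM => //; apply: genM => //; exact: genV.
exists y, L; split=> //; apply: srefl_image_in => // j Jj.
have WV := weylV Wy; split.
  by apply: roots_act => //; exact/simple_root/JPi.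
rewrite -[grp L](conj_setK y) conj_srefl // -eP'; apply: JP.
exact: grp_srefl.
Qed.

(** By [parabolic_normal] some morphism [y] carries [P] to a standard parabolic
    subgroup.  Let [w] be [y] followed by the longest element of this subgroup
    modulo [y J]; the latter inverts roots of this subgroup only, and all those
    that are new. *)
Lemma Q_separation J P : J `<=` Pi -> Q_ D J P -> exists y w,
  [/\ weyl D y /\ y @` J `<=` Pi, weyl D w /\ w @` J `<=` Pi,
    forall d, newpos J P d -> pos (y d) /\ ~ pos (w d)
  & forall d, pos d -> pos (y d) -> ~ pos (w d) -> P (srefl D d)].
Proof.
move=> JPi /Q_P[RP par fin].
have [_ JP _] := RP.
have [x [L [Wx LPi eP xL KL]]] := parabolic_normal JPi JP par.
have WV := weylV Wx; set y := (x^-1)%g in KL WV *; set K := y @` J in KL.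
have ePy : conj_set y P = grp L by rewrite eP conj_setK.
have newK d : newpos J P d -> newpos K (grp L) (y d).
  move=> nd; have [pd Pd Jd] := nd; rewrite -ePy; apply: newpos_conj => //.
  have rd := roots_act WV (pos_root pd).
  have Ld : grp L (srefl D (y d)) by rewrite -ePy conj_srefl.
  suff : posin L (y d) by case.
  by apply: (pos_pull LPi xL Wx rd Ld); rewrite glKV.
have finK : finite_set (newpos K (grp L)).
  by rewrite -ePy; exact: newpos_finite_conj.
have [z [Lz zKL zneg]] := longest_coset KL LPi finK.
have Wz := grp_weyl (simple_roots_sub LPi) Lz.
exists y, (z * y)%g; split.
- by split=> // k /KL/LPi.
- split; first exact: weylM.
  move=> _ [j Jj <-]; apply: LPi; apply: zKL; exists (y j) => //.
  by exists j.
- by move=> d /newK nd; split; [case: nd | rewrite glME; exact: zneg].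
move=> d pd pyd; rewrite glME => nzd.
have := inversion_in LPi Lz pyd nzd.
by rewrite -ePy conj_srefl.
Qed.

Lemma R_incl J U b : R_ D J U -> U (srefl D b) -> grp (J `|` [set b]) `<=` U.
Proof.
move=> [rU JU _] Ub; rewrite rU; apply: smallest_sub.
  exact: gen_subgroup.
move=> _ [a [Ja|->] <-]; rewrite -rU //; apply: JU; exact: grp_srefl.
Qed.

(** Where the signs of [U] and [P] agree, the root of [U] passes the test of
    [Q_separation] for membership in [P]. *)
Lemma Q_sub J U P : J `<=` Pi -> R_ D J U -> Q_ D J P ->
  (forall w d e, weyl D w -> w @` J `<=` Pi -> newpos J P d -> newpos J U e ->
    pos (w d) <-> pos (w e)) -> U `<=` P.
Proof.
move=> JPi RU QP same; have [RP _ _] := (Q_P _ _).1 QP.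
have [y [w [[Wy yJ] [Ww wJ] yw Pin]]] := Q_separation JPi QP.
have [d nd _] := R_ex JPi RP; have [e ne ->] := R_ex JPi RU.
have [pyd nwd] := yw _ nd; apply: R_incl => //; apply: Pin.
- by case: ne.
- exact/(same y d e Wy yJ nd ne).
- by move=> /(same w d e Ww wJ nd ne).
Qed.

Lemma Q_eq J P P' : J `<=` Pi -> Q_ D J P -> Q_ D J P' ->
  (forall w d e, weyl D w -> w @` J `<=` Pi -> newpos J P d -> newpos J P' e ->
    pos (w d) <-> pos (w e)) -> P = P'.
Proof.
move=> JPi QP QP' same; have [RP _ _] := (Q_P _ _).1 QP.
have [RP' _ _] := (Q_P _ _).1 QP'.
apply/seteqP; split; apply: (Q_sub JPi) => // w d e Ww wJ nd ne.
by apply: iff_sym; exact: same.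
Qed.

(** After transport along a morphism, [U] is the standard parabolic subgroup of
    some [L] properly containing [J].  The elements of [L] are simple in any
    larger reflection subgroup, and one in [R_ D J] has a single simple root
    outside [J]. *)
Lemma P_sub_M J U : J `<=` Pi -> P_ D J U -> M_ D J U.
Proof.
move=> JPi [RU par]; split=> // U' RU' UU'.
apply/seteqP; split=> //; have [_ JU _] := RU.
have [y [L [Wy LPi eU yL KL]]] := parabolic_normal JPi JU par.
have WV := weylV Wy; set K := _ @` J in KL.
have KPi : K `<=` Pi by move=> k /KL/LPi.
have RK : R_ D K (conj_set y^-1%g U') by exact: R_conj.
have [g [[_ _ nKg] eU' CX]] := R_canon KPi RK.
have eL : conj_set y^-1%g U = grp L by rewrite eU conj_setK.
have LU' : grp L `<=` grp (K `|` [set g]).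
  by rewrite -eU' -eL; exact: conj_set_mono.
have gR : K `|` [set g] `<=` roots D.
  move=> k [/KPi/simple_root//|->].
  have : canon_simple (D := D) (K `|` [set g]) g by rewrite CX; right.
  by move=> [/pos_in/pos_root].
have LK l : L l -> K l \/ l = g.
  move=> Ll; have Pl := LPi _ Ll.
  have : canon_simple (D := D) (K `|` [set g]) l.
    split; last by move=> d /pos_in; exact: simple_srefl_pos.
    split; last exact: simple_pos.
    by split; [exact: simple_root | apply: LU'; exact: grp_srefl].
  by rewrite CX.
have Lg : L g.
  apply: contrapT => nLg.
  have LK' : L `<=` K by move=> l /[dup] Ll /LK[//|lg]; rewrite -lg in nLg.
  have RKU : R_ D K (conj_set y^-1%g U) by exact: R_conj.
  have [b [_ + nb] _] := R_ex KPi RKU; rewrite eL => Lb.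
  by apply: nb; exact: grp_mono Lb.
have sub : conj_set y^-1%g U' `<=` conj_set y^-1%g U.
  by rewrite eU' eL; apply: grp_mono => k [/KL|->].
move=> u U'u; apply/(conj_setE y^-1%g); apply: sub.
exact/(conj_setE y^-1%g).
Qed.

End RealSubgroups.

(** * Finite subgroups give real roots *)

Section FiniteReal.
Context {R : realType} {V : lmodType R} {D : based_root_system V}.
Implicit Types (a b d e g : V) (w x y z : gl V) (J K L X Y : set V).
Implicit Types (U P : set (gl V)).
Local Notation B := (Defs.bform D).
Local Notation Pi := (simple D).
Local Notation pos := (pos_roots D).
Local Notation grp := (std_parabolic D).
Local Notation posin X := (pos_roots_in D (std_parabolic D X)).
Local Notation newpos := (newpos (D := D)).

(** The reflection in a simple root at which [q] is negative permutes the other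
    positive roots, so it lowers the number of positive roots at which the
    functional is negative. *)
Lemma dominant_conj (q : V -> R) : root_functional D q ->
  finite_set [set d | pos d /\ q d < 0] ->
  exists2 w, weyl D w & forall a, Pi a -> 0 <= q (w a).
Proof.
move=> qP /finite_seqP[r er].
have : [set d | pos d /\ q d < 0] `<=` [set` r] by rewrite er.
clear er; have [n] := ubnP (size r); elim: n q r qP => // n IHn q r qP rn qr.
have [[a [Pa qa]]|none] := pselect (exists a, Pi a /\ q a < 0); last first.
  exists 1%g; first exact: weyl1.
  by move=> a Pa; rewrite leNgt; apply/negP => qa; apply: none; exists a.
have ra := simple_root Pa; have Wa := weyl_srefl ra.
pose r' := [seq d <- r | d != a].
have [|||w Ww wq] := IHn (fun d => q (srefl D a d)) (map (srefl D a) r').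
- exact: root_functional_comp.
- rewrite size_map size_filter; move: rn; rewrite ltnS; apply: leq_trans.
  rewrite -(count_predC [pred d | d == a] r) -addn1 addnC leq_add //.
  rewrite -has_count; apply/hasP; exists a => //=.
  by apply: qr; split=> //; exact: simple_pos.
- move=> d [pd qd] /=; rewrite -[d](sreflK (D := D) a); apply: map_f.
  have da : d <> a.
    move=> da; move: qd; rewrite da srefl_self // (root_functionalN qP) //.
    by rewrite oppr_lt0 => qa'; have := lt_trans qa qa'; rewrite ltxx.
  have [//|psd] := simple_srefl_pos Pa pd.
  rewrite mem_filter; apply/andP; split; last by apply: qr.
  apply/eqP => e; apply: (pos_opp pd); have <- : srefl D a a = d.
    by rewrite -{2}e sreflK.
  by rewrite srefl_self // opprK; exact: simple_pos.
exists (srefl D a * w)%g; first exact: weylM.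
by move=> b /wq; rewrite glME.
Qed.

Lemma finite_separated (T : Type) (A : set T) (F : set V)
    (inv : T -> set V) : finite_set F ->
  (forall s t, A s -> A t -> (forall d, F d -> inv s d <-> inv t d) -> s = t) ->
  finite_set A.
Proof.
move=> /finite_seqP[r er] inj.
pose f t := [tuple of [seq `[< inv t d >] | d <- in_tuple r]].
have : (f @` A #= A)%card.
  apply: inj_card_eq => s t; rewrite !inE => As At e; apply: inj => // d.
  rewrite er /= => dr.
  have : [seq `[< inv s d >] | d <- r] = [seq `[< inv t d >] | d <- r].
    by have := congr1 val e.
  move=> /eq_in_map/(_ d dr) ed.
  by split=> /asboolP h; apply/asboolP; rewrite ?ed // -ed.
by move=> /eq_finite_set <-; exact: finite_finset.
Qed.

(** If [U] adds finitely many positive roots to [J], then the average [q] over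
    the cosets of [J] in [U] of the functional [p] that is [0] on [J] and [1]
    on the other simple roots vanishes on [U], and it is positive on all but
    finitely many positive roots outside [J].  Moving [q] into the fundamental
    chamber turns [J] into a set of simple roots on which the longest element
    of the parabolic subgroup fixing [q] can act. *)
Lemma finite_real J U : J `<=` Pi -> R_ D J U -> finite_set (newpos J U) ->
  exists w, [/\ weyl D w, w @` J `<=` Pi &
    forall d, newpos J U d -> ~ pos (w d)].
Proof.
move=> JPi RU fin; have [g [ng eU CX]] := R_canon JPi RU; subst U.
set X := J `|` [set g] in ng CX RU fin *.
have XR : X `<=` roots D.
  by move=> a [/JPi/simple_root|->] //; exact: newpos_root ng.
pose E := canon XR; have posE : pos_roots E = posin X by exact: canon_posE.
have JX j : J j -> posin X j.
  move=> Jj; have Pj := JPi _ Jj; split; last exact: simple_pos.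
  by split; [exact: simple_root | by apply: grp_srefl; left].
have weylX x : grp X x -> weyl D x by exact: grp_weyl.
(* the minimal coset representatives, identified by the roots they invert *)
pose Xs : set (gl V) := [set x | grp X x /\ forall j, J j -> pos (x j)].
have Xs1 : Xs 1%g by split; [exact: gen1 | move=> j /JPi/simple_pos].
have finXs : finite_set Xs.
  apply: (@finite_separated _ _ _ (fun x => [set d | pos (x d)]) fin).
  move=> x x' [Ux xJ] [Ux' x'J] same; have Wx := weylX _ Ux.
  have Wx' := weylX _ Ux'.
  have samep d : posin X d -> pos (x d) <-> pos (x' d).
    move=> [[rd Xd] pd]; have [Jd|nJd] := pselect (grp J (srefl D d)).
      have cd : cone J d by apply: (posin_std_cone JPi).
      by split=> _; apply: pos_push cd rd.
    exact: same.
  have sames d : roots_in D (grp X) d -> pos (x d) -> pos (x' d).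
    move=> [rd Xd] pxd; have [pd|pN] := root_sign rd; first by apply/samep.
    apply: contrapT => nd; have := npos_opp (roots_act Wx' rd) nd.
    rewrite -glN; have pNX : posin X (- d).
      by split=> //; split; [exact: roots_opp | rewrite sreflN].
    by move=> /(samep _ pNX); rewrite glN; exact: pos_opp.
  have Uxx : grp X (x' * x^-1)%g by apply: genM => //; exact: genV.
  have : weyl E (x' * x^-1)%g by rewrite canon_weylE.
  move=> /weyl_step[/divg1_eq -> //|[z [a [Wz Ca pa _ e]]]].
  have [Xa _] : canon_simple (D := D) X a by [].
  have ra := pos_root (pos_in Xa).
  have pxa : pos ((x' * x^-1)%g a).
    rewrite glME; apply: sames; last by rewrite glKV; exact: pos_in Xa.
    by apply: canon_act => //; [exact: genV | case: Xa].
  move: pa; rewrite posE => /pos_in pza.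
  by case: (pos_opp pza); rewrite -glN -[X in z X](srefl_self ra) -glME -e.
pose h a : R := if `[< J a >] then 0 else 1.
have [p pP pE] := root_functional_exists D h.
have p0 a : Pi a -> 0 <= p a by move=> /pE ->; rewrite /h; case: asboolP.
have Jp a : J a -> p a = 0.
  by move=> Ja; rewrite pE /h ?asboolT //; exact: JPi.
have pzero d : pos d -> p d = 0 -> grp J (srefl D d).
  move=> pd /(root_functional_zero pP p0 pd).
  apply: grp_mono => a [/pE ->]; rewrite /h; case: asboolP => // _ /eqP.
  by rewrite oner_eq0.
have JR : J `<=` roots D by exact: simple_roots_sub.
have pJ d : roots D d -> grp J (srefl D d) -> p d = 0.
  by move=> rd Jd; apply: (root_functional_in0 pP JR Jp).
pose q d := \sum_(x \in Xs) p (x^-1 d)%g.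
pose sXs := finmap.enum_fset (fset_set Xs).
have qE d : q d = \sum_(x <- sXs) p (x^-1 d)%g by exact: fsbig_finite.
have qP : root_functional D q.
  have := @root_functional_sum _ _ D _ sXs (fun x d => p (x^-1 d)%g).
  have -> : q = fun d => \sum_(x <- sXs) p (x^-1 d)%g.
    by apply/funext => d; exact: qE.
  apply=> x; rewrite in_fset_set // inE => -[Ux _].
  exact: (root_functional_comp pP (weylV (weylX _ Ux))).
(* left multiplication by a simple reflection of [U] permutes the cosets *)
have qX e : X e -> q e = 0.
  move=> Xe; have [Xe' eP] : canon_simple (D := D) X e by rewrite CX.
  have [re Ue] := Xe'.1; have We := weyl_srefl re.
  pose phi x := if `[< grp J (srefl D (x^-1 e)%g) >] then x
    else (srefl D e * x)%g.
  have phiV x : ((srefl D e * x)^-1 e)%g = - (x^-1 e)%g.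
    by rewrite invgM glME [(srefl D e)^-1%g]reflV srefl_self // glN.
  have phiK x : phi (phi x) = x.
    rewrite {2}/phi; case: asboolP => Jx; first by rewrite /phi asboolT.
    by rewrite /phi asboolF ?phiV ?sreflN // mulgA reflM mul1g.
  have phiX x : Xs x -> Xs (phi x).
    move=> [Ux xJ]; rewrite /phi; case: asboolP => // Jx; split.
      exact: genM.
    move=> j Jj; have rxj : posin X (x j).
      by split; [apply: canon_act => //; case: (JX _ Jj) | exact: xJ].
    have [xje|//] := eP _ rxj.
    by case: Jx; rewrite -xje glVK; exact: grp_srefl.
  have bij : set_bij Xs Xs phi.
    split=> [x /phiX //|x x' _ _ /(congr1 phi)|x Xx]; first by rewrite !phiK.
    by exists (phi x); [exact: phiX | exact: phiK].
  have : q e = \sum_(x \in Xs) p ((phi x)^-1 e)%g.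
    exact: (reindex_fsbig phi Xs Xs (fun x => p (x^-1 e)%g)).
  rewrite fsbig_finite // (eq_big_seq (fun x => - p (x^-1 e)%g)).
    by rewrite sumrN -qE => qe; lra.
  move=> x; rewrite in_fset_set // inE => -[Ux xJ].
  have rxe : roots D (x^-1 e)%g.
    by apply: roots_act => //; exact: (weylV (weylX _ Ux)).
  rewrite /phi; case: asboolP => Jx; first by rewrite pJ ?oppr0.
  by rewrite phiV (root_functionalN pP).
(* each of these roots is inverted by some [x^-1], since otherwise all terms of
   [q d] are nonnegative and the term of [1] is positive *)
pose bad : set V := [set d | [/\ pos d, ~ grp J (srefl D d) & q d <= 0]].
have finbad : finite_set bad.
  have : finite_set (\bigcup_(x in Xs) [set d | pos d /\ ~ pos (x^-1 d)%g]).
    apply: bigcup_finite => // x [Ux _].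
    by apply: inversions_finite; exact: (weylV (weylX _ Ux)).
  apply: sub_finite_set => d [pd Jd qd].
  apply: contrapT => none; move: qd; apply/negP; rewrite -ltNge qE.
  have pge x : Xs x -> 0 <= p (x^-1 d)%g.
    move=> Xx; apply: (root_functional_ge0 pP p0); apply: contrapT => nd.
    by apply: none; exists x.
  have pd0 : 0 < p d.
    rewrite lt_neqAle (root_functional_ge0 pP p0 pd) andbT eq_sym.
    by apply/eqP => /(pzero _ pd).
  have s1 : 1%g \in sXs by rewrite in_fset_set // inE.
  rewrite (bigD1_seq _ s1 (finmap.fset_uniq _)) invg1 gl1E.
  apply: ltr_wpDr => //; rewrite big_seq_cond; apply: sumr_ge0 => x /andP[+ _].
  by rewrite in_fset_set // inE; exact: pge.
have [w Ww wq] : exists2 w, weyl D w & forall a, Pi a -> 0 <= q (w a).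
  apply: dominant_conj => //; apply: sub_finite_set finbad => d [pd qd].
  split=> //; last exact: ltW.
  move=> Jd; move: qd; rewrite (root_functional_in0 qP XR qX) ?ltxx //.
  by split; [exact: pos_root | apply: grp_mono Jd => a; left].
pose L := [set a | Pi a /\ q (w a) = 0].
have LPi : L `<=` Pi by move=> a [].
have LR := simple_roots_sub LPi.
have [y [z [Wy Lz ew yL _]]] := coset_rep LPi Ww.
have qwP := root_functional_comp qP Ww.
have qy d : roots D d -> q (y d) = q (w d).
  move=> rd; have -> : y d = w (z^-1%g d) by rewrite ew glME glKV.
  apply: (root_functional_grp qwP LR) => // [a [] //|]; exact: genV.
have qyP := root_functional_comp qP Wy.
have qy0 a : Pi a -> 0 <= q (y a).
  by move=> Pa; rewrite qy; [exact: wq | exact: simple_root].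
have qyL d : pos d -> q (y d) = 0 -> grp L (srefl D d).
  move=> pd /(root_functional_zero qyP qy0 pd); apply: grp_mono => a [Pa qa].
  by split=> //; rewrite -qy //; exact: simple_root.
have WV := weylV Wy.
have qL d : roots D d -> q d = 0 -> grp L (srefl D (y^-1 d)%g).
  move=> rd qd; have rvd := roots_act WV rd.
  have [pvd|pN] := root_sign rvd; first by apply: qyL => //; rewrite glKV.
  rewrite -sreflN; apply: qyL => //.
  by rewrite glN glKV (root_functionalN qP) // qd oppr0.
have qin d : pos d -> q d = 0 -> posin L (y^-1 d)%g.
  move=> pd qd; have rd := pos_root pd.
  apply: (pos_pull LPi yL Wy); [exact: roots_act | exact: qL | by rewrite glKV].
have KL : y^-1%g @` J `<=` L.
  apply: (srefl_image_in JPi LPi Wy yL) => j Jj.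
  have rj := simple_root (JPi _ Jj).
  split; first exact: roots_act.
  by apply: qL => //; apply: qX; left.
have newg : newpos (y^-1%g @` J) (grp L) (y^-1 g)%g.
  have [pg _ Jg] := ng; have [[_ Lg] pvg] := qin _ pg (qX _ (or_intror erefl)).
  by split=> //; rewrite grp_image_srefl.
have finK : finite_set (newpos (y^-1%g @` J) (grp L)).
  apply: sub_finite_set (finite_image (y^-1%g : V -> V) finbad) => d [pd Ld nd].
  exists (y d); last by rewrite glVK.
  have rd := pos_root pd; have dL : posin L d by split.
  split.
  - exact: pos_push yL Wy (posin_std_cone LPi dL) rd.
  - by rewrite -(grp_image_srefl _ _ WV) glVK.
  - have L0 a : L a -> q (w a) = 0 by case.
    by rewrite qy // (root_functional_in0 qwP LR L0).
have [u [Lu uK uneg]] := longest_coset KL LPi finK.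
have Wu := grp_weyl LR Lu; have Wuy := weylM Wu WV.
have uyPi : (u * y^-1)%g @` J `<=` Pi.
  move=> _ [j Jj <-]; apply: LPi; apply: uK; exists (y^-1 j)%g => //.
exists (u * y^-1)%g; split=> // d nd.
move=> /(R_sign JPi RU Wuy uyPi nd ng).
by rewrite glME; exact: uneg.
Qed.

End FiniteReal.

(** * Sign patterns and real compressions *)

Section CrossParallel.
Context {G : groupoid}.

Definition cross_parallel T T' (X : signed_gset G T) (Y : signed_gset G T')
    a x y :=
  forall b (g : mor a b), pos (X b) (gact X g x) <-> pos (Y b) (gact Y g y).

Lemma cross_parallel_sym T T' (X : signed_gset G T) (Y : signed_gset G T')
    a x y :
  cross_parallel X Y a x y -> cross_parallel Y X a y x.
Proof. by move=> xy b g; apply: iff_sym. Qed.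

Lemma cross_parallel_pos T T' (X : signed_gset G T) (Y : signed_gset G T')
    a x y :
  car (X a) x -> car (Y a) y -> cross_parallel X Y a x y ->
  pos (X a) x <-> pos (Y a) y.
Proof. by move=> Xx Yy /(_ a (idm a)); rewrite !gact_id. Qed.

Lemma cross_parallel_real T T' (X : signed_gset G T) (Y : signed_gset G T')
    a x y :
  real_car X a x -> car (Y a) y -> cross_parallel X Y a x y ->
  real_car Y a y.
Proof.
move=> [Xx [b [g ng]]] Yy xy; split=> //; exists b, g => e; apply: ng.
by rewrite (xy b g) e (cross_parallel_pos Xx Yy xy).
Qed.

Definition match_class T T' (X : signed_gset G T) (Y : signed_gset G T')
    (a : G) (c : set T) : set T' :=
  [set y | real_car Y a y /\ exists2 x, c x & cross_parallel X Y a x y].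

Lemma match_classE T T' (X : signed_gset G T) (Y : signed_gset G T') a x y :
  real_car X a x -> real_car Y a y -> cross_parallel X Y a x y ->
  match_class X Y a (pclass X a x) = pclass Y a y.
Proof.
move=> rx ry xy; apply/seteqP; split=> [z [rz [x' [rx' xx'] x'z]]|z [rz yz]].
  by split=> // b g; rewrite -(xy b g) (xx' b g).
by split=> //; exists x => // b g; rewrite (xy b g).
Qed.

Lemma match_class_morphism T T' (X : signed_gset G T) (Y : signed_gset G T') :
  (forall a x, real_car X a x ->
    exists2 y, car (Y a) y & cross_parallel X Y a x y) ->
  sgset_morphism (real_compression X) (real_compression Y) (match_class X Y).
Proof.
move=> XY.
have XYr a x : real_car X a x ->
    exists2 y, real_car Y a y & cross_parallel X Y a x y.
  move=> rx; have [y Yy xy] := XY a x rx; exists y => //.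
  exact: cross_parallel_real rx Yy xy.
split=> [a _ [x rx <-]|a _ [x rx <-]|a _ [x [px rx] <-]|a b g _ [x rx <-]] /=.
- by have [y ry xy] := XYr a x rx; rewrite (match_classE rx ry xy); exists y.
- have [y ry xy] := XYr a x rx.
  have [rNx rNy] := (neg_real_car rx, neg_real_car ry).
  rewrite rec_negE // (match_classE rx ry xy) rec_negE //.
  apply: match_classE => // b g.
  by rewrite !act_pos_neg; [apply: not_iff_compat | case: ry | case: rx].
- have rcx : real_car X a x by exact: real_pos_car.
  have [y ry xy] := XYr a x rcx; rewrite (match_classE rcx ry xy).
  exists y => //; case: ry => Yy ry; split=> //.
  exact/(cross_parallel_pos rcx.1 Yy xy).
- have [y ry xy] := XYr a x rx.
  rewrite rec_actE // (match_classE rx ry xy) rec_actE //.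
  apply: match_classE; [exact: act_real_car..|] => c h.
  by rewrite -!gact_comp; [exact: xy | case: ry | case: rx].
Qed.

(** A class of parallel real roots is determined by the common sign pattern of
    its members, so both compressions are the set of patterns that occur. *)
Lemma real_compression_iso T T' (X : signed_gset G T) (Y : signed_gset G T') :
  (forall a x, real_car X a x ->
    exists2 y, car (Y a) y & cross_parallel X Y a x y) ->
  (forall a y, real_car Y a y ->
    exists2 x, car (X a) x & cross_parallel X Y a x y) ->
  sgset_iso (real_compression X) (real_compression Y).
Proof.
move=> XY YX.
have YX' a y : real_car Y a y ->
    exists2 x, car (X a) x & cross_parallel Y X a y x.
  by move=> /YX[x Xx xy]; exists x => //; exact: cross_parallel_sym.
exists (match_class X Y), (match_class Y X); split.
- exact: match_class_morphism.
- exact: match_class_morphism.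
- move=> a _ [x rx <-]; have [y Yy xy] := XY a x rx.
  have ry := cross_parallel_real rx Yy xy; rewrite (match_classE rx ry xy).
  exact: match_classE (cross_parallel_sym xy).
- move=> a _ [y ry <-]; have [x Xx yx] := YX' a y ry.
  have rx := cross_parallel_real ry Xx yx; rewrite (match_classE ry rx yx).
  exact: match_classE (cross_parallel_sym yx).
Qed.

Lemma real_compression_id (T : choiceType) (t0 : T) (X : signed_gset G T) :
  (forall a x, car (X a) x -> real_root X a x) ->
  (forall a x y, car (X a) x -> car (X a) y -> parallel X a x y -> x = y) ->
  sgset_iso (real_compression X) X.
Proof.
move=> Xr Xp.
have rcar a x : car (X a) x -> real_car X a x.
  by move=> Xx; split=> //; exact: Xr.
have get a x : car (X a) x -> xget t0 (pclass X a x) = x.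
  move=> Xx; case: xgetP => [y -> [[Xy _] xy]|/(_ x)[]].
    exact/esym/(Xp a).
  exact/pclass_self/rcar.
exists (fun a c => xget t0 c), (fun a x => pclass X a x); split.
- split=> [a _ [x [Xx _] <-]|a _ [x [Xx rx] <-]|a _ [x [px _] <-]|
      a b g _ [x [Xx rx] <-]] /=.
  + by rewrite get.
  + by rewrite rec_negE ?get //; exact: neg_car.
  + by rewrite get //; exact: pos_car.
  + by rewrite rec_actE ?get //; exact: gact_car.
- split=> [a x Xx|a x Xx|a x px|a b g x Xx] /=.
  + by exists x => //; exact: rcar.
  + by rewrite rec_negE //; exact: rcar.
  + by exists x => //; split=> //; apply: Xr; exact: pos_car.
  + by rewrite rec_actE //; exact: rcar.
- by move=> a _ [x [Xx _] <-]; rewrite get.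
- by move=> a x Xx; rewrite get.
Qed.

Lemma sgset_iso_trans T1 T2 T3 (X : signed_gset G T1) (Y : signed_gset G T2)
    (Z : signed_gset G T3) : sgset_iso X Y -> sgset_iso Y Z -> sgset_iso X Z.
Proof.
move=> [f [f' [[fc fn fp fa] [f'c f'n f'p f'a] ff' f'f]]].
move=> [h [h' [[hc hn hp ha] [h'c h'n h'p h'a] hh' h'h]]].
exists (fun a x => h a (f a x)), (fun a z => f' a (h' a z)); split.
- split=> [a x /fc/hc //|a x Xx|a x /fp/hp //|a b g x Xx].
    by rewrite fn // hn //; exact: fc.
  by rewrite fa // ha //; exact: fc.
- split=> [a x /h'c/f'c //|a x Xx|a x /h'p/f'p //|a b g x Xx].
    by rewrite h'n // f'n //; exact: h'c.
  by rewrite h'a // f'a //; exact: h'c.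
- by move=> a x Xx; rewrite hh' ?ff' //; exact: fc.
- by move=> a x Xx; rewrite f'f ?h'h //; exact: h'c.
Qed.

End CrossParallel.

(** * The signed groupoid-sets *)

Section UpsilonConstruction.
Context {R : realType} {V : lmodType R} {D : based_root_system V}.
Variable C : set (bh_full D).
Implicit Types (J K : bh_groupoid C) (U : set (gl V)) (X : fam_kind).
Local Notation Pi := (simple D).
Local Notation grp := (std_parabolic D).
Local Notation newpos := (newpos (D := D)).

Lemma bh_set_simple J : bh_set J `<=` Pi.
Proof. exact: svalP (sval J). Qed.

Lemma bh_mor_weyl J K (f : mor J K) : weyl D (bh_mor f).
Proof. exact: bh_weyl. Qed.

Lemma bh_mor_image J K (f : mor J K) : bh_mor f @` bh_set J = bh_set K.
Proof. exact: bh_image. Qed.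

Lemma bh_mor_simple J K (f : mor J K) : bh_mor f @` bh_set J `<=` Pi.
Proof. by rewrite bh_mor_image; exact: bh_set_simple. Qed.

Lemma etaE J K (f : mor J K) U d : R_ D (bh_set J) U ->
  newpos (bh_set J) U d ->
  eta D (bh_mor f) U (bh_set J) = ~~ `[< pos_roots D (bh_mor f d) >].
Proof.
move=> RU nd; have := R_eta (@bh_set_simple J) RU (bh_mor_weyl f)
  (@bh_mor_simple _ _ f) nd.
case: (eta _ _ _ _) => -[h1 h2].
  by apply/esym/asboolPn; exact: h1.
apply/esym/negbTE; rewrite negbK; apply/asboolP.
by apply: contrapT => /h2.
Qed.

Definition upsilon_sset X J : signed_set (set (gl V) * bool).
Proof.
apply: (@SignedSet _ (fam D X (bh_set J) `*` [set: bool])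
  (fam D X (bh_set J) `*` [set false]) (fun p => (p.1, ~~ p.2))).
- by move=> p [].
- by move=> p [].
- by move=> [U e] _ /=; rewrite negbK.
- by move=> [U []] _ [].
- move=> [U e] [/= fU _]; split=> [[_ /= e1] [_ /= e2]|h].
    by move: e1; rewrite e2.
  by split=> //=; case: e h => //= -[].
Defined.

Definition upsilon_act J K (f : mor J K) (p : set (gl V) * bool) :=
  (conj_set (bh_mor f) p.1, eta D (bh_mor f) p.1 (bh_set J) (+) p.2).

Lemma upsilon_act_car X J K (f : mor J K) U : fam D X (bh_set J) U ->
  fam D X (bh_set K) (conj_set (bh_mor f) U).
Proof.
move=> fU; rewrite -(bh_mor_image f); apply: fam_conj => //.
- exact: bh_set_simple.
- exact: bh_mor_weyl.
- exact: bh_mor_simple.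
Qed.

Lemma eta_comp J K L (g : mor K L) (f : mor J K) U : R_ D (bh_set J) U ->
  eta D (bh_mor (compm g f)) U (bh_set J) =
  eta D (bh_mor g) (conj_set (bh_mor f) U) (bh_set K) (+)
  eta D (bh_mor f) U (bh_set J).
Proof.
move=> RU; have [d nd _] := R_ex (@bh_set_simple J) RU.
have RU' : R_ D (bh_set K) (conj_set (bh_mor f) U).
  exact: (@upsilon_act_car FamR).
rewrite (etaE (compm g f) RU nd) (etaE f RU nd).
have rd := newpos_root nd; have Wf := bh_mor_weyl f; have Wg := bh_mor_weyl g.
have [pd|npd] := pselect (pos_roots D (bh_mor f d)).
  have := newpos_conj Wf nd pd; rewrite bh_mor_image => nd'.
  by rewrite (etaE g RU' nd') (asboolT pd) addbF.
have := newpos_conjN Wf nd npd; rewrite bh_mor_image => nd'.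
rewrite (etaE g RU' nd') (asboolF npd) addbT negbK glN.
rewrite -asbool_neg; apply: asbool_equiv_eq.
by rewrite (pos_roots_opp (roots_act Wg (roots_act Wf rd))).
Qed.

Definition upsilon X : signed_gset (bh_groupoid C) (set (gl V) * bool).
Proof.
apply: (@SignedGSet (bh_groupoid C) _ (upsilon_sset X) upsilon_act).
- by move=> J K f [U e] [/= fU _]; split=> //; exact: upsilon_act_car.
- by move=> J K f [U e] _ /=; rewrite /upsilon_act /= addbN.
- move=> J [U e] [/= /fam_R RU _]; rewrite /upsilon_act /=.
  have [d nd _] := R_ex (@bh_set_simple J) RU.
  rewrite (etaE (idm J) RU nd) [bh_mor _]/= conj_set1 asboolT //.
  by case: nd.
- move=> J K L g f [U e] [/= fU _]; congr pair; first exact: conj_setM.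
  by rewrite addbA; congr (_ (+) _); exact/eta_comp/(fam_R fU).
Defined.

Lemma upsilon_posE X J K (f : mor J K) U e d : fam D X (bh_set J) U ->
  newpos (bh_set J) U d ->
  pos (upsilon X K) (gact (upsilon X) f (U, e)) <->
  if e then ~ pos_roots D (bh_mor f d) else pos_roots D (bh_mor f d).
Proof.
move=> fU nd; have fU' := upsilon_act_car f fU.
have -> : pos (upsilon X K) (gact (upsilon X) f (U, e)) <->
    eta D (bh_mor f) U (bh_set J) (+) e = false.
  by split=> [[]//|h]; split.
rewrite (etaE f (fam_R fU) nd); case: e; case: asboolP => h; split=> //.
Qed.

Lemma morphism_exists J w : component_union C -> weyl D w ->
  w @` bh_set J `<=` Pi -> exists K (f : mor J K), bh_mor f = w.
Proof.
move=> [A eC] Ww wPi; pose K0 : bh_full D := exist _ (w @` bh_set J) wPi.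
pose f0 : bh_hom D (bh_set J) (w @` bh_set J) := BHHom Ww erefl.
have CK : C K0.
  have CJ : C (sval J) by exact: svalP.
  move: CJ; rewrite {1}eC => -[I AI [h]]; rewrite eC; exists I => //.
  by constructor; exact: (bh_comp f0 h).
by exists (exist _ K0 CK), f0.
Qed.

Lemma upsilon_real X J U e : component_union C -> fam D X (bh_set J) U ->
  real_root (upsilon X) J (U, e) <-> finite_set (newpos (bh_set J) U).
Proof.
move=> hC fU; have RU := fam_R fU; have JPi := @bh_set_simple J.
have [d nd _] := R_ex JPi RU.
have pU : pos (upsilon X J) (U, e) <-> e = false by split=> [[]//|h]; split.
split=> [[K [f]]|fin].
  rewrite (upsilon_posE f e fU nd) pU => flip.
  have nwd : ~ pos_roots D (bh_mor f d).
    by move=> pd; apply: flip; case: e {pU}; split.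
  apply: sub_finite_set (inversions_finite (bh_mor_weyl f)) => x nx.
  split; first by case: nx.
  by move=> /(R_sign JPi RU (bh_mor_weyl f) (@bh_mor_simple _ _ f) nx nd).
have [w [Ww wPi neg]] := finite_real JPi RU fin.
have [K [f ew]] := morphism_exists hC Ww wPi.
exists K, f; rewrite (upsilon_posE f e fU nd) pU ew.
have := neg _ nd; case: e {pU} => nwd [h1 h2]; last exact/nwd/h2.
by have := h1 nwd.
Qed.

Lemma finite_closure (J : set V) U d : J `<=` Pi -> R_ D J U ->
  finite_set (newpos J U) -> newpos J U d ->
  exists2 P, Q_ D J P & newpos J P d.
Proof.
move=> JPi RU fin nd; have [w [Ww wPi neg]] := finite_real JPi RU fin.
by have [pd _ Jd] := nd; exact: Q_closure Ww wPi pd Jd (neg _ nd).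
Qed.

(** A maximal [U] adding finitely many roots is the parabolic subgroup that
    [Q_closure] provides for its new root. *)
Lemma finite_M_parabolic (J : set V) U : J `<=` Pi -> M_ D J U ->
  finite_set (newpos J U) -> P_ D J U.
Proof.
move=> JPi [RU Umax] fin; have [b nb eU] := R_ex JPi RU.
have [P QP [_ Pb _]] := finite_closure JPi RU fin nb.
have [RP par _] := (Q_P _ _).1 QP; have UP := R_incl RP Pb.
by rewrite -eU in UP; rewrite -(Umax _ RP UP).
Qed.

Lemma Q_fam X (J : set V) U : J `<=` Pi -> Q_ D J U -> fam D X J U.
Proof.
by move=> JPi [PU NU]; case: X => //=; [case: NU | exact: P_sub_M].
Qed.

Lemma upsilon_car X J p : car (upsilon X J) p <-> fam D X (bh_set J) p.1.
Proof. by split=> [[]|]. Qed.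

Lemma upsilon_incl X X' :
  (forall J, fam D X (bh_set J) `<=` fam D X' (bh_set J)) ->
  sgset_incl (upsilon X) (upsilon X').
Proof.
move=> XX'; exists (fun _ p => p); split=> //; split=> //.
  by move=> J p [/XX'].
by move=> J p [/XX'].
Qed.

Lemma upsilon_real_car X J p : component_union C ->
  car (real_part (upsilon X) J) p <->
  fam D X (bh_set J) p.1 /\ finite_set (newpos (bh_set J) p.1).
Proof.
move=> hC; case: p => U e; split=> [[[fU _]]|[fU fin]].
  by move=> /(upsilon_real e hC fU).
by split; [split | apply/(upsilon_real e hC fU)].
Qed.

Lemma upsilon_Q_parallel J p p' : component_union C ->
  car (upsilon FamQ J) p -> car (upsilon FamQ J) p' ->
  parallel (upsilon FamQ) J p p' ->
  p = p'.
Proof.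
move=> hC; case: p p' => [P e] [P' e'] [/= QP _] [/= QP' _] par.
have JPi := @bh_set_simple J.
have ee : e = e'.
  have := parallel_pos (x := (P, e)) (y := (P', e')) _ _ par.
  by move=> [] // h1 h2; case: e e' {par} h1 h2 => [] [] //= h1 h2;
    [have [] := h2 | have [] := h1].
subst e'; congr pair; apply: (Q_eq JPi) => // w d d' Ww wPi nd nd'.
have [K [f <-]] := morphism_exists hC Ww wPi.
have := par K f; rewrite (upsilon_posE (X := FamQ) f e QP nd)
  (upsilon_posE (X := FamQ) f e QP' nd').
by case: e {par} => // h; split=> hp; apply: contrapT => /h.
Qed.

(** The real root of [U] has the same signs under all morphisms as that of the
    finite parabolic subgroup containing [U], since both are the signs of a
    common root of [D]. *)
Lemma upsilon_rec_Q X : component_union C ->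
  sgset_iso (real_compression (upsilon X)) (upsilon FamQ).
Proof.
move=> hC; have XQ : sgset_iso (real_compression (upsilon X))
    (real_compression (upsilon FamQ)).
  apply: real_compression_iso => J [U e].
    move=> /(upsilon_real_car _ _ _ hC)[/= fU fin].
    have JPi := @bh_set_simple J; have RU := fam_R fU.
    have [d nd _] := R_ex JPi RU.
    have [P QP nP] := finite_closure JPi RU fin nd.
    exists (P, e) => // K f.
    by rewrite (upsilon_posE f e fU nd) (upsilon_posE f e (X := FamQ) QP nP).
  move=> /(upsilon_real_car _ _ _ hC)[/= QU fin]; have JPi := @bh_set_simple J.
  have fU : fam D X (bh_set J) U by exact: Q_fam.
  have [d nd _] := R_ex JPi (fam_R fU).
  exists (U, e) => // K f.
  by rewrite (upsilon_posE f e fU nd) (upsilon_posE f e (X := FamQ) QU nd).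
apply: sgset_iso_trans XQ _; apply: (real_compression_id (set0, false)).
  move=> J [U e] [/= QU _]; apply/(upsilon_real e hC (X := FamQ) QU).
  by case: ((Q_P _ _).1 QU).
by move=> J p p'; exact: upsilon_Q_parallel.
Qed.

(** A morphism maps [J] to simple roots, hence it preserves the signs of all
    roots of the parabolic subgroup of [J]. *)
Lemma Lambda_real_out J d : real_car (Lambda C) J d ->
  ~ grp (bh_set J) (srefl D d).
Proof.
move=> [rd [K [f flip]]] Jd; have JPi := @bh_set_simple J.
have keep x : roots D x -> grp (bh_set J) (srefl D x) -> pos_roots D x ->
    pos_roots D (bh_mor f x).
  move=> rx Jx px; have cx : cone (bh_set J) x by apply: (posin_std_cone JPi).
  apply: (pos_push _ (bh_mor_weyl f) cx rx) => l Jl.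
  by apply: simple_pos; apply: (@bh_mor_simple _ _ f); exists l.
apply: flip; split=> /= pd; last exact: keep.
apply: contrapT => nd; have pN := npos_opp rd nd.
have := keep _ (pos_root pN); rewrite sreflN glN => /(_ Jd pN).
exact: pos_opp.
Qed.

Lemma Lambda_rec_Ups X : component_union C ->
  sgset_iso (real_compression (Lambda C)) (real_compression (upsilon X)).
Proof.
move=> hC; apply: real_compression_iso => J.
  move=> d rcd; have Jd := Lambda_real_out rcd; have JPi := @bh_set_simple J.
  have closure x : real_car (Lambda C) J x -> pos_roots D x ->
      exists2 P, Q_ D (bh_set J) P & newpos (bh_set J) P x.
    move=> /[dup] /Lambda_real_out Jx [rx [K [f flip]]] px.
    apply: (Q_closure JPi (bh_mor_weyl f) (@bh_mor_simple _ _ f) px Jx) => pwx.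
    exact: flip.
  have rd : roots D d by case: rcd.
  have [pd|pN] := root_sign rd.
    have [P QP nP] := closure _ rcd pd; have fP := Q_fam X JPi QP.
    by exists (P, false) => // K f; rewrite (upsilon_posE f _ fP nP).
  have [P QP nP] := closure _ (neg_real_car rcd) pN; have fP := Q_fam X JPi QP.
  exists (P, true) => // K f; rewrite (upsilon_posE f _ fP nP) /=.
  have Wf := bh_mor_weyl f; rewrite glN (pos_roots_opp (roots_act Wf rd)).
  by split=> [pd /(_ pd)|] //; exact: contrapT.
move=> [U e] [[/= fU _] _]; have JPi := @bh_set_simple J.
have [d nd _] := R_ex JPi (fam_R fU); have rd := newpos_root nd.
exists (if e then - d else d); first by case: e; [exact: roots_opp | exact: rd].
move=> K f; rewrite (upsilon_posE f _ fU nd); case: e => //=.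
by rewrite glN (pos_roots_opp (roots_act (bh_mor_weyl f) rd)).
Qed.

Lemma upsilon_is_Upsilon X : is_Upsilon X (upsilon X).
Proof. by split. Qed.

Lemma eta0_disjoint X J K (f : mor J K) U : fam D X (bh_set J) U ->
  ~~ eta D (bh_mor f) U (bh_set J) ->
  (U `\` grp (bh_set J)) `&` Nset D (bh_mor f)^-1%g = set0.
Proof.
move=> fU neta; rewrite -subset0 => t [[Ut Jt] Nt].
have [/pos_refl[d pd td] _] := Nt; rewrite td in Ut Jt Nt.
have nd : newpos (bh_set J) U d by [].
move: neta; rewrite (etaE f (fam_R fU) nd) negbK => /asboolP pwd.
by move: Nt; rewrite (NsetE (weylV (bh_mor_weyl f)) pd) invgK.
Qed.

Lemma upsilon_real_eq X X' : component_union C ->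
  (forall J U, finite_set (newpos (bh_set J) U) ->
    fam D X (bh_set J) U <-> fam D X' (bh_set J) U) ->
  sgset_eq (real_part (upsilon X)) (real_part (upsilon X')).
Proof.
move=> hC XX'; have ecar J p : car (real_part (upsilon X) J) p <->
    car (real_part (upsilon X') J) p.
  rewrite !(upsilon_real_car _ _ _ hC).
  by split=> -[fU fin]; split=> //; apply/XX'.
have epos X0 J p : pos (real_part (upsilon X0) J) p <->
    car (real_part (upsilon X0) J) p /\ p.2 = false.
  by split=> [[[fU e] r]|[[[fU _] r] e]]; split.
split=> // J; split=> //; first by apply/seteqP; split=> p /ecar.
by apply/seteqP; split=> p /epos[/ecar cp e]; apply/epos.
Qed.

Lemma upsilon_real_fam X X' : component_union C ->
  (forall J U, fam D X (bh_set J) U /\ finite_set (newpos (bh_set J) U)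
    <-> fam D X' (bh_set J) U) -> sgset_eq (real_part (upsilon X)) (upsilon X').
Proof.
move=> hC XX'; have ecar J p : car (real_part (upsilon X) J) p <->
    car (upsilon X' J) p.
  by rewrite (upsilon_real_car _ _ _ hC) upsilon_car XX'.
split=> // J; split=> //; first by apply/seteqP; split=> p /ecar.
apply/seteqP; split=> p.
  move=> [[fU e] r]; split=> //.
  by apply/(upsilon_car X')/ecar; split=> //; split.
move=> [fU e]; have /ecar[[fXU _] r] : car (upsilon X' J) p by split.
by split.
Qed.

End UpsilonConstruction.

Theorem theorem1p33 (R : realType) (V : lmodType R) (D : based_root_system V)
    (C : set (bh_full D)) (hC : component_union C) :
  exists Upsilon :
    fam_kind -> signed_gset (bh_groupoid C) (set (gl V) * bool),
  [/\ (* the signed groupoid-sets (G, Upsilon_X) *)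
      forall X, is_Upsilon X (Upsilon X),
      (* the parenthetical remark in the definition of eta(w,U,J) *)
      forall X (J K : bh_groupoid C) (f : mor J K) (U : set (gl V)),
        fam D X (bh_set J) U -> ~~ eta D (bh_mor f) U (bh_set J) ->
        (U `\` std_parabolic D (bh_set J)) `&` Nset D (bh_mor f)^-1%g = set0
    & [/\ (* (a) *)
          forall X (J : bh_groupoid C) (U : set (gl V)) (e : bool),
            car (Upsilon X J) (U, e) ->
            (car (real_part (Upsilon X) J) (U, e) <->
              finite_set (pos_roots_in D U `\`
                          pos_roots_in D (std_parabolic D (bh_set J)))) /\
            (finite_set (pos_roots_in D U `\`
                         pos_roots_in D (std_parabolic D (bh_set J))) <->
              finite_set ((U `\` std_parabolic D (bh_set J)) `&` refls D)),
          (* (b) *)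
          [/\ sgset_incl (Upsilon FamQ) (Upsilon FamP),
              sgset_incl (Upsilon FamP) (Upsilon FamM),
              sgset_incl (Upsilon FamM) (Upsilon FamR),
              sgset_incl (Upsilon FamQ) (Upsilon FamN)
            & sgset_incl (Upsilon FamN) (Upsilon FamR)],
          (* (c) *)
          [/\ sgset_eq (real_part (Upsilon FamR)) (Upsilon FamN),
              sgset_eq (real_part (Upsilon FamM)) (real_part (Upsilon FamP))
            & sgset_eq (real_part (Upsilon FamP)) (Upsilon FamQ)]
        & (* (d) *)
          forall X,
            sgset_iso (real_compression (Lambda C))
                      (real_compression (Upsilon X)) /\
            sgset_iso (real_compression (Upsilon X)) (Upsilon FamQ)]].
Proof.
exists (upsilon C); split; first exact: upsilon_is_Upsilon.
  by move=> X J K f U; exact: eta0_disjoint.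
split.
- move=> X J U e [/= fU _]; rewrite -newposE newpos_finite.
  split; last by [].
  have := upsilon_real_car X J (U, e) hC; rewrite newpos_finite => -[h1 h2].
  by split=> [/h1[]|fin] //; exact: h2.
- split; apply: upsilon_incl => J U /=; first by case.
  + by apply: P_sub_M; exact: bh_set_simple.
  + by case.
  + by case.
  + by case.
- split.
  + apply: upsilon_real_fam => // J U /=; rewrite newpos_finite.
    by split=> [[]|[]].
  + apply: upsilon_real_eq => // J U fin /=.
    have JPi := @bh_set_simple _ _ _ _ J.
    by split=> [MU|PU]; [exact: finite_M_parabolic | exact: P_sub_M].
  + apply: upsilon_real_fam => // J U /=; rewrite newpos_finite.
    by split=> [[[RU par] fin]|[[RU par] [_ fin]]]; split.
- by move=> X; split; [exact: Lambda_rec_Ups | exact: upsilon_rec_Q].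
Qed.
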